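(* Let $N\in\mathbb{N}=\{1,2,\dots\}$. The polyanalytic RBF space $\mathcal{H}_N(\mathbb{C})$ is a reproducing kernel Hilbert space with reproducing kernel $K_{RBF,N}(z,w)=e^{-\frac{(z-\overline{w})^2}{4}}L^1_{N-1}\left(\frac{|z-w|^2}{2}\right)$, and the reproducing property is given by $$f(w)=\frac{1}{2\pi}\int_{\mathbb{C}}f(z)\,\overline{K_{RBF,N}(z,w)}\,\exp\left(\frac{(z-\overline{z})^2}{4}\right)d\lambda(z),\quad f\in\mathcal{H}_N(\mathbb{C}),\ w\in\mathbb{C}.$$ Moreover, for $\ell=1,\dots,N$, the true polyanalytic RBF space $\mathcal{H}^{(\ell)}_T(\mathbb{C})$ is a reproducing kernel Hilbert space whose reproducing kernel is $$\mathsf{K}_{\ell,T}(z,w)=L^0_{\ell-1}\left(\frac{|z-w|^2}{2}\right)e^{-\frac{(z-\overline{w})^2}{4}}.$$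
   Context: $d\lambda$ is Lebesgue measure on $\mathbb{C}$. A function on $\mathbb{C}$ is polyanalytic of order $N$ if it is $\mathcal{C}^N$ and $\frac{\partial^N}{\partial\overline{z}^N}f=0$. The space $\mathcal{H}_N(\mathbb{C})$ consists of the polyanalytic functions $f$ of order $N$ on $\mathbb{C}$ with $$\|f\|^2=\frac{1}{2\pi}\int_{\mathbb{C}}|f(z)|^2e^{\frac{(z-\overline{z})^2}{4}}d\lambda(z)<\infty.$$ The true polyanalytic RBF space $\mathcal{H}_T^{(\ell)}(\mathbb{C})$, $\ell\in\mathbb{N}$, consists of the functions $f:\mathbb{C}\to\mathbb{C}$ for which the same quantity $\|f\|^2$ is finite and there exists an entire function $h$ such that $$f(z)=\frac{2^{\ell-1}}{\sqrt{(\ell-1)!}}\,e^{\frac{|z|^2}{2}-\frac{z^2}{4}}\,\frac{\partial^{\ell-1}}{\partial z^{\ell-1}}\left(h(z)e^{-\frac{|z|^2}{2}}\right),\quad z\in\mathbb{C}.$$ Both spaces carry the inner product $\langle f,g\rangle=\frac{1}{2\pi}\int_{\mathbb{C}}f\,\overline{g}\,e^{\frac{(z-\overline{z})^2}{4}}d\lambda$. The generalized Laguerre polynomials are $L^\beta_k(x)=\sum_{j=0}^{k}(-1)^j\binom{k+\beta}{k-j}\frac{x^j}{j!}$. *)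

(* Defs.v *)
From HB Require Import structures.
From mathcomp Require Import all_boot all_order all_algebra.
From mathcomp Require Import all_classical all_reals all_analysis.
From mathcomp Require Import complex.

Set Implicit Arguments.
Unset Strict Implicit.
Unset Printing Implicit Defensive.

Import Order.TTheory GRing.Theory Num.Theory numFieldNormedType.Exports.

Local Open Scope classical_set_scope.
Local Open Scope ring_scope.
Local Open Scope complex_scope.

Definition cexp (R : realType) (z : R[i]) : R[i] :=
  expR (complex.Re z) * cos (complex.Im z)
    +i* (expR (complex.Re z) * sin (complex.Im z)).

(* Derivative at z, along the real line t |-> z + t v, of f seen as a map
   between real planes; v = 1 gives d/dx and v = 'i gives d/dy. As usual for
   derive1, the value is meaningful only when pderivable v f z holds. *)
Definition pderivable (R : realType) (v : R[i]) (f : R[i] -> R[i]) (z : R[i])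
    : Prop :=
  derivable (fun t : R => complex.Re (f (z + t%:C * v))) 0 1 /\
  derivable (fun t : R => complex.Im (f (z + t%:C * v))) 0 1.

Definition pderive (R : realType) (v : R[i]) (f : R[i] -> R[i]) (z : R[i])
    : R[i] :=
  derive1 (fun t : R => complex.Re (f (z + t%:C * v))) 0
    +i* derive1 (fun t : R => complex.Im (f (z + t%:C * v))) 0.

(* The class C^n in the real sense: all partial derivatives of order at most n
   exist and are continuous. *)
Fixpoint Cn (R : realType) (n : nat) (f : R[i] -> R[i]) : Prop :=
  continuous (f : R[i]^o -> R[i]^o) /\
  match n with
  | 0 => True
  | m.+1 =>
      [/\ forall z, pderivable 1 f z, forall z, pderivable 'i%C f z,
          Cn m (pderive 1 f) & Cn m (pderive 'i%C f)]
  end.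

(* Wirtinger derivatives d/dz and d/d(conj z). *)
Definition dz (R : realType) (f : R[i] -> R[i]) : R[i] -> R[i] :=
  fun z => (pderive 1 f z - 'i%C * pderive 'i%C f z) / 2.

Definition dzbar (R : realType) (f : R[i] -> R[i]) : R[i] -> R[i] :=
  fun z => (pderive 1 f z + 'i%C * pderive 'i%C f z) / 2.

(* Complex differentiability, R[i]^o being the field R[i] as a normed module
   over itself. *)
Definition entire (R : realType) (h : R[i] -> R[i]) : Prop :=
  forall z, derivable (h : R[i]^o -> R[i]^o) z 1.

Definition polyanalytic (R : realType) (N : nat) (f : R[i] -> R[i]) : Prop :=
  Cn N f /\ forall z, iter N (@dzbar R) f z = 0.

(* Lebesgue measure on the plane R * R, identified with R[i] through
   p |-> p.1 +i* p.2. *)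
Definition plane_measure (R : realType)
    : {measure set (measurableTypeR R * measurableTypeR R) -> \bar R} :=
  (@lebesgue_measure R \x @lebesgue_measure R)%E.

Definition cintegrable (R : realType) (F : R[i] -> R[i]) : Prop :=
  (plane_measure R).-integrable setT
    (fun p => (complex.Re (F (p.1 +i* p.2)))%:E) /\
  (plane_measure R).-integrable setT
    (fun p => (complex.Im (F (p.1 +i* p.2)))%:E).

Definition cintegral (R : realType) (F : R[i] -> R[i]) : R[i] :=
  Rintegral (plane_measure R) setT (fun p => complex.Re (F (p.1 +i* p.2)))
    +i* Rintegral (plane_measure R) setT
          (fun p => complex.Im (F (p.1 +i* p.2))).

(* Real and positive: it equals exp (- (Im z)^2). *)
Definition rbf_weight (R : realType) (z : R[i]) : R[i] :=
  cexp ((z - z^*%C) ^+ 2 / 4).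

(* The integrand is real, so complex.Re only changes its type. *)
Definition rbf_norm2 (R : realType) (f : R[i] -> R[i]) : \bar R :=
  (((2 * pi)^-1)%:E *
   \int[plane_measure R]_p
     (complex.Re (`|f (p.1 +i* p.2)| ^+ 2 * rbf_weight (p.1 +i* p.2)))%:E)%E.

Definition rbf_ip (R : realType) (f g : R[i] -> R[i]) : R[i] :=
  ((2 * pi)^-1)%:C * cintegral (fun z => f z * (g z)^*%C * rbf_weight z).

Definition polyanalytic_rbf (R : realType) (N : nat) : set (R[i] -> R[i]) :=
  [set f | polyanalytic N f /\ (rbf_norm2 f < +oo)%E].

(* h (z) exp (- |z|^2 / 2) is smooth when h is entire, so that the iterated
   dz is a genuine derivative. *)
Definition true_polyanalytic_rbf (R : realType) (l : nat)
    : set (R[i] -> R[i]) :=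
  [set f | (rbf_norm2 f < +oo)%E /\
    exists2 h : R[i] -> R[i], entire h &
      forall z, f z =
        2 ^+ l.-1 / sqrtC (l.-1)`!%:R
        * cexp (`|z| ^+ 2 / 2 - z ^+ 2 / 4)
        * iter l.-1 (@dz R) (fun u => h u * cexp (- (`|u| ^+ 2 / 2))) z].

(* Generalized Laguerre polynomial of degree k, for a natural parameter b. *)
Definition laguerre (F : fieldType) (b k : nat) (x : F) : F :=
  \sum_(j < k.+1) (-1) ^+ j * 'C(k + b, k - j)%:R * (x ^+ j / j`!%:R).

Definition K_rbf (R : realType) (N : nat) (z w : R[i]) : R[i] :=
  cexp (- ((z - w^*%C) ^+ 2 / 4)) * laguerre 1 N.-1 (`|z - w| ^+ 2 / 2).

Definition K_true_rbf (R : realType) (l : nat) (z w : R[i]) : R[i] :=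
  laguerre 0 l.-1 (`|z - w| ^+ 2 / 2) * cexp (- ((z - w^*%C) ^+ 2 / 4)).

(* H is a set of functions on X and ip is only considered on H. *)
Section FunctionHilbertSpaces.
Variables (R : realType) (X : Type).
Implicit Types (H : set (X -> R[i])) (ip : (X -> R[i]) -> (X -> R[i]) -> R[i]).

Definition linear_subspace H : Prop :=
  H (fun=> 0) /\
  forall (a : R[i]) f g, H f -> H g -> H (fun x => a * f x + g x).

(* In R[i], 0 <= c says that c is real and nonnegative. *)
Definition inner_product_on H ip : Prop :=
  [/\ forall (a : R[i]) f g k, H f -> H g -> H k ->
        ip (fun x => a * f x + g x) k = a * ip f k + ip g k,
      forall f g, H f -> H g -> ip g f = (ip f g)^*%C,
      forall f, H f -> 0 <= ip f f &
      forall f, H f -> ip f f = 0 -> forall x, f x = 0].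

Definition ip_norm ip (f : X -> R[i]) : R := Num.sqrt (complex.Re (ip f f)).

Definition ip_dist ip (f g : X -> R[i]) : R := ip_norm ip (fun x => f x - g x).

Definition complete_on H ip : Prop :=
  forall u : nat -> X -> R[i], (forall n, H (u n)) ->
    (forall e : R, 0 < e -> exists n0 : nat, forall m n : nat,
       (n0 <= m)%N -> (n0 <= n)%N -> ip_dist ip (u m) (u n) < e) ->
  exists2 f, H f & (fun n => ip_dist ip (u n) f) @ \oo --> (0 : R).

Definition rkhs H ip : Prop :=
  [/\ linear_subspace H, inner_product_on H ip, complete_on H ip &
      forall x, exists M : R, forall f, H f -> `|f x| <= (M * ip_norm ip f)%:C].

Definition reproducing_kernel H ip (K : X -> X -> R[i]) : Prop :=
  forall w, H (K^~ w) /\ forall f, H f -> f w = ip f (K^~ w).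

End FunctionHilbertSpaces.

(* Main.v *)
(* Multiplication by e^(z^2/4) turns the weight e^(-(Im z)^2) into the Gaussian
   e^(-|z|^2/2). A polyanalytic function of order N is a polynomial of degree
   less than N in the conjugate of z with entire coefficients h_j, and the
   integral of such a function against a rotation invariant weight of Gaussian
   decay only sees the diagonal Taylor coefficients (the z^j-coefficient of h_j):
   on a disc, monomials z^i conj(z)^j with i <> j integrate to 0 by rotation
   invariance. A magnetic translation moves the point w to the origin, where the
   reproducing property reduces to the moments of Laguerre polynomials,
   hence to the alternating Vandermonde identity. In the true polyanalytic case
   the operator d/dz - conj(z)/2, whose (l-1)-st power generates the space,
   commutes with magnetic translations, so the same computation applies.

   Completeness comes from the reproducing property: Cauchy sequences converge
   pointwise, Fatou's lemma bounds the limit f in norm, and f(w) = <f, K_w>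
   still holds. Differentiating under the integral sign in this identity
   shows that f belongs to the space again. *)

Require Import Defs.
From HB Require Import structures.
From mathcomp Require Import all_boot all_order all_algebra.
From mathcomp Require Import all_classical all_reals all_analysis.
From mathcomp Require Import measurable_realfun complex ring lra zify.

Set Implicit Arguments.
Unset Strict Implicit.
Unset Printing Implicit Defensive.

Import Order.TTheory GRing.Theory Num.Theory numFieldNormedType.Exports.

Local Open Scope classical_set_scope.
Local Open Scope ring_scope.
Local Open Scope complex_scope.

(** Two constructions carry most of the weight. The integrals [fock_int], with integrand F(z) (w -
    z)^a conj(w - z)^b conj(z)^c e^(w conj(z)/2), form a family stable under both Wirtinger
    derivatives in w: d/dw lowers a or raises c, and d/d(conj w) lowers b. The Gaussian moments, the
    polyanalytic order of <f, K_w>, and the fact that a reproduced function comes from a power of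
    d/dz - conj(z)/2 are all read off from these rules.

    The obstacle to extracting diagonal Taylor coefficients is that only the whole sum of the h_j
    conj(z)^j, times the weight, is known to be integrable, not its summands. The integral is
    therefore cut to discs, where Taylor polynomials converge geometrically, and the radius tends to
    infinity only after the off-diagonal terms are gone.

    Circle integrals are increments of primitives, so that Cauchy's theorem reduces to Goursat's
    quartering argument for a closed form on a rectangle of parameters. *)

Local Notation cj := conjc.

(** * Wirtinger calculus *)

Section Modulus.
Variable R : realType.
Implicit Types z w : R[i].

(* The norm `|z| is an element of R[i]; cmod z is the same number in R. *)
Definition cmod z : R := Num.sqrt (complex.Re z ^+ 2 + complex.Im z ^+ 2).

Lemma cmodE z : `|z| = (cmod z)%:C.
Proof. exact: normc_def. Qed.

Lemma cmod_ge0 z : 0 <= cmod z.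
Proof. exact: sqrtr_ge0. Qed.

Lemma cmod_sqr z : cmod z ^+ 2 = complex.Re z ^+ 2 + complex.Im z ^+ 2.
Proof. by rewrite sqr_sqrtr // addr_ge0 ?sqr_ge0. Qed.

Lemma cmodM z w : cmod (z * w) = cmod z * cmod w.
Proof. by apply: complexI; rewrite rmorphM /= -!cmodE normrM. Qed.

Lemma cmodD z w : cmod (z + w) <= cmod z + cmod w.
Proof. by rewrite -lecR rmorphD /= -!cmodE ler_normD. Qed.

Lemma cmodN z : cmod (- z) = cmod z.
Proof. by apply: complexI; rewrite -!cmodE normrN. Qed.

Lemma cmodB z w : cmod (z - w) <= cmod z + cmod w.
Proof. by rewrite -(cmodN w) cmodD. Qed.

Lemma cmod0 : cmod 0 = 0.
Proof. by apply: complexI; rewrite -!cmodE normr0. Qed.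

Lemma cmod1 : cmod 1 = 1.
Proof. by apply: complexI; rewrite -!cmodE normr1. Qed.

Lemma cmod_eq0 z : (cmod z == 0) = (z == 0).
Proof. by rewrite -(inj_eq (@complexI R)) -cmodE normr_eq0. Qed.

Lemma cmod_gt0 z : (0 < cmod z) = (z != 0).
Proof. by rewrite lt_def cmod_eq0 cmod_ge0 andbT. Qed.

Lemma cmodX z n : cmod (z ^+ n) = cmod z ^+ n.
Proof. by elim: n => [|n IH]; rewrite ?expr0 ?cmod1 // !exprS cmodM IH. Qed.

Lemma cmodV z : cmod z^-1 = (cmod z)^-1.
Proof. by apply: complexI; rewrite fmorphV /= -!cmodE normfV. Qed.

Lemma cmodJ z : cmod (cj z) = cmod z.
Proof. by case: z => a b; rewrite /cmod /= sqrrN. Qed.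

Lemma cmodR (x : R) : cmod x%:C = `|x|.
Proof. by rewrite /cmod /= expr0n addr0 sqrtr_sqr. Qed.

Lemma cmod_nat n : cmod n%:R = n%:R.
Proof. by rewrite -(rmorph_nat (real_complex R)) cmodR normr_nat. Qed.

Lemma cmod_i : cmod 'i = 1.
Proof. by rewrite /cmod /= expr0n expr1n add0r sqrtr1. Qed.

Lemma normr_Re_le z : `|complex.Re z| <= cmod z.
Proof. by rewrite -sqrtr_sqr ler_wsqrtr // lerDl sqr_ge0. Qed.

Lemma normr_Im_le z : `|complex.Im z| <= cmod z.
Proof. by rewrite -sqrtr_sqr ler_wsqrtr // lerDr sqr_ge0. Qed.

Lemma cmod_le z : cmod z <= `|complex.Re z| + `|complex.Im z|.
Proof.
rewrite {1}[z]complexE (le_trans (cmodD _ _)) // cmodM cmod_i mul1r !cmodR.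
exact: lexx.
Qed.

Lemma cmod_sum (I : Type) (r : seq I) (P : pred I) (F : I -> R[i]) :
  cmod (\sum_(i <- r | P i) F i) <= \sum_(i <- r | P i) cmod (F i).
Proof.
elim/big_ind2 : _ => [|x1 x2 y1 y2 H1 H2|//]; first by rewrite cmod0.
by rewrite (le_trans (cmodD _ _)) // lerD.
Qed.

Lemma cmod_dist z w : cmod (z - w) = cmod (w - z).
Proof. by rewrite -cmodN opprB. Qed.

Lemma cmod_lt_small z : (forall e : R, 0 < e -> cmod z <= e) -> z = 0.
Proof.
move=> H; apply/eqP; rewrite -cmod_eq0 eq_le cmod_ge0 andbT.
by apply/ler_addgt0Pr => e e0; rewrite add0r H.
Qed.

Lemma Re_D z w : complex.Re (z + w) = complex.Re z + complex.Re w.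
Proof. by case: z; case: w. Qed.
Lemma Im_D z w : complex.Im (z + w) = complex.Im z + complex.Im w.
Proof. by case: z; case: w. Qed.
Lemma Re_N z : complex.Re (- z) = - complex.Re z.
Proof. by case: z. Qed.
Lemma Im_N z : complex.Im (- z) = - complex.Im z.
Proof. by case: z. Qed.
Lemma Re_M z w : complex.Re (z * w) =
  complex.Re z * complex.Re w - complex.Im z * complex.Im w.
Proof. by case: z; case: w. Qed.
Lemma Im_M z w : complex.Im (z * w) =
  complex.Re z * complex.Im w + complex.Im z * complex.Re w.
Proof. by case: z; case: w. Qed.

Definition ReImE := (Re_D, Im_D, Re_N, Im_N, Re_M, Im_M).

Lemma complex_eq z w :
  complex.Re z = complex.Re w -> complex.Im z = complex.Im w -> z = w.
Proof. by case: z => a b; case: w => c d /= -> ->. Qed.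

Lemma mulcJ z : z * (cj z) = (cmod z ^+ 2)%:C.
Proof.
rewrite cmod_sqr; case: z => a b; apply: complex_eq; rewrite /=; ring.
Qed.

Lemma conjK z : cj (cj z) = z.
Proof. by case: z => a b /=; rewrite opprK. Qed.
Lemma conjD z w : (cj (z + w)) = (cj z) + (cj w).
Proof. exact: (rmorphD (@conjc R)). Qed.
Lemma conjN z : (cj (- z)) = - (cj z).
Proof. exact: (rmorphN (@conjc R)). Qed.
Lemma conjM z w : (cj (z * w)) = (cj z) * (cj w).
Proof. exact: (rmorphM (@conjc R)). Qed.
Lemma conjX z n : (cj (z ^+ n)) = (cj z) ^+ n.
Proof. exact: (rmorphXn (@conjc R)). Qed.
Lemma conjV z : (cj (z^-1)) = (cj z)^-1.
Proof. exact: (fmorphV (@conjc R)). Qed.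
Lemma conj_nat n : (cj (n%:R : R[i])) = n%:R.
Proof. exact: (rmorph_nat (@conjc R)). Qed.
Lemma conj_sum (I : Type) (r : seq I) (P : pred I) (F : I -> R[i]) :
  (cj (\sum_(i <- r | P i) F i)) = \sum_(i <- r | P i) (cj (F i)).
Proof. exact: (rmorph_sum (@conjc R)). Qed.
Lemma conjR (x : R) : (cj x%:C) = x%:C.
Proof. by rewrite /= oppr0. Qed.
Lemma conji : cj 'i%C = - 'i%C :> R[i].
Proof. by apply: complex_eq; rewrite /= ?oppr0. Qed.
Lemma conj1 : cj 1 = 1 :> R[i].
Proof. exact: (rmorph1 (@conjc R)). Qed.
Lemma conj0 : cj 0 = 0 :> R[i].
Proof. exact: (rmorph0 (@conjc R)). Qed.

Definition conjE := (conj1, conj0, conji, conjD, conjN, conjM, conjX, conjV, conjK, conj_nat, conjR).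

Lemma cexpD z w : cexp (z + w) = cexp z * cexp w.
Proof.
case: z => a b; case: w => c d; apply: complex_eq;
  rewrite /cexp /= expRD ?cosD ?sinD; ring.
Qed.

Lemma cexp0 : cexp 0 = 1 :> R[i].
Proof. by rewrite /cexp /= expR0 cos0 sin0 mulr1 mulr0. Qed.

Lemma cmod_cexp z : cmod (cexp z) = expR (complex.Re z).
Proof.
rewrite /cmod /cexp /= !exprMn -mulrDr cos2Dsin2 mulr1 sqrtr_sqr.
by rewrite ger0_norm // expR_ge0.
Qed.

Lemma cexp_neq0 z : cexp z != 0.
Proof. by rewrite -cmod_gt0 cmod_cexp expR_gt0. Qed.

Lemma cexpJ z : (cj (cexp z)) = cexp (cj z).
Proof. by case: z => a b; rewrite /cexp /= cosN sinN mulrN. Qed.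

Lemma cexpR (x : R) : cexp x%:C = (expR x)%:C.
Proof. by rewrite /cexp /= cos0 sin0 mulr1 mulr0. Qed.

Lemma cexpMn z n : cexp (z *+ n) = cexp z ^+ n.
Proof.
by elim: n => [|n IH]; rewrite ?mulr0n ?cexp0 ?expr0 // mulrS cexpD IH exprS.
Qed.

End Modulus.

(** * First-order remainders at 0 *)

Section LittleO.
Variable R : realType.
Local Notation C := R[i].
Implicit Types (f g r u : C -> C) (z a b : C).

(** The non-strict bound covers h = 0 as well and forces r 0 = 0. *)
Definition little_o r : Prop := forall e : R, 0 < e ->
  exists2 d : R, 0 < d & forall h, cmod h < d -> cmod (r h) <= e * cmod h.

Definition near0_bounded u : Prop := exists K : R, exists2 d : R, 0 < d &
  forall h, cmod h < d -> cmod (u h) <= K.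

Definition near0_lipschitz u : Prop := exists K : R, exists2 d : R, 0 < d &
  forall h, cmod h < d -> cmod (u h) <= K * cmod h.

Lemma little_oD r u : little_o r -> little_o u ->
  little_o (fun h => r h + u h).
Proof.
move=> Hr Hu e e0.
have [d d0 Hd] := Hr (e / 2) (divr_gt0 e0 (ltr0Sn _ 1)).
have [d' d'0 Hd'] := Hu (e / 2) (divr_gt0 e0 (ltr0Sn _ 1)).
exists (Num.min d d'); first by rewrite lt_min d0.
move=> h; rewrite lt_min => /andP[h1 h2].
apply: (le_trans (cmodD _ _)).
have := lerD (Hd _ h1) (Hd' _ h2); rewrite -mulrDl -splitr.
exact.
Qed.

Lemma eq_little_o r u : (forall h, r h = u h) -> little_o r -> little_o u.
Proof. by move=> /funext ->. Qed.

Lemma little_o_mulb r u : little_o r -> near0_bounded u ->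
  little_o (fun h => r h * u h).
Proof.
move=> Hr [K [d d0 HK]] e e0.
have K1 : 0 < `|K| + 1 by rewrite ltr_wpDl.
have [d' d'0 Hd'] := Hr _ (divr_gt0 e0 K1).
exists (Num.min d d'); first by rewrite lt_min d0.
move=> h; rewrite lt_min => /andP[h1 h2].
have H : cmod (u h) <= `|K| + 1.
  by rewrite (le_trans (HK _ h1)) // (le_trans (ler_norm K)) // lerDl.
rewrite cmodM (le_trans (ler_pM (cmod_ge0 _) (cmod_ge0 _) (Hd' _ h2) H)) //.
by rewrite mulrAC divfK // gt_eqF.
Qed.

Lemma little_o_quad r (K d : R) : 0 < d ->
  (forall h, cmod h < d -> cmod (r h) <= K * cmod h ^+ 2) -> little_o r.
Proof.
move=> d0 H e e0.
have K1 : 0 < `|K| + 1 by rewrite ltr_wpDl.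
exists (Num.min d (e / (`|K| + 1))); first by rewrite lt_min d0 divr_gt0.
move=> h; rewrite lt_min => /andP[h1 h2].
apply: (le_trans (H _ h1)); rewrite expr2 mulrA ler_wpM2r ?cmod_ge0 //.
rewrite ltr_pdivlMr // in h2.
apply: le_trans (ltW h2); rewrite mulrC ler_wpM2l ?cmod_ge0 //.
by rewrite (le_trans (ler_norm _)) // lerDl.
Qed.

Lemma little_o_lipschitz r : little_o r -> near0_lipschitz r.
Proof. by move=> /(_ 1 ltr01) [d d0 H]; exists 1, d. Qed.

Lemma near0_lipschitzD r u : near0_lipschitz r -> near0_lipschitz u ->
  near0_lipschitz (fun h => r h + u h).
Proof.
move=> [K [d d0 HK]] [K' [d' d'0 HK']].
exists (K + K'), (Num.min d d'); first by rewrite lt_min d0.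
move=> h; rewrite lt_min => /andP[h1 h2].
by rewrite (le_trans (cmodD _ _)) // mulrDl lerD ?HK ?HK'.
Qed.

Lemma near0_lipschitz_bounded u : near0_lipschitz u -> near0_bounded u.
Proof.
move=> [K [d d0 HK]]; exists (`|K| * d), d => // h hd.
apply: (le_trans (HK _ hd)).
apply: (@le_trans _ _ (`|K| * cmod h)).
  by rewrite ler_wpM2r ?cmod_ge0 ?ler_norm.
by rewrite ler_wpM2l // ltW.
Qed.

Lemma near0_boundedD r u : near0_bounded r -> near0_bounded u ->
  near0_bounded (fun h => r h + u h).
Proof.
move=> [K [d d0 HK]] [K' [d' d'0 HK']].
exists (K + K'), (Num.min d d'); first by rewrite lt_min d0.
move=> h; rewrite lt_min => /andP[h1 h2].
by rewrite (le_trans (cmodD _ _)) // lerD ?HK ?HK'.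
Qed.

Lemma near0_bounded_cst a : near0_bounded (fun=> a).
Proof. by exists (cmod a), 1. Qed.

Lemma near0_lipschitz_lin a b : near0_lipschitz (fun h => a * h + b * (cj h)).
Proof.
exists (cmod a + cmod b), 1 => // h _.
by rewrite (le_trans (cmodD _ _)) // !cmodM cmodJ mulrDl.
Qed.

Lemma little_o_lipM r u : near0_lipschitz r -> near0_lipschitz u ->
  little_o (fun h => r h * u h).
Proof.
move=> [K [d d0 HK]] [K' [d' d'0 HK']].
apply: (@little_o_quad _ (`|K| * `|K'|) (Num.min d d')).
  by rewrite lt_min d0.
move=> h; rewrite lt_min => /andP[h1 h2].
rewrite cmodM expr2 mulrACA ler_pM ?cmod_ge0 //.
  by rewrite (le_trans (HK _ h1)) // ler_wpM2r ?cmod_ge0 ?ler_norm.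
by rewrite (le_trans (HK' _ h2)) // ler_wpM2r ?cmod_ge0 ?ler_norm.
Qed.

Lemma little_o_comp r k : little_o r -> near0_lipschitz k ->
  little_o (fun h => r (k h)).
Proof.
move=> Hr [K [d d0 HK]] e e0.
have K1 : 0 < `|K| + 1 by rewrite ltr_wpDl.
have [d' d'0 Hd'] := Hr _ (divr_gt0 e0 K1).
exists (Num.min d (d' / (`|K| + 1))); first by rewrite lt_min d0 divr_gt0.
move=> h; rewrite lt_min => /andP[h1 h2].
have Hk : cmod (k h) <= cmod h * (`|K| + 1).
  rewrite (le_trans (HK _ h1)) // mulrC ler_wpM2l ?cmod_ge0 //.
  by rewrite (le_trans (ler_norm _)) // lerDl.
apply: (le_trans (Hd' _ _)).
  by rewrite (le_lt_trans Hk) // -ltr_pdivlMr.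
rewrite -mulrA ler_wpM2l ?(ltW e0) // mulrC ler_pdivrMr //.
Qed.

End LittleO.

(** * Real differentiability in Wirtinger form *)

Section RealDifferentiability.
Variable R : realType.
Local Notation C := R[i].
Implicit Types (f g : C -> C) (z a b u : C).

(* f is real differentiable at z, with Wirtinger derivatives a and b. *)
Definition wirt f z a b : Prop :=
  little_o (fun h => f (z + h) - f z - (a * h + b * (cj h))).

Lemma wirt_cst c z : wirt (fun=> c) z 0 0.
Proof. by move=> e e0; exists 1 => // h _; rewrite subrr !mul0r addr0 subrr cmod0 mulr_ge0 ?cmod_ge0 // ltW. Qed.

Lemma wirt_id z : wirt id z 1 0.
Proof.
apply: (@eq_little_o _ (fun=> 0)) => [h|]; first by ring.
by move=> e e0; exists 1 => // h _; rewrite cmod0 mulr_ge0 ?cmod_ge0 // ltW.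
Qed.

Lemma wirt_conj z : wirt (fun u => (cj u)) z 0 1.
Proof.
apply: (@eq_little_o _ (fun=> 0)) => [h|]; first by rewrite rmorphD /=; ring.
by move=> e e0; exists 1 => // h _; rewrite cmod0 mulr_ge0 ?cmod_ge0 // ltW.
Qed.

Lemma wirtD f g z a b a' b' : wirt f z a b -> wirt g z a' b' ->
  wirt (fun u => f u + g u) z (a + a') (b + b').
Proof.
move=> Hf Hg; apply: eq_little_o (little_oD Hf Hg) => h; ring.
Qed.

Lemma wirt_lipschitz f z a b : wirt f z a b ->
  near0_lipschitz (fun h => f (z + h) - f z).
Proof.
move=> /little_o_lipschitz H.
have := near0_lipschitzD H (near0_lipschitz_lin a b).
by congr near0_lipschitz; apply/funext => h; ring.
Qed.

Lemma wirtM f g z a b a' b' : wirt f z a b -> wirt g z a' b' ->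
  wirt (fun u => f u * g u) z (a * g z + f z * a') (b * g z + f z * b').
Proof.
move=> Hf Hg.
have Bg : near0_bounded (fun h => g (z + h)).
  have := near0_boundedD (near0_lipschitz_bounded (wirt_lipschitz Hg))
    (near0_bounded_cst (g z)).
  by congr near0_bounded; apply/funext => h; ring.
have B2 : near0_bounded (fun h => f z + (a * h + b * (cj h))).
  apply: near0_boundedD; first exact: near0_bounded_cst.
  exact/near0_lipschitz_bounded/near0_lipschitz_lin.
(* The remainder of the product has three pieces: the remainder of f times g (z + h), the remainder
   of g times the affine part of f, and the product of the two linear parts, which is quadratic in
   h. *)
have := little_oD (little_oD (little_o_mulb Hf Bg) (little_o_mulb Hg B2))
  (little_o_lipM (near0_lipschitz_lin a b) (near0_lipschitz_lin a' b')).
apply: eq_little_o => h; ring.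
Qed.

(** Conjugating the inner increment a h + b conj h exchanges its two coefficients, which is why conj
    b and conj a appear next to d. *)
Lemma wirt_comp f g z a b c d : wirt f z a b -> wirt g (f z) c d ->
  wirt (fun u => g (f u)) z (c * a + d * (cj b)) (c * b + d * (cj a)).
Proof.
move=> Hf Hg.
have Hc : little_o (fun h => (f (z + h) - f z - (a * h + b * (cj h))) * c
    + cj (f (z + h) - f z - (a * h + b * (cj h))) * d).
  apply: little_oD; first exact: little_o_mulb Hf (near0_bounded_cst _).
  apply: little_o_mulb (near0_bounded_cst _).
  by move=> e /Hf[dl dl0 H]; exists dl => // h /H; rewrite cmodJ.
have := little_oD (little_o_comp Hg (wirt_lipschitz Hf)) Hc.
apply: eq_little_o => h.
have := erefl (f (z + h)); rewrite -{1}(subrKC (f z) (f (z + h))).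
by move: (f (z + h) - f z) => k <-; rewrite !conjE; ring.
Qed.

Lemma eq_wirt f g z a b : f =1 g -> wirt f z a b -> wirt g z a b.
Proof. by move=> /funext ->. Qed.

Lemma wirt_eq f z a b a' b' : a = a' -> b = b' ->
  wirt f z a b -> wirt f z a' b'.
Proof. by move=> -> ->. Qed.

Lemma wirtZ c f z a b : wirt f z a b -> wirt (fun u => c * f u) z (c * a) (c * b).
Proof.
by move=> H; apply: wirt_eq (wirtM (wirt_cst c z) H); rewrite mul0r add0r.
Qed.

Lemma wirtN f z a b : wirt f z a b -> wirt (fun u => - f u) z (- a) (- b).
Proof.
move=> H; apply: wirt_eq (eq_wirt _ (wirtZ (-1) H)); rewrite ?mulN1r // => u.
by rewrite mulN1r.
Qed.

Lemma wirtB f g z a b a' b' : wirt f z a b -> wirt g z a' b' ->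
  wirt (fun u => f u - g u) z (a - a') (b - b').
Proof. by move=> Hf Hg; apply: wirtD => //; apply: wirtN. Qed.

Lemma wirt_sum (I : Type) (s : seq I) (P : pred I) (F A B : I -> C -> C) z :
  (forall i, wirt (F i) z (A i z) (B i z)) ->
  wirt (fun u => \sum_(i <- s | P i) F i u) z
    (\sum_(i <- s | P i) A i z) (\sum_(i <- s | P i) B i z).
Proof.
move=> H; elim: s => [|i s IH].
  by apply: wirt_eq (eq_wirt _ (wirt_cst 0 z)) => [||u]; rewrite big_nil.
case Pi : (P i); last first.
  by apply: wirt_eq (eq_wirt _ IH) => [||u]; rewrite big_cons Pi.
by apply: wirt_eq (eq_wirt _ (wirtD (H i) IH)) => [||u]; rewrite big_cons Pi.
Qed.

Lemma wirtX f z a b n : wirt f z a b ->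
  wirt (fun u => f u ^+ n) z (n%:R * f z ^+ n.-1 * a) (n%:R * f z ^+ n.-1 * b).
Proof.
move=> H; elim: n => [|n IH].
  apply: wirt_eq (eq_wirt _ (wirt_cst 1 z)) => [||u]; rewrite ?expr0 //; ring.
apply: wirt_eq (eq_wirt _ (wirtM H IH)) => [||u]; rewrite ?exprS //=;
  case: n {IH} => [|n] /=; rewrite ?expr0 ?exprS -?natr1; ring.
Qed.

Lemma wirt_continuous f z a b : wirt f z a b -> forall e : R, 0 < e ->
  exists2 d : R, 0 < d & forall h, cmod h < d -> cmod (f (z + h) - f z) <= e.
Proof.
move=> /wirt_lipschitz [K [d d0 H]] e e0.
have K1 : 0 < `|K| + 1 by rewrite ltr_wpDl.
exists (Num.min d (e / (`|K| + 1))); first by rewrite lt_min d0 divr_gt0.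
move=> h; rewrite lt_min => /andP[h1]; rewrite ltr_pdivlMr // => h2.
rewrite (le_trans (H _ h1)) // (le_trans _ (ltW h2)) // mulrC ler_wpM2l ?cmod_ge0 //.
by rewrite (le_trans (ler_norm _)) // lerDl.
Qed.

End RealDifferentiability.

(** * Derivatives along curves, and partial derivatives *)

Section RealDerivatives.
Variable R : realType.
Local Notation C := R[i].
Implicit Types (f g : C -> C) (z a b u : C).

Lemma is_derive_epsP (phi : R -> R) (x l : R) :
  (forall e : R, 0 < e -> exists2 d : R, 0 < d & forall h, `|h| < d ->
     `|phi (x + h) - phi x - h * l| <= e * `|h|) <-> is_derive x 1 phi l.
Proof.
split=> [H|[dphi <-] e e0].
  have cv : (fun h : R => h^-1 *: (phi (h *: (1 : R) + x) - phi x)) @ 0^' --> l.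
    apply/cvgrPdist_le => e e0; have [d d0 Hd] := H _ e0.
    apply/nbhs_ballP; exists d => //= h.
    rewrite /ball /= sub0r normrN => hd h0; have hp : 0 < `|h| by rewrite normr_gt0.
    rewrite distrC -(ler_pM2r hp) -normrM.
    rewrite mulrBl /GRing.scale /= mulr1 mulrAC mulVf // mul1r [_ * h]mulrC.
    by rewrite [h + x]addrC Hd.
  by apply: DeriveDef; [apply: cvgP cv | apply: cvg_lim cv].
have /cvgrPdist_le/(_ _ e0) := dphi.
move/nbhs_ballP => [d /= d0 Hd]; exists d => // h hd.
have [->|h0] := eqVneq h 0.
  by rewrite addr0 subrr mul0r subrr normr0 mulr0.
have := Hd h; rewrite /ball /= sub0r normrN => /(_ hd h0).
rewrite distrC => /(ler_wpM2r (normr_ge0 h)); rewrite -normrM.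
by rewrite mulrBl /GRing.scale /= mulr1 mulrAC mulVf // mul1r [_ * h]mulrC [h + x]addrC.
Qed.

Definition rderiv (F : R -> C) (x : R) (l : C) : Prop :=
  forall e : R, 0 < e -> exists2 d : R, 0 < d & forall h : R, `|h| < d ->
    cmod (F (x + h) - F x - h%:C * l) <= e * `|h|.

Lemma rderiv_ReIm (F : R -> C) (x : R) (l : C) : rderiv F x l ->
  is_derive x 1 (fun t => complex.Re (F t)) (complex.Re l) /\
  is_derive x 1 (fun t => complex.Im (F t)) (complex.Im l).
Proof.
move=> H; split; apply/is_derive_epsP => e /H[d d0 Hd]; exists d => // h /Hd;
  apply: le_trans.
- by apply: le_trans (normr_Re_le _); rewrite !ReImE /= mul0r subr0.
- by apply: le_trans (normr_Im_le _); rewrite !ReImE /= mul0r addr0.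
Qed.

Lemma ReIm_rderiv (F : R -> C) (x : R) (l : C) :
  is_derive x 1 (fun t => complex.Re (F t)) (complex.Re l) ->
  is_derive x 1 (fun t => complex.Im (F t)) (complex.Im l) -> rderiv F x l.
Proof.
move=> /is_derive_epsP H1 /is_derive_epsP H2 e e0.
have [d d0 Hd] := H1 _ (divr_gt0 e0 (ltr0Sn _ 1)).
have [d' d'0 Hd'] := H2 _ (divr_gt0 e0 (ltr0Sn _ 1)).
exists (Num.min d d'); first by rewrite lt_min d0.
move=> h; rewrite lt_min => /andP[h1 h2].
apply: le_trans (cmod_le _) _; have := lerD (Hd _ h1) (Hd' _ h2).
rewrite -mulrDl -splitr; apply: le_trans.
by rewrite !ReImE /= !mul0r subr0 addr0.
Qed.

Lemma wirt_curve f (g : R -> C) (t : R) (l a b : C) : wirt f (g t) a b -> rderiv g t l ->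
  rderiv (fun s => f (g s)) t (a * l + b * cj l).
Proof.
move=> Hf Hg e e0.
(* The increment of g is at most |h| (|l| + 1), so tolerance (e/2) / (|l| + 1) for f costs (e/2)
   |h|; the other half pays for the remainder of g, amplified by |a| + |b|. The added 1 keeps both
   denominators positive. *)
have M0 : 0 < cmod l + 1 by rewrite ltr_wpDl ?cmod_ge0.
have N0 : 0 < cmod a + cmod b + 1 by rewrite ltr_wpDl ?addr_ge0 ?cmod_ge0.
have e2 : 0 < e / 2 by rewrite divr_gt0.
have [d1 d10 H1] := Hf _ (divr_gt0 e2 M0).
have [d2 d20 H2] := Hg _ (divr_gt0 e2 N0).
have [d3 d30 H3] := Hg _ ltr01.
exists (Num.min (Num.min d2 d3) (d1 / (cmod l + 1))).
  by rewrite !lt_min d20 d30 divr_gt0.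
move=> h; rewrite !lt_min ltr_pdivlMr // => /andP[/andP[h2 h3] h1].
have Hk : cmod (g (t + h) - g t) <= `|h| * (cmod l + 1).
  rewrite (_ : g (t + h) - g t = (g (t + h) - g t - h%:C * l) + h%:C * l);
    last by ring.
  rewrite (le_trans (cmodD _ _)) // mulrDr mulr1 addrC lerD //.
    by rewrite cmodM cmodR.
  by have := H3 _ h3; rewrite mul1r.
have := H1 _ (le_lt_trans Hk h1); have := H2 _ h2.
rewrite subrKC; set k := g (t + h) - g t => K2 K1.
have -> : f (g (t + h)) - f (g t) - h%:C * (a * l + b * cj l) =
  (f (g (t + h)) - f (g t) - (a * k + b * cj k)) +
  (a * (k - h%:C * l) + b * cj (k - h%:C * l)) by rewrite !conjE; ring.
rewrite (le_trans (cmodD _ _)) // [e]splitr mulrDl lerD //.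
  rewrite (le_trans K1) // -mulrA ler_wpM2l ?(ltW e2) // mulrC ler_pdivrMr //.
rewrite (le_trans (cmodD _ _)) // !cmodM cmodJ -mulrDl.
rewrite (le_trans (ler_wpM2l _ K2)) ?addr_ge0 ?cmod_ge0 //.
rewrite mulrA ler_wpM2r // mulrA ler_pdivrMr // mulrC ler_wpM2l ?(ltW e2) //.
by rewrite lerDl.
Qed.

Lemma wirt_line f z v a b : wirt f z a b ->
  rderiv (fun t : R => f (z + t%:C * v)) 0 (a * v + b * cj v).
Proof.
move=> Hf; apply: (@wirt_curve f (fun t => z + t%:C * v)).
  by rewrite /= mul0r addr0.
move=> e e0; exists 1 => // h _.
rewrite add0r mul0r addr0 (_ : _ - _ = 0) ?cmod0; last by ring.
by rewrite mulr_ge0 // ltW.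
Qed.

Lemma wirt_pderivable f z v a b : wirt f z a b -> pderivable v f z.
Proof.
by move=> /(wirt_line v)/rderiv_ReIm[[H1 _] [H2 _]]; split.
Qed.

Lemma wirt_pderive f z v a b : wirt f z a b ->
  pderive v f z = a * v + b * cj v.
Proof.
move=> /(wirt_line v)/rderiv_ReIm[H1 H2]; rewrite /pderive !derive1E.
by rewrite !derive_val; apply: complex_eq.
Qed.

Lemma wirt_dz f z a b : wirt f z a b -> dz f z = a.
Proof.
move=> H; rewrite /dz !(wirt_pderive _ H) !conjE.
have := sqr_i R; rewrite expr2 => Hi.
apply: (mulIf (_ : (2 : C) != 0)); first by rewrite pnatr_eq0.
rewrite divfK ?pnatr_eq0 //.
rewrite (_ : _ - _ = a + b - ('i%C * 'i%C) * (a - b)); last by ring.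
by rewrite Hi; ring.
Qed.

Lemma wirt_dzbar f z a b : wirt f z a b -> dzbar f z = b.
Proof.
move=> H; rewrite /dzbar !(wirt_pderive _ H) !conjE.
have := sqr_i R; rewrite expr2 => Hi.
apply: (mulIf (_ : (2 : C) != 0)); first by rewrite pnatr_eq0.
rewrite divfK ?pnatr_eq0 //.
rewrite (_ : _ + _ = a + b + ('i%C * 'i%C) * (a - b)); last by ring.
by rewrite Hi; ring.
Qed.

(** Since Re h = (h + conj h) / 2, the slope splits evenly between the two coefficients. *)
Lemma wirt_Re (phi : R -> R) z l : is_derive (complex.Re z) 1 phi l ->
  wirt (fun u => (phi (complex.Re u))%:C) z (l / 2)%:C (l / 2)%:C.
Proof.
move=> /is_derive_epsP H e e0; have [d d0 Hd] := H _ e0.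
exists d => // h hd; have K := Hd (complex.Re h) (le_lt_trans (normr_Re_le _) hd).
have K' := ler_wpM2l (ltW e0) (normr_Re_le h).
rewrite (_ : _ - _ = (phi (complex.Re z + complex.Re h) - phi (complex.Re z)
  - complex.Re h * l)%:C).
  by rewrite cmodR (le_trans K).
by case: h {hd K K'} => x y; apply: complex_eq; rewrite !ReImE /=; field.
Qed.

Lemma wirt_Im (phi : R -> R) z l : is_derive (complex.Im z) 1 phi l ->
  wirt (fun u => (phi (complex.Im u))%:C) z
    (- 'i%C * (l / 2)%:C) ('i%C * (l / 2)%:C).
Proof.
move=> /is_derive_epsP H e e0; have [d d0 Hd] := H _ e0.
exists d => // h hd; have K := Hd (complex.Im h) (le_lt_trans (normr_Im_le _) hd).
have K' := ler_wpM2l (ltW e0) (normr_Im_le h).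
rewrite (_ : _ - _ = (phi (complex.Im z + complex.Im h) - phi (complex.Im z)
  - complex.Im h * l)%:C).
  by rewrite cmodR (le_trans K).
by case: h {hd K K'} => x y; apply: complex_eq; rewrite !ReImE /=; field.
Qed.

(** In the product rule for e^(Re u) (cos (Im u) + i sin (Im u)) the two contributions to the
    conjugate coefficient cancel: these are the Cauchy-Riemann equations. *)
Lemma wirt_cexp z : wirt (@cexp R) z (cexp z) 0.
Proof.
have W := wirtM (wirt_Re (is_derive_expR (complex.Re z)))
  (wirtD (wirt_Im (is_derive_cos (complex.Im z)))
     (wirtM (wirt_cst 'i%C z) (wirt_Im (is_derive_sin (complex.Im z))))).
apply: wirt_eq (eq_wirt _ W) => [||u].
- by apply: complex_eq; rewrite /cexp !ReImE /=; field.
- by apply: complex_eq; rewrite /cexp !ReImE /=; field.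
- by apply: complex_eq; rewrite /cexp !ReImE /=; ring.
Qed.

End RealDerivatives.

(** * Mean value bounds, entire functions and smoothness classes *)

Section Regularity.
Variable R : realType.
Local Notation C := R[i].
Implicit Types (f g h : C -> C) (z a b u : C).

(** The mean value theorem is applied to real and imaginary part separately, at two unrelated
    points; this costs the factor 2, which reappears in all later constants. *)
Lemma mvt_cmod (F F' : R -> C) (a b M : R) : a <= b ->
  (forall x, a <= x <= b -> rderiv F x (F' x) /\ cmod (F' x) <= M) ->
  cmod (F b - F a) <= 2 * M * (b - a).
Proof.
move=> ab H.
have dRe x : x \in `[a, b]%R ->
    is_derive x 1 (fun t => complex.Re (F t)) (complex.Re (F' x)).
  by rewrite in_itv /= => /H[/rderiv_ReIm[]].
have dIm x : x \in `[a, b]%R ->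
    is_derive x 1 (fun t => complex.Im (F t)) (complex.Im (F' x)).
  by rewrite in_itv /= => /H[/rderiv_ReIm[]].
have sub x : x \in `]a, b[%R -> x \in `[a, b]%R.
  by rewrite !in_itv /= => /andP[/ltW-> /ltW->].
have [c1 /[!in_itv]/= c1ab E1] := MVT_segment ab (fun x xab => dRe x (sub _ xab))
  (derivable_within_continuous (fun x xab => @ex_derive _ _ _ _ _ _ _ (dRe x xab))).
have [c2 /[!in_itv]/= c2ab E2] := MVT_segment ab (fun x xab => dIm x (sub _ xab))
  (derivable_within_continuous (fun x xab => @ex_derive _ _ _ _ _ _ _ (dIm x xab))).
apply: le_trans (cmod_le _) _; rewrite !ReImE E1 E2 !normrM.
rewrite [`|b - a|]ger0_norm ?subr_ge0 // -mulrDl ler_wpM2r ?subr_ge0 //.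
rewrite mulrC mulr2n mulrDr mulr1 lerD //.
- by rewrite (le_trans (normr_Re_le _)) //; case: (H _ c1ab).
- by rewrite (le_trans (normr_Im_le _)) //; case: (H _ c2ab).
Qed.

Lemma mvt_cmod0 (F F' : R -> C) (x M : R) :
  (forall s, `|s| <= `|x| -> rderiv F s (F' s) /\ cmod (F' s) <= M) ->
  cmod (F x - F 0) <= 2 * M * `|x|.
Proof.
move=> H; have [x0|x0] := leP 0 x.
  rewrite ger0_norm // -{2}[x]subr0; apply: (mvt_cmod x0) => s /andP[s0 sx].
  by apply: H; rewrite (ger0_norm s0) (ger0_norm x0).
rewrite cmod_dist ltr0_norm // -[- x]add0r.
apply: (mvt_cmod (ltW x0)) => s /andP[s0 sx].
by apply: H; rewrite (ltr0_norm x0) ler0_norm // lerN2.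
Qed.

Lemma continuous_epsP f : continuous (f : C^o -> C^o) <->
  forall z (e : R), 0 < e ->
    exists2 d : R, 0 < d & forall k, cmod k < d -> cmod (f (z + k) - f z) <= e.
Proof.
split=> [H z e e0|H z].
  have /cvgrPdist_le/(_ e%:C) := H z; rewrite ltcR => /(_ e0).
  move=> /nbhs_ballP[d /= d0 Hd]; move: (d0); rewrite ltcE /= => /andP[/eqP di dr].
  exists (complex.Re d) => // k kd; rewrite -lecR -cmodE distrC.
  apply: Hd; rewrite /ball /= opprD addrA subrr add0r normrN cmodE.
  by rewrite ltcE /= di eqxx.
apply/(@cvgrPdist_le _ C^o _ _ (nbhs_filter (z : C^o))) => e.
rewrite ltcE /= => /andP[/eqP ei er]; have [d d0 Hd] := H z _ er.
apply/(@nbhs_ballP _ C^o); exists d%:C => /=; first by rewrite ltcR.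
move=> y; rewrite /ball /= distrC cmodE ltcR => /Hd.
rewrite subrKC distrC cmodE => K.
by rewrite lecE /= ei eqxx.
Qed.

(** The remainder bound divided by |k| is the convergence of the complex difference quotient. This
    is the form in which holomorphy is used from here on. *)
Lemma entire_wirtP h : entire h <-> forall z, exists a, wirt h z a 0.
Proof.
split=> [H z|H z].
  exists ('D_1 (h : C^o -> C^o) z) => e e0.
  have /cvgrPdist_le/(_ e%:C) := H z; rewrite ltcR => /(_ e0).
  move=> /nbhs_ballP[d /= d0 Hd]; move: (d0); rewrite ltcE /= => /andP[/eqP di dr].
  exists (complex.Re d) => // k kd.
  have [->|k0] := eqVneq k 0.
    by rewrite conj0 addr0 !mulr0 addr0 subrr subr0 cmod0 mulr0.
  have := Hd k; rewrite /ball /= sub0r normrN cmodE.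
  have -> : (cmod k)%:C < d by rewrite ltcE /= di eqxx.
  move=> /(_ isT k0); rewrite distrC cmodE lecR.
  rewrite -(ler_pM2r (_ : 0 < cmod k)) ?cmod_gt0 // -cmodM.
  apply: le_trans; rewrite mul0r addr0 mulrBl /GRing.scale /= mulr1.
  by rewrite mulrAC mulVf // mul1r [k + z]addrC.
have [a Ha] := H z.
have cv : (fun k : C^o => (k : C)^-1 *: ((h : C^o -> C^o) (k *: (1 : C^o) + z) - h z)) @ (0 : C^o)^' --> (a : C^o).
  apply/(@cvgrPdist_le _ C^o _ _ (dnbhs_filter (0 : C^o))) => e; rewrite ltcE /= => /andP[/eqP ei er].
  have [d d0 Hd] := Ha _ er.
  apply/(@nbhs_ballP _ C^o); exists d%:C => /=; first by rewrite ltcR.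
  move=> k; rewrite /ball /= sub0r normrN cmodE ltcR => kd k0.
  rewrite distrC cmodE lecE /= ei eqxx /=.
  rewrite -(ler_pM2r (_ : 0 < cmod k)) ?cmod_gt0 // -cmodM.
  apply: le_trans (Hd _ kd); rewrite mul0r addr0 mulrBl /GRing.scale /= mulr1.
  by rewrite mulrAC mulVf // mul1r [k + z]addrC.
exact: cvgP cv.
Qed.

Lemma pderive_line v f z t : pderivable v f (z + t%:C * v) ->
  rderiv (fun s : R => f (z + s%:C * v)) t (pderive v f (z + t%:C * v)).
Proof.
have shift (s : R) : z + t%:C * v + s%:C * v = z + (t + s)%:C * v.
  by rewrite rmorphD /=; ring.
move=> [dRe dIm]; rewrite /pderive !derive1E.
apply: ReIm_rderiv => /=; apply/is_derive_epsP.
  have /is_derive_epsP H := derivableP dRe.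
  move=> e /H[d d0 Hd]; exists d => // k /Hd.
  by rewrite !shift add0r addr0.
have /is_derive_epsP H := derivableP dIm.
move=> e /H[d d0 Hd]; exists d => // k /Hd.
by rewrite !shift add0r addr0.
Qed.

(** Removing the linear part s D leaves a curve whose derivative is the deviation of the partial
    derivative from D, to which the mean value bound applies. *)
Lemma pderive_increment f v z D (x e : R) :
  (forall w, pderivable v f w) ->
  (forall s : R, `|s| <= `|x| -> cmod (pderive v f (z + s%:C * v) - D) <= e) ->
  cmod (f (z + x%:C * v) - f z - x%:C * D) <= 2 * e * `|x|.
Proof.
move=> df He; pose F (s : R) := f (z + s%:C * v) - s%:C * D.
rewrite (_ : f (z + x%:C * v) - f z - x%:C * D = F x - F 0); last first.
  by rewrite /F !mul0r addr0; ring.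
apply: (mvt_cmod0 (F' := fun s => pderive v f (z + s%:C * v) - D)) => s Hs.
split; last exact: He.
move=> eps eps0; have [d d0 Hd] := pderive_line (df (z + s%:C * v)) eps0.
exists d => // t /Hd; apply: le_trans.
by rewrite /F rmorphD /= le_eqVlt; apply/orP; left; apply/eqP; congr cmod; ring.
Qed.

Lemma wirtinger_identity (x y p q i : C) : i * i = -1 ->
  (p - i * q) / 2 * (x + y * i) + (p + i * q) / 2 * (x + y * - i) =
  x * p + y * q.
Proof.
move=> ii; transitivity (x * p - (i * i) * y * q); first by field.
by rewrite ii; ring.
Qed.

(* Move first parallel to the real axis, then parallel to the imaginary axis. *)
Lemma C1_wirt f z :
  (forall w, pderivable 1 f w) -> (forall w, pderivable 'i%C f w) ->
  continuous (pderive 1 f : C^o -> C^o) ->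
  continuous (pderive 'i%C f : C^o -> C^o) ->
  wirt f z (dz f z) (dzbar f z).
Proof.
move=> d1 di /continuous_epsP c1 /continuous_epsP ci e e0.
(* Each of the two moves costs 2 (e/4) |k|, with the 2 of [mvt_cmod]. The radius is halved below
   because points of the corner path are only bounded by 2 |k|. *)
have e4 : 0 < e / 4 by rewrite divr_gt0.
have [d d0 Hd] := c1 z _ e4; have [d' d'0 Hd'] := ci z _ e4.
exists (Num.min d d' / 2); first by rewrite divr_gt0 // lt_min d0.
move=> k; rewrite ltr_pdivlMr // lt_min => /andP[kd kd'].
have small (s t : R) : `|s| <= `|complex.Re k| -> `|t| <= `|complex.Im k| ->
    cmod (s%:C * 1 + t%:C * 'i%C) <= cmod k * 2.
  move=> Hs Ht; rewrite (le_trans (cmodD _ _)) // !cmodM cmod_i cmod1 !mulr1 !cmodR.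
  rewrite mulrC mulr2n mulrDl mul1r lerD //.
    by apply: le_trans Hs (normr_Re_le _).
  by apply: le_trans Ht (normr_Im_le _).
have H1 : cmod (f (z + (complex.Re k)%:C * 1) - f z
    - (complex.Re k)%:C * pderive 1 f z) <= 2 * (e / 4) * cmod k.
  apply: (le_trans (pderive_increment (e := e / 4) d1 _)) => [s Hs|].
    apply: Hd; rewrite (le_lt_trans _ kd) // (le_trans _ (small s 0 Hs _)) //.
      by rewrite mul0r addr0.
    by rewrite normr0.
  by rewrite ler_wpM2l ?normr_Re_le // mulr_ge0 // ltW.
have H2 : cmod (f (z + (complex.Re k)%:C * 1 + (complex.Im k)%:C * 'i%C)
    - f (z + (complex.Re k)%:C * 1)
    - (complex.Im k)%:C * pderive 'i%C f z) <= 2 * (e / 4) * cmod k.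
  apply: (le_trans (pderive_increment (e := e / 4) di _)) => [s Hs|].
    rewrite -addrA; apply: Hd'; rewrite (le_lt_trans _ kd') //.
    exact: small.
  by rewrite ler_wpM2l ?normr_Im_le // mulr_ge0 // ltW.
have kE : k = (complex.Re k)%:C * 1 + (complex.Im k)%:C * 'i%C.
  by rewrite mulr1 mulrC -complexE.
move: H2; rewrite -(addrA z) -kE => H2.
have -> : f (z + k) - f z - (dz f z * k + dzbar f z * cj k) =
  (f (z + (complex.Re k)%:C * 1) - f z - (complex.Re k)%:C * pderive 1 f z) +
  (f (z + k) - f (z + (complex.Re k)%:C * 1)
   - (complex.Im k)%:C * pderive 'i%C f z).
  have -> : dz f z * k + dzbar f z * cj k =
      (complex.Re k)%:C * pderive 1 f z + (complex.Im k)%:C * pderive 'i%C f z.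
    rewrite {1 2}kE !conjE /dz /dzbar !mulr1.
    by apply: wirtinger_identity; rewrite -expr2 sqr_i.
  by ring.
rewrite (le_trans (cmodD _ _)) // (le_trans (lerD H1 H2)) //.
by rewrite -mulrDl ler_wpM2r ?cmod_ge0 //; lra.
Qed.

(** A class of differentiable functions that contains the two partial derivatives of its members
    consists of smooth functions: the recursion of [Cn] never leaves S. The two expressions are d/dx
    and d/dy in terms of the Wirtinger derivatives. *)
Lemma Cn_class (S : (C -> C) -> Prop) :
  (forall f, S f -> exists fz fzb : C -> C, [/\ forall z, wirt f z (fz z) (fzb z),
     S (fun z => fz z + fzb z) & S (fun z => 'i%C * (fz z - fzb z))]) ->
  forall n f, S f -> Cn n f.
Proof.
move=> H; elim=> [|n IH] f Sf; have [fz [fzb [W S1 S2]]] := H f Sf.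
  by split=> //; apply/continuous_epsP => z e e0; exact: wirt_continuous (W z) _ e0.
split; first by apply/continuous_epsP => z e e0; exact: wirt_continuous (W z) _ e0.
split.
- by move=> z; exact: wirt_pderivable (W z).
- by move=> z; exact: wirt_pderivable (W z).
- rewrite (_ : pderive 1 f = fun z => fz z + fzb z); first exact: IH.
  by apply/funext => z; rewrite (wirt_pderive _ (W z)) conj1 !mulr1.
- rewrite (_ : pderive 'i%C f = fun z => 'i%C * (fz z - fzb z)); first exact: IH.
  by apply/funext => z; rewrite (wirt_pderive _ (W z)) conji; ring.
Qed.

Lemma wirt_entire_dz h z : entire h -> wirt h z (dz h z) 0.
Proof. by move=> /entire_wirtP/(_ z)[a H]; rewrite (wirt_dz H). Qed.

Lemma entireD g h : entire g -> entire h -> entire (fun z => g z + h z).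
Proof.
move=> Hg Hh; apply/entire_wirtP => z; eexists.
by have := wirtD (wirt_entire_dz z Hg) (wirt_entire_dz z Hh); rewrite addr0; exact.
Qed.

Lemma entireM g h : entire g -> entire h -> entire (fun z => g z * h z).
Proof.
move=> Hg Hh; apply/entire_wirtP => z; eexists.
have := wirtM (wirt_entire_dz z Hg) (wirt_entire_dz z Hh).
by rewrite mul0r mulr0 addr0; exact.
Qed.

Lemma entire_cst a : entire (fun=> a).
Proof. by apply/entire_wirtP => z; exists 0; exact: wirt_cst. Qed.

Lemma entire_id : entire (id : C -> C).
Proof. by apply/entire_wirtP => z; exists 1; exact: wirt_id. Qed.

Lemma entire_comp g h : entire g -> entire h -> entire (fun z => g (h z)).
Proof.
move=> Hg Hh; apply/entire_wirtP => z; eexists.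
have := wirt_comp (wirt_entire_dz z Hh) (wirt_entire_dz (h z) Hg).
by rewrite conj0 !mulr0 !mul0r !addr0; exact.
Qed.

Lemma entire_cexp : entire (@cexp R).
Proof. by apply/entire_wirtP => z; exists (cexp z); exact: wirt_cexp. Qed.

Lemma entireX h n : entire h -> entire (fun z => h z ^+ n).
Proof.
move=> Hh; elim: n => [|n IH]; first exact: entire_cst.
rewrite (_ : (fun z => h z ^+ n.+1) = (fun z => h z * h z ^+ n)).
  exact: entireM.
by apply/funext => z; rewrite exprS.
Qed.

End Regularity.

Arguments entire_cst {R} a z.

(** * Cauchy's theorem and Taylor expansions *)

Section Goursat.
Variable R : realType.
Local Notation C := R[i].
Variables (P Q P1 P2 Q1 Q2 : C -> C) (A B : R -> R -> C).

Let inD (x y : R) := (-1 < x) && (-1 < y).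

Hypothesis dA : forall x y, inD x y -> rderiv (A^~ y) x (P (x +i* y)).
Hypothesis dB : forall x y, inD x y -> rderiv (B x) y (Q (x +i* y)).
Hypothesis dP : forall x y, inD x y ->
  wirt P (x +i* y) (P1 (x +i* y)) (P2 (x +i* y)).
Hypothesis dQ : forall x y, inD x y ->
  wirt Q (x +i* y) (Q1 (x +i* y)) (Q2 (x +i* y)).
Hypothesis closed_form : forall x y, inD x y ->
  'i%C * (P1 (x +i* y) - P2 (x +i* y)) = Q1 (x +i* y) + Q2 (x +i* y).

(* The integral of P dx + Q dy along the boundary of a rectangle, expressed
   with partial primitives A of P and B of Q. *)
Let E (a b c d : R) : C :=
  (A b c - A a c) + (B b d - B b c) - (A b d - A a d) - (B a d - B a c).

Let E_split a m b c k d :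
  E a b c d = (E a m c k + E m b c k) + (E a m k d + E m b k d).
Proof. by rewrite /E; ring. Qed.

Lemma rderivB (F G : R -> C) x l l' : rderiv F x l -> rderiv G x l' ->
  rderiv (fun t => F t - G t) x (l - l').
Proof.
move=> HF HG e e0.
have [d d0 Hd] := HF _ (divr_gt0 e0 (ltr0Sn _ 1)).
have [d' d'0 Hd'] := HG _ (divr_gt0 e0 (ltr0Sn _ 1)).
exists (Num.min d d'); first by rewrite lt_min d0.
move=> h; rewrite lt_min => /andP[h1 h2].
have -> : F (x + h) - G (x + h) - (F x - G x) - h%:C * (l - l') =
  (F (x + h) - F x - h%:C * l) - (G (x + h) - G x - h%:C * l') by ring.
apply: le_trans (cmodB _ _) _; have := lerD (Hd _ h1) (Hd' _ h2).
by rewrite -mulrDl -splitr.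
Qed.

Lemma rderiv_quad (u v : C) x :
  rderiv (fun t : R => t%:C * u + t%:C ^+ 2 * v) x (u + 2 * x%:C * v).
Proof.
move=> e e0; have K1 : 0 < cmod v + 1 by rewrite ltr_wpDl ?cmod_ge0.
exists (e / (cmod v + 1)); first exact: divr_gt0.
move=> h; rewrite ltr_pdivlMr // => hd.
rewrite rmorphD /= (_ : _ - _ = h%:C * (h%:C * v)); last by ring.
rewrite !cmodM cmodR mulrC ler_wpM2r //; apply: le_trans (ltW hd).
by rewrite ler_wpM2l // lerDl.
Qed.

(** Near p the form is its first-order expansion up to an error e l, where l bounds the distance to
    p. The expansion is closed and integrates to 0 around the rectangle, so the sides contribute at
    most 4 e l times l. *)
Let local_estimate x0 y0 (e : R) : inD x0 y0 -> 0 < e ->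
  exists2 dl : R, 0 < dl & forall a b c d : R,
    -1 < a -> -1 < c -> a <= x0 <= b -> c <= y0 <= d -> (b - a) + (d - c) < dl ->
    cmod (E a b c d) <= 4 * e * ((b - a) + (d - c)) ^+ 2.
Proof.
move=> D0 e0; set p := x0 +i* y0.
have [d1 d10 H1] := dP D0 e0; have [d2 d20 H2] := dQ D0 e0.
have CF := closed_form D0; rewrite -/p in H1 H2 CF.
exists (Num.min d1 d2); first by rewrite lt_min d10.
move=> a b c d a1 c1 /andP[ax xb] /andP[cy yd]; rewrite lt_min => /andP[l1 l2].
set l := (b - a) + (d - c) in l1 l2 *.
have ab : a <= b := le_trans ax xb; have cd : c <= d := le_trans cy yd.
have near (x y : R) : a <= x <= b -> c <= y <= d -> cmod (x +i* y - p) <= l.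
  move=> /andP[h1 h2] /andP[h3 h4]; apply: le_trans (cmod_le _) _.
  rewrite !ReImE /=; apply: lerD; rewrite ler_norml; lra.
have l0 : 0 <= l by rewrite addr_ge0 ?subr_ge0.
(* [La] is an explicit primitive in x of the first-order expansion of P at p, and [Mu] one in y of
   the expansion of Q. *)
pose La (x y : R) : C := x%:C * (P p + P1 p * ('i%C * y%:C - p) + P2 p * (- 'i%C * y%:C - cj p))
  + x%:C ^+ 2 * ((P1 p + P2 p) / 2).
pose Mu (x y : R) : C := y%:C * (Q p + Q1 p * (x%:C - p) + Q2 p * (x%:C - cj p))
  + y%:C ^+ 2 * ('i%C * (Q1 p - Q2 p) / 2).
have ReImc (x y : R) : x +i* y = x%:C + 'i%C * y%:C.
  by apply: complex_eq; rewrite !ReImE /=; ring.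
have hor (y : R) : c <= y <= d ->
    cmod ((A b y - La b y) - (A a y - La a y)) <= 2 * (e * l) * (b - a).
  move=> /andP[cy1 yd1].
  apply: (mvt_cmod (F := fun x => A x y - La x y) (F' := fun x => P (x +i* y) - (P p + P1 p * (x +i* y - p)
     + P2 p * cj (x +i* y - p))) ab) => x /andP[ax1 xb1]; split.
    have := rderivB (dA (x := x) (y := y) _) (rderiv_quad
      (P p + P1 p * ('i%C * y%:C - p) + P2 p * (- 'i%C * y%:C - cj p))
      ((P1 p + P2 p) / 2) x).
    rewrite /inD (lt_le_trans a1 ax1) (lt_le_trans c1 cy1) => /(_ isT).
    by congr rderiv; rewrite ReImc !conjE; field.
  have := H1 (x +i* y - p).
  rewrite subrKC => K.
  have N := near x y; rewrite ax1 xb1 cy1 yd1 in N; have {}N := N isT isT.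
  rewrite -(addrA (P p)) opprD addrA.
  by apply: le_trans (K (le_lt_trans N l1)) _; rewrite ler_wpM2l // ltW.
have ver (x : R) : a <= x <= b ->
    cmod ((B x d - Mu x d) - (B x c - Mu x c)) <= 2 * (e * l) * (d - c).
  move=> /andP[ax1 xb1].
  apply: (mvt_cmod (F := fun y => B x y - Mu x y) (F' := fun y => Q (x +i* y) - (Q p + Q1 p * (x +i* y - p)
     + Q2 p * cj (x +i* y - p))) cd) => y /andP[cy1 yd1]; split.
    have := rderivB (dB (x := x) (y := y) _) (rderiv_quad
      (Q p + Q1 p * (x%:C - p) + Q2 p * (x%:C - cj p))
      ('i%C * (Q1 p - Q2 p) / 2) y).
    rewrite /inD (lt_le_trans a1 ax1) (lt_le_trans c1 cy1) => /(_ isT).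
    by congr rderiv; rewrite ReImc !conjE; field.
  have := H2 (x +i* y - p).
  rewrite subrKC => K.
  have N := near x y; rewrite ax1 xb1 cy1 yd1 in N; have {}N := N isT isT.
  rewrite -(addrA (Q p)) opprD addrA.
  by apply: le_trans (K (le_lt_trans N l2)) _; rewrite ler_wpM2l // ltW.
have -> : E a b c d =
  (((A b c - La b c) - (A a c - La a c)) - ((A b d - La b d) - (A a d - La a d)))
  + (((B b d - Mu b d) - (B b c - Mu b c)) - ((B a d - Mu a d) - (B a c - Mu a c))).
  (* The affine part contributes the area of the rectangle times the defect of closedness at p,
     which is 0. *)
  suff : (La b c - La a c - (La b d - La a d)) + (Mu b d - Mu b c - (Mu a d - Mu a c)) = 0.
    by rewrite /E => Z; rewrite -[LHS]subr0 -Z; ring.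
  transitivity ((b%:C - a%:C) * (d%:C - c%:C) * ((Q1 p + Q2 p) - 'i%C * (P1 p - P2 p))).
    by rewrite /La /Mu; ring.
  by rewrite CF subrr mulr0.
have aab : a <= a <= b by rewrite lexx.
have bab : a <= b <= b by rewrite lexx andbT.
have ccd : c <= c <= d by rewrite lexx.
have dcd : c <= d <= d by rewrite lexx andbT.
apply: le_trans (cmodD _ _) _.
apply: le_trans (lerD (cmodB _ _) (cmodB _ _)) _.
apply: le_trans (lerD (lerD (hor _ ccd) (hor _ dcd)) (lerD (ver _ bab) (ver _ aab))) _.
by rewrite /l; nra.
Qed.

(** Repeated quartering: some quarter keeps a fourth of the boundary integral, while the local
    estimate at the common point of the nested rectangles decays with the square of the side, that
    is, faster by the arbitrary factor e. *)
Lemma goursat (a b c d : R) : -1 < a -> -1 < c -> a <= b -> c <= d -> E a b c d = 0.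
Proof.
move=> a1 c1 ab cd; pose w n := (b - a) / 2 ^+ n; pose v n := (d - c) / 2 ^+ n.
have w0 n : 0 <= w n by rewrite divr_ge0 ?subr_ge0 // exprn_ge0.
have v0 n : 0 <= v n by rewrite divr_ge0 ?subr_ge0 // exprn_ge0.
have wS n : w n = w n.+1 + w n.+1.
  by rewrite /w exprS; field; rewrite expf_neq0.
have vS n : v n = v n.+1 + v n.+1.
  by rewrite /v exprS; field; rewrite expf_neq0.
pose G n (p : R * R) := cmod (E p.1 (p.1 + w n) p.2 (p.2 + v n)).
(* Pigeonhole on the four quarters: if each were below a fourth of the total, additivity would fail.
   A rectangle of generation n is coded by its lower left corner, as its sides [w n] and [v n] are
   fixed. *)
have step (np : nat * (R * R)) : exists q : R * R,
    [/\ np.2.1 <= q.1, q.1 + w np.1.+1 <= np.2.1 + w np.1, np.2.2 <= q.2,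
        q.2 + v np.1.+1 <= np.2.2 + v np.1 & G np.1 np.2 <= 4 * G np.1.+1 q].
  case: np => n [x y] /=.
  have := E_split x (x + w n.+1) (x + w n) y (y + v n.+1) (y + v n).
  have -> : x + w n = x + w n.+1 + w n.+1 by rewrite wS addrA.
  have -> : y + v n = y + v n.+1 + v n.+1 by rewrite vS addrA.
  have := w0 n.+1; have := v0 n.+1; move=> vp wp Esp.
  set g := G n (x, y).
  have gE : g = cmod (E x (x + w n.+1 + w n.+1) y (y + v n.+1 + v n.+1)).
    by rewrite /g /G /= wS vS !addrA.
  have [H1|H1] := leP g (4 * G n.+1 (x, y)); first by exists (x, y); split => //=; lra.
  have [H2|H2] := leP g (4 * G n.+1 (x + w n.+1, y)).
    by exists (x + w n.+1, y); split => //=; lra.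
  have [H3|H3] := leP g (4 * G n.+1 (x, y + v n.+1)).
    by exists (x, y + v n.+1); split => //=; lra.
  have [H4|H4] := leP g (4 * G n.+1 (x + w n.+1, y + v n.+1)).
    by exists (x + w n.+1, y + v n.+1); split => //=; lra.
  have : g <= G n.+1 (x, y) + G n.+1 (x + w n.+1, y) + (G n.+1 (x, y + v n.+1)
     + G n.+1 (x + w n.+1, y + v n.+1)).
    rewrite gE Esp (le_trans (cmodD _ _)) // lerD // (le_trans (cmodD _ _)) //.
  by move=> H5; lra.
have [next Hnext] := choice step.
pose pos := fix pos n := if n is m.+1 then next (m, pos m) else (a, c).
have Hpos n : [/\ (pos n).1 <= (pos n.+1).1,
    (pos n.+1).1 + w n.+1 <= (pos n).1 + w n, (pos n).2 <= (pos n.+1).2,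
    (pos n.+1).2 + v n.+1 <= (pos n).2 + v n & G n (pos n) <= 4 * G n.+1 (pos n.+1)].
  exact: (Hnext (n, pos n)).
have nested n m : [/\ (pos n).1 <= (pos (n + m)%N).1,
    (pos (n + m)%N).1 + w (n + m)%N <= (pos n).1 + w n, (pos n).2 <= (pos (n + m)%N).2 &
    (pos (n + m)%N).2 + v (n + m)%N <= (pos n).2 + v n].
  elim: m => [|m [i1 i2 i3 i4]]; first by rewrite addn0.
  by rewrite addnS; have [j1 j2 j3 j4 _] := Hpos (n + m)%N%N; split; lra.
have cross1 n m : (pos n).1 <= (pos m).1 + w m.
  have [k1 k2 _ _] := nested n m; have [] := nested m n; rewrite addnC.
  by have := w0 (n + m)%N; lra.
have cross2 n m : (pos n).2 <= (pos m).2 + v m.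
  have [_ _ k1 k2] := nested n m; have [] := nested m n; rewrite addnC.
  by have := v0 (n + m)%N; lra.
(* Every left edge lies to the left of every right edge ([cross1]), so the supremum of the left
   edges is in all the intervals; likewise for the heights. *)
pose x0 := sup (range (fun n => (pos n).1)).
pose y0 := sup (range (fun n => (pos n).2)).
have x0l n : (pos n).1 <= x0.
  by apply: ub_le_sup; [exists ((pos 0%N).1 + w 0%N) => _ [m _ <-]; exact: cross1 | exists n].
have x0u n : x0 <= (pos n).1 + w n.
  apply: ge_sup; first by exists (pos 0%N).1, 0%N.
  by move=> _ [m _ <-]; exact: cross1.
have y0l n : (pos n).2 <= y0.
  by apply: ub_le_sup; [exists ((pos 0%N).2 + v 0%N) => _ [m _ <-]; exact: cross2 | exists n].
have y0u n : y0 <= (pos n).2 + v n.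
  apply: ge_sup; first by exists (pos 0%N).2, 0%N.
  by move=> _ [m _ <-]; exact: cross2.
have posge n : a <= (pos n).1 /\ c <= (pos n).2.
  by have [] := nested 0%N n; rewrite add0n.
have D0 : inD x0 y0.
  by rewrite /inD (lt_le_trans a1 (x0l 0%N)) (lt_le_trans c1 (y0l 0%N)).
have Gn n : G 0%N (a, c) <= 4 ^+ n * G n (pos n).
  elim: n => [|n IH]; first by rewrite expr0 mul1r.
  rewrite (le_trans IH) // exprSr -mulrA ler_wpM2l ?exprn_ge0 //.
  by have [] := Hpos n.
have <- : a + w 0%N = b by rewrite /w expr0 divr1 subrKC.
have <- : c + v 0%N = d by rewrite /v expr0 divr1 subrKC.
apply: cmod_lt_small => e e0; rewrite -/(G 0%N (a, c)).
set S := (b - a) + (d - c).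
have S0 : 0 <= S by rewrite addr_ge0 ?subr_ge0.
(* At generation n the estimate is 4^n times 4 e' (S / 2^n)^2 = 4 e' S^2, independent of n; e' is
   chosen to make this at most e, also when S = 0. *)
have e'0 : 0 < e / (4 * S ^+ 2 + 1) by rewrite divr_gt0 // ltr_wpDl ?mulr_ge0 ?sqr_ge0.
have [dl dl0 Hdl] := local_estimate D0 e'0.
have [n Hn] : exists n : nat, S / 2 ^+ n < dl.
  have [n Hn] : exists n : nat, S / dl < n%:R.
    by exists (Num.truncn (S / dl)).+1; exact: truncnS_gt.
  exists n; rewrite ltr_pdivrMr ?exprn_gt0 // mulrC -ltr_pdivrMr //.
  by rewrite (lt_trans Hn) // -natrX ltr_nat ltn_expl.
have [pa pc] := posge n.
have wvE : (pos n).1 + w n - (pos n).1 + ((pos n).2 + v n - (pos n).2) = S / 2 ^+ n.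
  by rewrite /S mulrDl !addrA /w /v; ring.
have := Hdl (pos n).1 ((pos n).1 + w n) (pos n).2 ((pos n).2 + v n).
rewrite wvE (lt_le_trans a1 pa) (lt_le_trans c1 pc) x0l x0u y0l y0u.
move=> /(_ isT isT isT isT Hn) K.
rewrite (le_trans (Gn n)) // (le_trans (ler_wpM2l _ K)) ?exprn_ge0 //.
have -> : (4 : R) ^+ n = 2 ^+ n * 2 ^+ n by rewrite -exprMn; congr (_ ^+ _); ring.
have t0 : (2 : R) ^+ n != 0 by rewrite expf_neq0.
have S1 : 4 * S ^+ 2 + 1 != 0 by rewrite gt_eqF // ltr_wpDl ?mulr_ge0 ?sqr_ge0.
rewrite [X in X <= _](_ : _ = e * (4 * S ^+ 2) / (4 * S ^+ 2 + 1)); last first.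
  move: (2 ^+ n) t0 => t t0; move: (4 * S ^+ 2 + 1) S1 => q q0.
  by field; rewrite t0 q0.
rewrite ler_pdivrMr ?ltr_wpDl ?mulr_ge0 ?sqr_ge0 // ler_wpM2l ?(ltW e0) //.
by rewrite lerDl.
Qed.

End Goursat.

(** * Primitives and integrals over one period *)

Section Primitives.
Variable R : realType.
Local Notation C := R[i].
Implicit Types (F G : R -> C) (f g h : C -> C) (z w u : C).

Definition rcont F : Prop := forall (x e : R), 0 < e ->
  exists2 d : R, 0 < d & forall h : R, `|h| < d -> cmod (F (x + h) - F x) <= e.

Lemma rderiv_rcont F : (forall x, exists l, rderiv F x l) -> rcont F.
Proof.
move=> H x e e0; have [l Hl] := H x; have [d d0 Hd] := Hl _ ltr01.
have K0 : 0 < cmod l + 1 by rewrite ltr_wpDl ?cmod_ge0.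
exists (Num.min d (e / (cmod l + 1))); first by rewrite lt_min d0 divr_gt0.
move=> h; rewrite lt_min ltr_pdivlMr // => /andP[hd he].
rewrite (_ : _ - _ = (F (x + h) - F x - h%:C * l) + h%:C * l); last by ring.
rewrite (le_trans (cmodD _ _)) // (le_trans _ (ltW he)) // mulrDr mulr1 addrC lerD //.
  by rewrite cmodM cmodR.
by have := Hd _ hd; rewrite mul1r.
Qed.

Lemma continuous_real_epsP (phi : R -> R) : continuous phi <->
  forall x (e : R), 0 < e ->
    exists2 d : R, 0 < d & forall k, `|k| < d -> `|phi (x + k) - phi x| <= e.
Proof.
split=> [H x e e0|H x].
  have /cvgrPdist_le/(_ e e0) := H x.
  move=> /nbhs_ballP[d /= d0 Hd]; exists d => // k kd; rewrite distrC.
  by apply: Hd; rewrite /ball /= opprD addrA subrr add0r normrN.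
apply/cvgrPdist_le => e e0; have [d d0 Hd] := H x _ e0.
apply/nbhs_ballP; exists d => // y; rewrite /ball /= distrC => /Hd.
by rewrite subrKC distrC.
Qed.

Lemma rcont_ReIm F : rcont F -> continuous (fun x => complex.Re (F x)) /\
  continuous (fun x => complex.Im (F x)).
Proof.
move=> H; split; apply/continuous_real_epsP => x e /(H x)[d d0 Hd];
  exists d => // k /Hd; apply: le_trans.
- by apply: le_trans (normr_Re_le _); rewrite !ReImE.
- by apply: le_trans (normr_Im_le _); rewrite !ReImE.
Qed.

(** The fundamental theorem of calculus on [-1, x + 1], in which x is an interior point. *)
Lemma real_primitive (phi : R -> R) : continuous phi ->
  exists G : R -> R, forall x : R, -1 < x -> is_derive x 1 G (phi x).
Proof.
move=> cphi.
exists (fun x => \int[lebesgue_measure]_(t in [set` `[(-1)%R, x]]) phi t) => x x1.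
have xu : x < x + 1 by rewrite ltrDl.
have cint : lebesgue_measure.-integrable `[(-1)%R, (x + 1)%R] (EFin \o phi).
  apply: continuous_compact_integrable; first exact: segment_compact.
  exact: continuous_subspaceT.
have [d1 d2] := continuous_FTC1_closed xu cint x1 (cphi x).
by apply: (DeriveDef d1); rewrite -derive1E.
Qed.

Lemma primitive_exists F : rcont F ->
  exists G : R -> C, forall x : R, -1 < x -> rderiv G x (F x).
Proof.
move=> /rcont_ReIm[/real_primitive[G1 H1] /real_primitive[G2 H2]].
exists (fun x => G1 x +i* G2 x) => x x1; apply: ReIm_rderiv => /=; first exact: H1.
exact: H2.
Qed.

(* The base point -1 makes 0 an interior point, so that no one-sided derivative
   occurs on [0, 2 pi]. *)
Definition prim F : R -> C :=
  xget (fun=> 0) [set G | forall x : R, -1 < x -> rderiv G x (F x)].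

Lemma primP F x : rcont F -> -1 < x -> rderiv (prim F) x (F x).
Proof.
move=> /primitive_exists[G HG]; rewrite /prim.
by case: xgetP => [y _ H|/(_ G)//]; exact: H.
Qed.

(** The integral of F over [0, 2 pi] as an increment of a primitive, which is the form in which
    integrals enter [goursat]. *)
Definition loop_int F : C := prim F (2 * pi) - prim F 0.

(** Two primitives differ by a function of derivative 0, so the mean value bound holds with M =
    0. *)
Lemma loop_intE F G : rcont F -> (forall x, -1 < x -> rderiv G x (F x)) ->
  loop_int F = G (2 * pi) - G 0.
Proof.
move=> cF dG; have pi0 : 0 <= 2 * pi :> R by rewrite mulr_ge0 // pi_ge0.
have : cmod ((prim F (2 * pi) - G (2 * pi)) - (prim F 0 - G 0)) <= 2 * 0 * (2 * pi - 0).
  apply: (mvt_cmod (F := fun x => prim F x - G x) (F' := fun x => F x - F x) pi0).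
  move=> x /andP[x0 _]; split; last by rewrite subrr cmod0.
  by apply: rderivB; [apply: primP|apply: dG] => //; exact: lt_le_trans x0.
rewrite mulr0 mul0r => H; apply/eqP; rewrite -subr_eq0 -cmod_eq0.
rewrite eq_le cmod_ge0 andbT; apply: le_trans H.
by rewrite le_eqVlt; apply/orP; left; apply/eqP; congr cmod; rewrite /loop_int; ring.
Qed.

Lemma loop_int_bound F (M : R) : rcont F ->
  (forall t, 0 <= t <= 2 * pi -> cmod (F t) <= M) ->
  cmod (loop_int F) <= 4 * pi * M.
Proof.
move=> cF HM; have pi0 : 0 <= 2 * pi :> R by rewrite mulr_ge0 // pi_ge0.
apply: (le_trans (mvt_cmod (F' := F) (M := M) pi0 _)) => [x x0|].
  split; last exact: HM.
  by apply: primP => //; case/andP: x0 => x0 _; exact: lt_le_trans x0.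
by rewrite subr0 le_eqVlt; apply/orP; left; apply/eqP; ring.
Qed.

Lemma rcontD F G : rcont F -> rcont G -> rcont (fun t => F t + G t).
Proof.
move=> HF HG x e e0.
have [d d0 Hd] := HF x _ (divr_gt0 e0 (ltr0Sn _ 1)).
have [d' d'0 Hd'] := HG x _ (divr_gt0 e0 (ltr0Sn _ 1)).
exists (Num.min d d'); first by rewrite lt_min d0.
move=> h; rewrite lt_min => /andP[h1 h2].
rewrite (_ : _ - _ = (F (x + h) - F x) + (G (x + h) - G x)); last by ring.
by apply: le_trans (cmodD _ _) _; have := lerD (Hd _ h1) (Hd' _ h2); rewrite -splitr.
Qed.

Lemma rcontZ a F : rcont F -> rcont (fun t => a * F t).
Proof.
move=> HF x e e0; have K0 : 0 < cmod a + 1 by rewrite ltr_wpDl ?cmod_ge0.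
have [d d0 Hd] := HF x _ (divr_gt0 e0 K0); exists d => // h hd.
rewrite -mulrBr cmodM; apply: le_trans (ler_wpM2l (cmod_ge0 _) (Hd _ hd)) _.
by rewrite mulrA ler_pdivrMr // mulrC ler_wpM2l ?(ltW e0) // lerDl.
Qed.

Lemma rderivD F G x (l l' : C) : rderiv F x l -> rderiv G x l' ->
  rderiv (fun t => F t + G t) x (l + l').
Proof.
move=> HF HG e e0.
have [d d0 Hd] := HF _ (divr_gt0 e0 (ltr0Sn _ 1)).
have [d' d'0 Hd'] := HG _ (divr_gt0 e0 (ltr0Sn _ 1)).
exists (Num.min d d'); first by rewrite lt_min d0.
move=> h; rewrite lt_min => /andP[h1 h2].
rewrite (_ : _ - _ = (F (x + h) - F x - h%:C * l) + (G (x + h) - G x - h%:C * l'));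
  last by ring.
by apply: le_trans (cmodD _ _) _; have := lerD (Hd _ h1) (Hd' _ h2); rewrite -mulrDl -splitr.
Qed.

Lemma rderivZ a F x (l : C) : rderiv F x l -> rderiv (fun t => a * F t) x (a * l).
Proof.
move=> HF e e0; have K0 : 0 < cmod a + 1 by rewrite ltr_wpDl ?cmod_ge0.
have [d d0 Hd] := HF _ (divr_gt0 e0 K0); exists d => // h hd.
rewrite (_ : _ - _ = a * (F (x + h) - F x - h%:C * l)); last by ring.
rewrite cmodM; apply: le_trans (ler_wpM2l (cmod_ge0 _) (Hd _ hd)) _.
rewrite mulrA ler_wpM2r // mulrA ler_pdivrMr // mulrC ler_wpM2l ?(ltW e0) //.
by rewrite lerDl.
Qed.

Lemma loop_intD F G : rcont F -> rcont G ->
  loop_int (fun t => F t + G t) = loop_int F + loop_int G.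
Proof.
move=> cF cG.
rewrite (loop_intE (G := fun t => prim F t + prim G t)); first by rewrite /loop_int; ring.
  exact: rcontD.
by move=> x x1; apply: rderivD; apply: primP.
Qed.

Lemma loop_intZ a F : rcont F -> loop_int (fun t => a * F t) = a * loop_int F.
Proof.
move=> cF.
rewrite (loop_intE (G := fun t => a * prim F t)); first by rewrite /loop_int; ring.
  exact: rcontZ.
by move=> x x1; apply: rderivZ; apply: primP.
Qed.

Lemma rcont_bounded F (a b : R) :
  rcont F -> exists M : R, forall t, a <= t <= b -> cmod (F t) <= M.
Proof.
move=> cF; have [ab|ba] := leP a b; last first.
  by exists 0 => t /andP[h1 h2]; move: (le_trans h1 h2); rewrite leNgt ba.
have [] := @EVT_max R (fun t => cmod (F t)) a b ab.
  apply: continuous_subspaceT; apply/continuous_real_epsP => x e /(cF x)[d d0 Hd].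
  exists d => // k /Hd; apply: le_trans; rewrite ler_norml.
  have := cmodD (F (x + k) - F x) (F x); have := cmodD (F x - F (x + k)) (F (x + k)).
  by rewrite !subrK [cmod (F x - _)]cmod_dist; lra.
by move=> c _ Hc; exists (cmod (F c)) => t tab; apply: Hc; rewrite in_itv.
Qed.

End Primitives.

(** * Integrals over circles centred at 0 *)

Section CircleIntegrals.
Variable R : realType.
Local Notation C := R[i].
Implicit Types (F G : R -> C) (f g h : C -> C) (z w u a b : C) (r t x : R).

Lemma cmod_ge_sub z w : cmod z - cmod w <= cmod (z - w).
Proof. by rewrite lerBlDr (le_trans _ (cmodD _ _)) // subrK. Qed.

(** The remainder equals h^2 / (z^2 (z + h)), and |z + h| >= |z| / 2 once |h| < |z| / 2. *)
Lemma wirt_inv z : z != 0 -> wirt (fun w => w^-1) z (- z^-1 ^+ 2) 0.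
Proof.
rewrite -cmod_gt0 => z0; apply: (@little_o_quad _ _ (2 / cmod z ^+ 3) (cmod z / 2)).
  by rewrite divr_gt0.
move=> h hz.
have Hm : cmod z / 2 <= cmod (z + h).
  have := cmod_ge_sub z (- h); rewrite opprK cmodN; apply: le_trans; lra.
have zh0 : z + h != 0 by rewrite -cmod_gt0 (lt_le_trans _ Hm) // divr_gt0.
have zn0 : z != 0 by rewrite -cmod_gt0.
rewrite (_ : _ - _ = h ^+ 2 * (z ^+ 2 * (z + h))^-1); last first.
  by field; rewrite zh0 zn0.
rewrite cmodM cmodX cmodV cmodM cmodX [_ * cmod h ^+ 2]mulrC ler_wpM2l ?sqr_ge0 //.
rewrite -[2 / _]invrK lef_pV2 ?posrE ?invr_gt0 ?divr_gt0 ?mulr_gt0 ?exprn_gt0 ?cmod_gt0 //.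
by rewrite invf_div exprSr -mulrA ler_wpM2l ?sqr_ge0.
Qed.

Definition cis t : C := cexp ('i%C * t%:C).

Lemma cmod_cis t : cmod (cis t) = 1.
Proof. by rewrite cmod_cexp !ReImE /= mul0r mulr0 subrr expR0. Qed.

Lemma cis0 : cis 0 = 1.
Proof. by rewrite /cis mulr0 cexp0. Qed.

Lemma cisE t : cis t = cos t +i* sin t.
Proof.
rewrite /cis (_ : 'i%C * t%:C = 0 +i* t); last first.
  by apply: complex_eq; rewrite !ReImE /=; ring.
by rewrite /cexp /= expR0 !mul1r.
Qed.

Lemma cis_2pi : cis (2 * pi) = 1.
Proof.
by rewrite cisE mulr_natl cos2pi sin2pi.
Qed.

Lemma rderiv_real t : rderiv (fun s : R => s%:C) t 1.
Proof.
move=> e e0; exists 1 => // h _; rewrite rmorphD /= (_ : _ - _ = 0); last by ring.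
by rewrite cmod0 mulr_ge0 // ltW.
Qed.

Lemma rderiv_cis t : rderiv cis t ('i%C * cis t).
Proof.
have := wirt_curve (wirt_cexp ('i%C * t%:C)) (rderivZ 'i%C (rderiv_real t)).
by rewrite mul0r addr0 mulr1 mulrC.
Qed.

Lemma rderiv_circle r t : rderiv (fun s => r%:C * cis s) t ('i%C * (r%:C * cis t)).
Proof. by have := rderivZ r%:C (rderiv_cis t); rewrite mulrCA. Qed.

(** The integral is against dt, not dz; since dz = i z dt, the Cauchy kernel takes the form z / (z -
    w) and a derivative enters as f' z * z. *)
Definition circ r f : C := loop_int (fun t => f (r%:C * cis t)).

(** A condition that makes the integrand continuous along the circle and is stable under sums,
    products and inverses. *)
Definition cdiff r f : Prop := forall z, cmod z = r -> exists a b, wirt f z a b.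

Lemma cmod_circle r t : 0 <= r -> cmod (r%:C * cis t) = r.
Proof. by move=> r0; rewrite cmodM cmod_cis mulr1 cmodR ger0_norm. Qed.

Lemma cdiff_rcont r f : 0 <= r -> cdiff r f -> rcont (fun t => f (r%:C * cis t)).
Proof.
move=> r0 df; apply: rderiv_rcont => t.
have [a [b Hf]] := df _ (cmod_circle t r0).
by eexists; exact: wirt_curve Hf (rderiv_circle r t).
Qed.

Lemma cdiffM r f g : cdiff r f -> cdiff r g -> cdiff r (fun z => f z * g z).
Proof.
move=> df dg z zr; have [a [b Hf]] := df z zr; have [a' [b' Hg]] := dg z zr.
by eexists; eexists; exact: wirtM Hf Hg.
Qed.

Lemma cdiffD r f g : cdiff r f -> cdiff r g -> cdiff r (fun z => f z + g z).
Proof.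
move=> df dg z zr; have [a [b Hf]] := df z zr; have [a' [b' Hg]] := dg z zr.
by eexists; eexists; exact: wirtD Hf Hg.
Qed.

Lemma cdiff_cst r a : cdiff r (fun=> a).
Proof. by move=> z _; exists 0, 0; exact: wirt_cst. Qed.

Lemma cdiff_id r : cdiff r id.
Proof. by move=> z _; exists 1, 0; exact: wirt_id. Qed.

Lemma cdiffZ r a f : cdiff r f -> cdiff r (fun z => a * f z).
Proof. exact/cdiffM/cdiff_cst. Qed.

Lemma cdiff_entire r h : entire h -> cdiff r h.
Proof. by move=> H z _; exists (dz h z), 0; exact: wirt_entire_dz. Qed.

Lemma cdiff_inv r f : (forall z, cmod z = r -> f z != 0) -> cdiff r f ->
  cdiff r (fun z => (f z)^-1).
Proof.
move=> f0 df z zr; have [a [b Hf]] := df z zr.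
by eexists; eexists; exact: wirt_comp Hf (wirt_inv (f0 z zr)).
Qed.

Lemma cdiffX r f n : cdiff r f -> cdiff r (fun z => f z ^+ n).
Proof.
move=> df z zr; have [a [b Hf]] := df z zr.
by eexists; eexists; exact: wirtX Hf.
Qed.

Lemma circD r f g : 0 <= r -> cdiff r f -> cdiff r g ->
  circ r (fun z => f z + g z) = circ r f + circ r g.
Proof. by move=> r0 df dg; apply: loop_intD; apply: cdiff_rcont. Qed.

Lemma circZ r a f : 0 <= r -> cdiff r f -> circ r (fun z => a * f z) = a * circ r f.
Proof. by move=> r0 df; apply: loop_intZ; apply: cdiff_rcont. Qed.

Lemma circ_sum r n (F : nat -> C -> C) : 0 <= r -> (forall i, cdiff r (F i)) ->
  circ r (fun z => \sum_(i < n) F i z) = \sum_(i < n) circ r (F i).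
Proof.
move=> r0 dF; elim: n => [|n IH].
  rewrite big_ord0 (_ : (fun z => _) = fun z => 0 * 0); last first.
    by apply/funext => z; rewrite big_ord0 mul0r.
  by rewrite circZ ?mul0r //; exact: cdiff_cst.
rewrite big_ord_recr /= -IH -circD //; last first.
  move=> z zr; elim: n {IH} => [|n [a [b W]]].
    exists 0, 0; apply: eq_wirt (wirt_cst 0 z) => u; by rewrite big_ord0.
  have [a' [b' W']] := dF n z zr.
  exists (a + a'), (b + b'); apply: eq_wirt (wirtD W W') => u.
  by rewrite big_ord_recr.
by congr circ; apply/funext => z; rewrite big_ord_recr.
Qed.

Lemma circ_bound r f (M : R) : 0 <= r -> cdiff r f ->
  (forall t, 0 <= t <= 2 * pi -> cmod (f (r%:C * cis t)) <= M) ->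
  cmod (circ r f) <= 4 * pi * M.
Proof.
by move=> r0 df HM; apply: loop_int_bound => //; exact: cdiff_rcont.
Qed.

Lemma cdiff_bounded r f : 0 <= r -> cdiff r f ->
  exists M : R, forall t, 0 <= t <= 2 * pi -> cmod (f (r%:C * cis t)) <= M.
Proof. by move=> r0 /(cdiff_rcont r0)/rcont_bounded; exact. Qed.

Lemma eq_circ r f g : 0 <= r -> (forall z, cmod z = r -> f z = g z) ->
  circ r f = circ r g.
Proof.
by move=> r0 H; congr loop_int; apply/funext => t; apply/H/cmod_circle.
Qed.

(** Up to the factor i, f' (z) z is the derivative of f along the parametrised circle, a closed
    curve. *)
Lemma circ_derivative r f f' : 0 <= r ->
  (forall z, cmod z = r -> wirt f z (f' z) 0) -> cdiff r f' ->
  circ r (fun z => f' z * z) = 0.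
Proof.
move=> r0 df df'.
have d1 : cdiff r (fun z => f' z * z) by apply: cdiffM => //; exact: cdiff_id.
apply: (mulfI (_ : 'i%C != 0 :> C)); first by rewrite -cmod_eq0 cmod_i oner_eq0.
rewrite mulr0 -circZ //; rewrite /circ.
rewrite (loop_intE (G := fun t => f (r%:C * cis t))).
- by rewrite cis_2pi cis0 subrr.
- by apply: (@cdiff_rcont _ (fun z => 'i%C * (f' z * z))) => //; exact: cdiffZ.
move=> t _; have := wirt_curve (df _ (cmod_circle t r0)) (rderiv_circle r t).
by rewrite mul0r addr0 mulrCA.
Qed.

End CircleIntegrals.

(** * The central step of Cauchy's formula *)

Section Cauchy.
Variable R : realType.
Local Notation C := R[i].
Implicit Types (f g h : C -> C) (z w u a b : C) (r t x : R).

Lemma sub_neq0 r z w : cmod w < r -> cmod z = r -> z - w != 0.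
Proof.
move=> wr zr; rewrite -cmod_gt0 (lt_le_trans _ (cmod_ge_sub z w)) //.
by rewrite zr subr_gt0.
Qed.

Lemma halfC : (1 / 2 : R)%:C = 2^-1.
Proof. by rewrite div1r fmorphV /= rmorph_nat. Qed.

Lemma wirt_ReC z : wirt (fun u => (complex.Re u)%:C) z 2^-1 2^-1.
Proof. by rewrite -halfC; exact: (wirt_Re (phi := id) (is_derive_id _ _)). Qed.

Lemma wirt_ImC z : wirt (fun u => (complex.Im u)%:C) z (- 'i%C / 2) ('i%C / 2).
Proof. by rewrite -halfC; exact: (wirt_Im (phi := id) (is_derive_id _ _)). Qed.

Lemma wirt_cis_Im z : wirt (fun u => cis (complex.Im u)) z
  (cis (complex.Im z) / 2) (- (cis (complex.Im z) / 2)).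
Proof.
have := wirt_comp (wirtZ 'i%C (wirt_ImC z)) (wirt_cexp ('i%C * (complex.Im z)%:C)).
apply: wirt_eq; rewrite mul0r addr0 -/(cis _).
- rewrite (_ : 'i%C * (- 'i%C / 2) = - ('i%C ^+ 2) / 2); last by ring.
  by rewrite sqr_i opprK mul1r.
- rewrite (_ : 'i%C * ('i%C / 2) = ('i%C ^+ 2) / 2); last by ring.
  by rewrite sqr_i mulN1r mulrN.
Qed.

Lemma wirt_exp_Re r z : wirt (fun u => cexp ((complex.Re u)%:C - r%:C)) z
  (cexp ((complex.Re z)%:C - r%:C) / 2) (cexp ((complex.Re z)%:C - r%:C) / 2).
Proof.
have := wirt_comp (wirtB (wirt_ReC z) (wirt_cst r%:C z))
  (wirt_cexp ((complex.Re z)%:C - r%:C)).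
by apply: wirt_eq; rewrite mul0r addr0 subr0.
Qed.

(* Contract the circle |z| = r to w along k |-> w + e^(s - T) (z - w); the
   parametrised integrals agree for s = 0 and s = T, and the former tends to 0
   as T grows. *)
Lemma circ_sub_eq0 h w r : entire h -> cmod w < r ->
  circ r (fun z => (h z - h w) * (z / (z - w))) = 0.
Proof.
move=> eh wr; have r0 : 0 < r := le_lt_trans (cmod_ge0 w) wr.
have hder := wirt_entire_dz _ eh.
(* With u = s + i t, P ds + Q dt is the pullback of (h(v) - h(w)) dv / (v - w) under v = w + e^(s -
   T) (r e^(it) - w): the logarithmic differential of v - w is ds + q dt. Its closedness is the
   statement [closed] below. *)
pose k (u : C) := r%:C * cis (complex.Im u) - w.
have kn0 u : k u != 0 by apply: sub_neq0 wr _; rewrite cmod_circle // ltW.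
pose e1 (T : R) (u : C) := cexp ((complex.Re u)%:C - T%:C).
pose E1 (u : C) := r%:C * cis (complex.Im u).
pose P T (u : C) := h (w + e1 T u * k u) - h w.
pose q (u : C) := 'i%C * (E1 u / k u).
pose Q T (u : C) := P T u * q u.
pose al T u := (e1 T u * k u + e1 T u * E1 u) / 2.
pose be T u := (e1 T u * k u - e1 T u * E1 u) / 2.
have wE u : wirt E1 u (E1 u / 2) (- (E1 u / 2)).
  by apply: wirt_eq (wirtZ r%:C (wirt_cis_Im u)); rewrite /E1; ring.
have wk u : wirt k u (E1 u / 2) (- (E1 u / 2)).
  by apply: wirt_eq (wirtB (wE u) (wirt_cst w u)); rewrite subr0.
have wP T u : wirt (P T) u (dz h (w + e1 T u * k u) * al T u)
    (dz h (w + e1 T u * k u) * be T u).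
  have := wirtM (wirt_exp_Re T u) (wk u); rewrite -/(e1 T u) => H.
  have := wirtB (wirt_comp (wirtD (wirt_cst w u) H) (hder _)) (wirt_cst (h w) u).
  by apply: wirt_eq; rewrite /al /be -/(e1 T u); field.
pose ga (u : C) := 'i%C * (E1 u / 2 * (k u)^-1 + E1 u * (- (k u)^-1 ^+ 2 * (E1 u / 2))).
have wq u : wirt q u (ga u) (- ga u).
  have := wirtZ 'i%C (wirtM (wE u) (wirt_comp (wk u) (wirt_inv (kn0 u)))).
  by apply: wirt_eq; rewrite /ga; ring.
have wQ T u : wirt (Q T) u
    (dz h (w + e1 T u * k u) * al T u * q u + P T u * ga u)
    (dz h (w + e1 T u * k u) * be T u * q u + P T u * - ga u).
  exact: wirtM (wP T u) (wq u).
have closed T u : 'i%C * (dz h (w + e1 T u * k u) * al T u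
     - dz h (w + e1 T u * k u) * be T u) =
    (dz h (w + e1 T u * k u) * al T u * q u + P T u * ga u) +
    (dz h (w + e1 T u * k u) * be T u * q u + P T u * - ga u).
  by rewrite /al /be /q; field.
have lineH (y x : R) : rderiv (fun x : R => x +i* y) x 1.
  move=> e e0; exists 1 => // d _; rewrite (_ : _ - _ = 0).
    by rewrite cmod0 mulr_ge0 // ltW.
  by apply: complex_eq; rewrite !ReImE /=; ring.
have lineV (x y : R) : rderiv (fun y : R => x +i* y) y 'i%C.
  move=> e e0; exists 1 => // d _; rewrite (_ : _ - _ = 0).
    by rewrite cmod0 mulr_ge0 // ltW.
  by apply: complex_eq; rewrite !ReImE /=; ring.
have cP T y : rcont (fun x : R => P T (x +i* y)).
  apply: rderiv_rcont => x; eexists; exact: wirt_curve (wP T _) (lineH y x).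
have cQ T x : rcont (fun y : R => Q T (x +i* y)).
  apply: rderiv_rcont => y; eexists; exact: wirt_curve (wQ T _) (lineV x y).
pose A T (x y : R) := prim (fun s => P T (s +i* y)) x.
pose B T (x y : R) := prim (fun t => Q T (x +i* t)) y.
have pi0 : 0 <= 2 * pi :> R by rewrite mulr_ge0 // pi_ge0.
have main T : 0 <= T ->
    loop_int (fun t => Q T (T +i* t)) = loop_int (fun t => Q T (0 +i* t)).
  move=> T0.
  have H := @goursat R (P T) (Q T)
    (fun u => dz h (w + e1 T u * k u) * al T u)
    (fun u => dz h (w + e1 T u * k u) * be T u)
    (fun u => dz h (w + e1 T u * k u) * al T u * q u + P T u * ga u)
    (fun u => dz h (w + e1 T u * k u) * be T u * q u + P T u * - ga u)
    (A T) (B T)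
    (fun x y D => primP (cP T y) (proj1 (andP D)))
    (fun x y D => primP (cQ T x) (proj2 (andP D)))
    (fun x y _ => wP T _) (fun x y _ => wQ T _) (fun x y _ => closed T _)
    0 T 0 (2 * pi) (ltrN10 _) (ltrN10 _) T0 pi0.
  (* The sides t = 0 and t = 2 pi of the rectangle carry the same integral because the curve closes
     up; only the sides s = 0 and s = T remain. *)
  have AE x : A T x (2 * pi) = A T x 0.
    rewrite /A; congr (prim _ _); apply/funext => s; rewrite /P /k /e1 /=.
    by rewrite cis_2pi cis0.
  move: H; rewrite !AE => H; apply/eqP; rewrite -subr_eq0; apply/eqP.
  rewrite -H /loop_int /B.
  move: (A T _ _) (A T _ _) (prim _ _) (prim _ _) (prim _ _) (prim _ _) => a b c d e e'; ring.
have -> : circ r (fun z => (h z - h w) * (z / (z - w))) =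
    - 'i%C * loop_int (fun t => Q 0 (0 +i* t)).
  have cQ' := cQ 0 0.
  rewrite -loop_intZ // /circ; congr loop_int; apply/funext => t.
  rewrite /Q /P /q /e1 /k /E1 /= subrr cexp0 mul1r subrKC.
  rewrite (_ : - 'i%C * _ = - ('i%C ^+ 2) * ((h (r%:C * cis t) - h w) *
    (r%:C * cis t / (r%:C * cis t - w)))); last by ring.
  by rewrite sqr_i opprK mul1r.
(* At s = T the contraction factor is 1, whatever T is, so the quantity to be shown 0 does not
   depend on T. *)
have shift T : (fun t => Q T (T +i* t)) = (fun t => Q 0 (0 +i* t)).
  by apply/funext => t; rewrite /Q /P /q /e1 /k /E1 /= !subrr.
have -> : loop_int (fun t => Q 0 (0 +i* t)) = 0; last by rewrite mulr0.
apply: cmod_lt_small => e e0.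
(* M collects the factor 4 pi of [loop_int_bound] and the bound on |q|. Below, 2 r bounds |k|, and T
   = 2 r / d suffices because e^x exceeds x. *)
pose M := 4 * pi * (r / (r - cmod w)).
have M0 : 0 < M by rewrite !mulr_gt0 // ?pi_gt0 // invr_gt0 subr_gt0.
have [d d0 Hd] := wirt_continuous (hder w) (divr_gt0 e0 M0).
have [T T0 HT] : exists2 T : R, 0 <= T & expR (- T) * (2 * r) < d.
  exists (2 * r / d); first by rewrite divr_ge0 ?mulr_ge0 // ltW.
  have X0 : 0 < 2 * r / d by rewrite divr_gt0 // mulr_gt0.
  rewrite expRN [_ * (2 * r)]mulrC ltr_pdivrMr ?expR_gt0 // [d * _]mulrC -ltr_pdivrMr //.
  by rewrite (lt_le_trans _ (expR_ge1Dx _)) // ltrDr.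
rewrite -(shift T) main //.
rewrite (le_trans (loop_int_bound (M := e / M * (r / (r - cmod w))) (cQ T 0) _)) //.
  move=> t _; rewrite /Q /q cmodM; apply: ler_pM; rewrite ?cmod_ge0 //.
    apply: Hd; rewrite cmodM cmod_cexp !ReImE /= sub0r (le_lt_trans _ HT) //.
    rewrite ler_wpM2l ?expR_ge0 // (le_trans (cmodB _ _)) //.
    by rewrite cmod_circle ?(ltW r0) //= mulr2n mulrDl mul1r lerD2l ltW.
  rewrite /E1 /k /= !cmodM cmod_i mul1r cmodV cmodR cmod_cis mulr1 ger0_norm ?(ltW r0) // ler_pM2l //.
  have kt : r%:C * cis t - w != 0 := kn0 (0 +i* t).
  rewrite lef_pV2 ?posrE ?cmod_gt0 ?subr_gt0 //.
  by rewrite (le_trans _ (cmod_ge_sub _ _)) // cmod_circle // ltW.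
have swap (x y v : R) : x * (y * v) = y * (x * v) by ring.
by rewrite swap -/M divfK ?gt_eqF.
Qed.

End Cauchy.

(** * Geometric expansion of the Cauchy kernel *)

Section Taylor.
Variable R : realType.
Local Notation C := R[i].
Implicit Types (f g h : C -> C) (z w u a b : C) (r t x : R).

Lemma geometric_small (K q : R) : 0 <= q < 1 -> forall e : R, 0 < e ->
  exists m : nat, K * q ^+ m <= e.
Proof.
move=> /andP[q0 q1] e e0.
have q1' : `|q| < 1 by rewrite ger0_norm.
have /cvgrPdist_le/(_ e e0) := cvg_geometric K q1'.
move=> [m _ /(_ m)]; rewrite /= leqnn => /(_ isT).
by rewrite sub0r normrN => H; exists m; apply: le_trans (ler_norm _) H.
Qed.

Lemma geometric_expansion z w m : z != 0 -> z - w != 0 ->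
  z / (z - w) = \sum_(i < m) w ^+ i * (z ^+ i)^-1 + (w / z) ^+ m * (z / (z - w)).
Proof.
move=> z0 zw; elim: m => [|m IH]; first by rewrite big_ord0 expr0 add0r mul1r.
rewrite big_ord_recr /= {1}IH -addrA; congr (_ + _).
by rewrite -exprVn -exprMn exprS -[in RHS]mulrA; field; rewrite z0 zw.
Qed.

Lemma cdiff_geom r w g : cmod w < r -> cdiff r g ->
  cdiff r (fun z => g z * (z / (z - w))).
Proof.
move=> wr dg; apply: cdiffM => //; apply: cdiffM; first exact: cdiff_id.
apply: cdiff_inv => [z zr|]; first exact: sub_neq0 wr zr.
by apply: cdiffD; [exact: cdiff_id|exact: cdiff_cst].
Qed.

Lemma circle_neq0 r z : 0 < r -> cmod z = r -> z != 0.
Proof. by move=> r0 zr; rewrite -cmod_gt0 zr. Qed.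

Lemma cdiff_pow_inv r n : 0 < r -> cdiff r (fun z => (z ^+ n)^-1).
Proof.
move=> r0; apply: cdiff_inv; last by apply: cdiffX; exact: cdiff_id.
by move=> z zr; rewrite expf_neq0 // (circle_neq0 r0).
Qed.

(** Integrates the finite geometric expansion of z / (z - w) with its explicit remainder. With g = 1
    it evaluates the Cauchy kernel, with g = h it gives the Taylor expansion of h. *)
Lemma circ_geom r w g (M : R) m : cmod w < r -> cdiff r g ->
  (forall t, 0 <= t <= 2 * pi -> cmod (g (r%:C * cis t)) <= M) ->
  cmod (circ r (fun z => g z * (z / (z - w)))
    - \sum_(i < m) w ^+ i * circ r (fun z => g z * (z ^+ i)^-1))
  <= 4 * pi * (M * ((cmod w / r) ^+ m * (r / (r - cmod w)))).
Proof.
move=> wr dg HM; have r0 : 0 < r := le_lt_trans (cmod_ge0 w) wr.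
have r0' := ltW r0.
have dterm i : cdiff r (fun z => g z * (z ^+ i)^-1).
  by apply: cdiffM => //; exact: cdiff_pow_inv.
have drem : cdiff r (fun z => g z * (w / z) ^+ m * (z / (z - w))).
  apply: cdiff_geom => //; apply: cdiffM => //; apply: cdiffX; apply: cdiffZ.
  by apply: cdiff_inv; [move=> z; exact: circle_neq0|exact: cdiff_id].
have dsum : cdiff r (fun z => \sum_(i < m) w ^+ i * (g z * (z ^+ i)^-1)).
  move=> z zr; elim: (m) => [|k [a [b W]]].
    by exists 0, 0; apply: eq_wirt (wirt_cst 0 z) => u; rewrite big_ord0.
  have [a' [b' W']] := dterm k z zr.
  eexists; eexists; apply: eq_wirt (wirtD W (wirtZ (w ^+ k) W')) => u.
  by rewrite big_ord_recr.
have -> : circ r (fun z => g z * (z / (z - w))) =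
    \sum_(i < m) w ^+ i * circ r (fun z => g z * (z ^+ i)^-1)
    + circ r (fun z => g z * (w / z) ^+ m * (z / (z - w))).
  transitivity (circ r (fun z => \sum_(i < m) w ^+ i * (g z * (z ^+ i)^-1)
      + g z * (w / z) ^+ m * (z / (z - w)))).
    apply: eq_circ => // z zr.
    rewrite {1}(@geometric_expansion z w m) ?(sub_neq0 wr zr) ?(circle_neq0 r0 zr) //.
    rewrite mulrDr mulrA; congr (_ + _); rewrite mulr_sumr.
    by apply: eq_bigr => i _; rewrite mulrCA.
  rewrite circD // (@circ_sum _ r m (fun i z => w ^+ i * (g z * (z ^+ i)^-1))) //.
    by congr (_ + _); apply: eq_bigr => i _; rewrite circZ.
  by move=> i; exact: cdiffZ.
rewrite addrC addKr; apply: circ_bound => // t t2.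
have zr := cmod_circle t r0'; have {HM} := HM t t2.
move: (r%:C * cis t) zr => z zr HM.
rewrite !cmodM -!mulrA; apply: ler_pM; rewrite ?cmod_ge0 //.
  by rewrite mulr_ge0 ?mulr_ge0 ?cmod_ge0.
rewrite cmodX cmodM !cmodV zr; apply: ler_wpM2l.
  by rewrite exprn_ge0 // divr_ge0 ?cmod_ge0.
have kt : z - w != 0 := sub_neq0 wr zr.
rewrite ler_pM2l // lef_pV2 ?posrE ?cmod_gt0 ?subr_gt0 //.
by rewrite (le_trans _ (cmod_ge_sub _ _)) // zr.
Qed.

(** For n > 0 the function z^-n is a multiple of z times its own derivative, so [circ_derivative]
    applies. *)
Lemma circ_pow_inv r n : 0 < r ->
  circ r (fun z => (z ^+ n)^-1) = if n == 0%N then (2 * pi)%:C else 0.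
Proof.
move=> r0; case: n => [|n] /=.
  rewrite /circ (loop_intE (G := fun t => t%:C)) ?subr0 //.
    by apply: (@cdiff_rcont _ _ (fun z => (z ^+ 0)^-1)); [exact: ltW|exact: cdiff_pow_inv].
  by move=> t _; rewrite expr0 invr1; exact: rderiv_real.
have d1 := @cdiff_pow_inv r n.+1 r0; have d2 := @cdiff_pow_inv r n.+2 r0.
apply: (mulfI (_ : - n.+1%:R != 0 :> C)); first by rewrite oppr_eq0 pnatr_eq0.
rewrite mulr0 -circZ ?(ltW r0) //.
rewrite -(@circ_derivative R r (fun z => (z ^+ n.+1)^-1)
  (fun z => - n.+1%:R * (z ^+ n.+2)^-1)) ?(ltW r0) //.
- apply: eq_circ; first exact: ltW.
  by move=> z /(circle_neq0 r0) z0; rewrite [in RHS]exprS; field; rewrite z0 expf_neq0.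
- move=> z /(circle_neq0 r0) z0.
  have := wirt_comp (wirtX n.+1 (wirt_id z)) (wirt_inv (expf_neq0 n.+1 z0)).
  apply: wirt_eq; rewrite /= ?conj0 ?mulr0 ?mul0r ?addr0 //.
  by rewrite !exprS; field; rewrite z0 expf_neq0.
- exact: cdiffZ.
Qed.

Lemma circ_cauchy_kernel r w : cmod w < r ->
  circ r (fun z => z / (z - w)) = (2 * pi)%:C.
Proof.
move=> wr; have r0 : 0 < r := le_lt_trans (cmod_ge0 w) wr.
apply/eqP; rewrite -subr_eq0; apply/eqP; apply: cmod_lt_small => e e0.
have q1 : 0 <= cmod w / r < 1.
  by rewrite divr_ge0 ?cmod_ge0 ?(ltW r0) //= ltr_pdivrMr // mul1r.
have [m Hm] := geometric_small (4 * pi * (r / (r - cmod w)) * (cmod w / r)) q1 e0.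
have := @circ_geom r w (fun=> 1) 1 m.+1 wr (cdiff_cst 1).
have -> : circ r (fun z => 1 * (z / (z - w))) = circ r (fun z => z / (z - w)).
  by apply: eq_circ => [|z _]; [exact: ltW|rewrite mul1r].
have -> : \sum_(i < m.+1) w ^+ i * circ r (fun z => 1 * (z ^+ i)^-1) = (2 * pi)%:C.
  rewrite big_ord_recl expr0 mul1r big1 => [|i _].
    rewrite addr0 -[RHS](@circ_pow_inv r 0%N r0).
    by apply: eq_circ => [|z _]; [exact: ltW|rewrite mul1r].
  rewrite (_ : circ r _ = 0) ?mulr0 // -[RHS](@circ_pow_inv r (lift ord0 i) r0).
  by apply: eq_circ => [|z _]; [exact: ltW|rewrite mul1r].
move=> H; apply: le_trans (H _) _ => [t _|]; first by rewrite cmod1.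
apply: le_trans Hm; rewrite le_eqVlt; apply/orP; left; apply/eqP.
by rewrite exprS; ring.
Qed.

(** Write h z = (h z - h w) + h w: the first part integrates to 0 by contraction, the second carries
    the integral 2 pi of the kernel. *)
Lemma cauchy_formula h r w : entire h -> cmod w < r ->
  (2 * pi)%:C * h w = circ r (fun z => h z * (z / (z - w))).
Proof.
move=> eh wr; have r0 : 0 < r := le_lt_trans (cmod_ge0 w) wr.
have dh := cdiff_entire (r := r) eh.
have dk : cdiff r (fun z => z / (z - w)).
  by move=> z /(cdiff_geom wr (cdiff_cst 1))[a [b W]]; exists a, b;
    apply: eq_wirt W => u; rewrite mul1r.
have := circ_sub_eq0 eh wr.
have -> : circ r (fun z => (h z - h w) * (z / (z - w))) =
    circ r (fun z => h z * (z / (z - w))) + - h w * circ r (fun z => z / (z - w)).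
  rewrite -circZ ?(ltW r0) // -circD ?(ltW r0) //.
  - by congr circ; apply/funext => z; ring.
  - exact: cdiff_geom.
  - exact: cdiffZ.
by rewrite circ_cauchy_kernel // mulNr => /subr0_eq ->; rewrite mulrC.
Qed.

Lemma eq_wirt_near f g z a b (d : R) : 0 < d ->
  (forall k, cmod k < d -> f (z + k) = g (z + k)) -> wirt f z a b -> wirt g z a b.
Proof.
move=> d0 E W e /W[d' d'0 Hd']; exists (Num.min d d'); first by rewrite lt_min d0.
move=> k; rewrite lt_min => /andP[k1 k2].
have -> : g z = f z by have := E 0; rewrite addr0 cmod0 => ->.
by rewrite -E // Hd'.
Qed.

(** Differentiation under the circle integral: a second-order remainder that is uniform on the
    circle stays of second order after integration. *)
Lemma circ_wirt r g (u u' : C -> C -> C) w (K d : R) : 0 <= r -> 0 < d ->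
  cdiff r g -> (forall v, cmod (v - w) < d -> cdiff r (u^~ v)) -> cdiff r (u'^~ w) ->
  (forall z k, cmod z = r -> cmod k < d ->
     cmod (u z (w + k) - u z w - k * u' z w) <= K * cmod k ^+ 2) ->
  wirt (fun v => circ r (fun z => g z * u z v)) w
    (circ r (fun z => g z * u' z w)) 0.
Proof.
move=> r0 d0 dg du du' H; have [M HM] := cdiff_bounded r0 dg.
apply: (@little_o_quad _ _ (4 * pi * (`|M| * K)) d) => // k kd.
have dw : cdiff r (u^~ w) by apply: du; rewrite subrr cmod0.
have dwk : cdiff r (u^~ (w + k)) by apply: du; rewrite addrC addKr.
have -> : circ r (fun z => g z * u z (w + k)) - circ r (fun z => g z * u z w) -
    (circ r (fun z => g z * u' z w) * k + 0 * cj k) =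
    circ r (fun z => g z * (u z (w + k) - u z w - k * u' z w)).
  transitivity (circ r (fun z => (g z * u z (w + k) + -1 * (g z * u z w)) +
      - k * (g z * u' z w))); last by congr circ; apply/funext => z; ring.
  have d1 := cdiffM dg dwk; have d2 := cdiffM dg dw; have d3 := cdiffM dg du'.
  have E1 : circ r (fun z => -1 * (g z * u z w)) = -1 * circ r (fun z => g z * u z w).
    exact: circZ.
  have E2 : circ r (fun z => - k * (g z * u' z w)) = - k * circ r (fun z => g z * u' z w).
    exact: circZ.
  have d4 := cdiffZ (-1) d2; have d5 := cdiffZ (- k) d3.
  have d6 := cdiffD d1 d4.
  rewrite (circD r0 d6 d5) (circD r0 d1 d4).
  by rewrite E1 E2; ring.
rewrite -mulrA; apply: circ_bound => // [|t t2].
  apply: cdiffM => //; apply: cdiffD.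
    by apply: cdiffD => // z zr; have [a [b W]] := dw z zr; exists (- a), (- b); exact: wirtN.
  have := cdiffZ (- k) du'.
  by congr cdiff; apply/funext => z; rewrite mulNr.
rewrite cmodM -mulrA; apply: ler_pM; rewrite ?cmod_ge0 //.
  by rewrite (le_trans (HM _ t2)) // ler_norm.
by apply: H => //; rewrite cmod_circle.
Qed.

End Taylor.

(** * Derivatives of entire functions and Taylor expansion *)

Section TaylorExpansion.
Variable R : realType.
Local Notation C := R[i].
Implicit Types (f g h : C -> C) (z w u a b : C) (r t x : R).

Lemma inv_sub_expand a k : a != 0 -> a - k != 0 ->
  (a - k)^-1 = a^-1 + k * a^-1 * (a - k)^-1.
Proof. by move=> a0 ak0; field; rewrite a0 ak0. Qed.

Lemma inv_sub_quad1 a k (X : R) : a != 0 -> a - k != 0 ->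
  cmod a^-1 <= X -> cmod (a - k)^-1 <= 2 * X ->
  cmod ((a - k)^-1 ^+ 1 - a^-1 ^+ 1 - k * (1%:R * a^-1 ^+ 2)) <= 2 * X ^+ 3 * cmod k ^+ 2.
Proof.
move=> a0 ak0 Hx Hy; have E := inv_sub_expand a0 ak0.
move: (a^-1) ((a - k)^-1) E Hx Hy => x y E Hx Hy.
have -> : y ^+ 1 - x ^+ 1 - k * (1%:R * x ^+ 2) = k ^+ 2 * (x ^+ 2 * y).
  by rewrite [in LHS]E; rewrite (_ : _ - _ = k * x * (y - x)); [rewrite {1}E|]; ring.
rewrite cmodM cmodX [cmod (_ * y)]cmodM cmodX mulrC ler_wpM2r ?sqr_ge0 //.
rewrite (_ : 2 * X ^+ 3 = X ^+ 2 * (2 * X)); last by ring.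
apply: ler_pM => //; rewrite ?sqr_ge0 ?cmod_ge0 //.
by rewrite lerXn2r ?nnegrE ?cmod_ge0 // (le_trans _ Hx) ?cmod_ge0.
Qed.

Lemma inv_sub_quad2 a k (X : R) : a != 0 -> a - k != 0 ->
  cmod a^-1 <= X -> cmod (a - k)^-1 <= 2 * X ->
  cmod ((a - k)^-1 ^+ 2 - a^-1 ^+ 2 - k * (2%:R * a^-1 ^+ 3)) <= 8 * X ^+ 4 * cmod k ^+ 2.
Proof.
move=> a0 ak0 Hx Hy; have E := inv_sub_expand a0 ak0.
move: (a^-1) ((a - k)^-1) E Hx Hy => x y E Hx Hy.
have -> : y ^+ 2 - x ^+ 2 - k * (2%:R * x ^+ 3) = k ^+ 2 * (x ^+ 2 * y * (2 * x + y)).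
  have D : y - x = k * x * y by rewrite {1}E; ring.
  have -> : y ^+ 2 - x ^+ 2 - k * (2%:R * x ^+ 3) =
    (y - x) * (y + x) - k * x * (2%:R * x ^+ 2) by ring.
  rewrite D (_ : _ - _ = k * x * (x * (y - x) + (y - x) * (y + x))); last by ring.
  by rewrite D; ring.
rewrite cmodM cmodX [cmod (_ * (_ + _))]cmodM [cmod (_ * y)]cmodM cmodX mulrC.
rewrite ler_wpM2r ?sqr_ge0 //.
rewrite (_ : 8 * X ^+ 4 = X ^+ 2 * (2 * X) * (4 * X)); last by ring.
apply: ler_pM; rewrite ?mulr_ge0 ?sqr_ge0 ?cmod_ge0 //.
  apply: ler_pM => //; rewrite ?sqr_ge0 ?cmod_ge0 //.
  by rewrite lerXn2r ?nnegrE ?cmod_ge0 // (le_trans _ Hx) ?cmod_ge0.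
rewrite (le_trans (cmodD _ _)) // cmodM cmod_nat.
have : 2 * cmod x + cmod y <= 2 * X + 2 * X by rewrite lerD // ler_wpM2l.
by move/le_trans; apply; lra.
Qed.

(** The case n = 1 yields an integral formula for the derivative of h, and n = 2 differentiates that
    formula once more. The margin [dl] keeps w + k away from the circle by at least dl / 2. *)
Lemma cauchy_integral_wirt r g (n : nat) w : (n = 1 \/ n = 2)%N -> cmod w < r ->
  cdiff r g -> wirt (fun v => circ r (fun z => g z * (z - v)^-1 ^+ n)) w
    (circ r (fun z => g z * (n%:R * (z - w)^-1 ^+ n.+1))) 0.
Proof.
move=> Hn wr dg; have r0 : 0 <= r := le_trans (cmod_ge0 w) (ltW wr).
set dl := r - cmod w; have dl0 : 0 < dl by rewrite subr_gt0.
have dinv v m : cmod v < r -> cdiff r (fun z => (z - v)^-1 ^+ m).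
  move=> vr; apply: cdiffX; apply: cdiff_inv => [z zr|].
    exact: sub_neq0 vr zr.
  by apply: cdiffD; [exact: cdiff_id|exact: cdiff_cst].
have near v : cmod (v - w) < dl / 2 -> cmod v < r.
  move=> vw; rewrite (_ : v = (v - w) + w); last by ring.
  apply: le_lt_trans (cmodD _ _) _.
  have : dl / 2 < dl by lra.
  by move: vw; rewrite /dl; lra.
have est z k : cmod z = r -> cmod k < dl / 2 -> [/\ z - w != 0, z - w - k != 0,
    cmod (z - w)^-1 <= dl^-1 & cmod (z - w - k)^-1 <= 2 * dl^-1].
  move=> zr kd.
  have H1 : dl <= cmod (z - w) by rewrite (le_trans _ (cmod_ge_sub _ _)) // zr.
  have H2 : dl / 2 <= cmod (z - w - k).
    by rewrite (le_trans _ (cmod_ge_sub _ _)) //; lra.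
  have p1 : 0 < cmod (z - w) := lt_le_trans dl0 H1.
  have dl2 : 0 < dl / 2 by rewrite divr_gt0.
  have p2 : 0 < cmod (z - w - k) := lt_le_trans dl2 H2.
  split; rewrite -?cmod_gt0 // !cmodV ?lef_pV2 ?posrE //.
  by rewrite -[2 * _]invrK invfM invrK mulrC lef_pV2 ?posrE.
have shift z k : z - (w + k) = z - w - k by ring.
have dl2 : 0 < dl / 2 by rewrite divr_gt0.
case: Hn => ->.
  apply: (circ_wirt (u := fun z v => (z - v)^-1 ^+ 1)
    (u' := fun z v => 1%:R * (z - v)^-1 ^+ 2) (K := 2 * dl^-1 ^+ 3) r0 dl2 dg).
  - by move=> v /near vr; exact: dinv.
  - by apply: cdiffZ; exact: dinv.
  by move=> z k zr kd; have [? ? ? ?] := est z k zr kd; rewrite shift; exact: inv_sub_quad1.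
apply: (circ_wirt (u := fun z v => (z - v)^-1 ^+ 2)
    (u' := fun z v => 2%:R * (z - v)^-1 ^+ 3) (K := 8 * dl^-1 ^+ 4) r0 dl2 dg).
- by move=> v /near vr; exact: dinv.
- by apply: cdiffZ; exact: dinv.
by move=> z k zr kd; have [? ? ? ?] := est z k zr kd; rewrite shift; exact: inv_sub_quad2.
Qed.

Lemma twopi_neq0 : (2 * pi)%:C != 0 :> C.
Proof.
by rewrite -cmod_eq0 cmodR normr_eq0 mulf_eq0 pnatr_eq0 /= gt_eqF // pi_gt0.
Qed.

(** Cauchy's formula on one circle around the unit ball at w represents [dz h] on that whole ball,
    so the formula itself may be differentiated at w. *)
Lemma entire_dz h : entire h -> entire (dz h).
Proof.
move=> eh; apply/entire_wirtP => w; pose r := cmod w + 1.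
have wr : cmod w < r by rewrite ltrDl.
pose g z := h z * z.
have dg : cdiff r g by apply: cdiffM; [exact: cdiff_entire|exact: cdiff_id].
have r0 : 0 <= r := le_trans (cmod_ge0 w) (ltW wr).
have near v : cmod (v - w) < 1 -> cmod v < r.
  move=> vw; rewrite (_ : v = (v - w) + w); last by ring.
  by apply: le_lt_trans (cmodD _ _) _; rewrite addrC ltrD2l.
have hE v : cmod v < r ->
    h v = (2 * pi)%:C^-1 * circ r (fun z => g z * (z - v)^-1 ^+ 1).
  move=> vr; apply: (mulfI twopi_neq0); rewrite mulVKf ?twopi_neq0 //.
  by rewrite (cauchy_formula eh vr); apply: eq_circ => // z _; rewrite /g expr1 mulrA.
have dE v : cmod (v - w) < 1 ->
    dz h v = (2 * pi)%:C^-1 * circ r (fun z => g z * (1%:R * (z - v)^-1 ^+ 2)).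
  move=> vw; apply: (@wirt_dz _ _ _ _ ((2 * pi)%:C^-1 * 0)).
  apply: (@eq_wirt_near _
    (fun v => (2 * pi)%:C^-1 * circ r (fun z => g z * (z - v)^-1 ^+ 1)) _ _ _ _
    (1 - cmod (v - w))).
  - by rewrite subr_gt0.
  - move=> k kd; rewrite hE //; apply: near.
    rewrite (_ : v + k - w = (v - w) + k); last by ring.
    by apply: le_lt_trans (cmodD _ _) _; lra.
  - by apply: wirtZ; apply: cauchy_integral_wirt => //; [left|exact: near].
eexists; have W := @cauchy_integral_wirt r g 2 w (or_intror erefl) wr dg.
have := @eq_wirt_near _ _ (dz h) w _ _ 1 ltr01 _ (wirtZ (2 * pi)%:C^-1 W).
rewrite mulr0; apply => k kd.
rewrite dE; last by rewrite addrC addKr.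
by congr (_ * _); apply: eq_circ => // z _; rewrite mul1r.
Qed.

Lemma entire_iter_dz h n : entire h -> entire (iter n (@dz R) h).
Proof.
move=> eh; elim: n => [|n IH]; first exact: eh.
by rewrite iterS; exact: entire_dz IH.
Qed.

Definition taylor_coef h n : C := iter n (@dz R) h 0 / n`!%:R.

(** Integration by parts: the derivative of h z^-(n+1), times z, integrates to 0, which relates the
    coefficient n + 1 of h to the coefficient n of h'. *)
Lemma circ_taylor h r n : entire h -> 0 < r ->
  circ r (fun z => h z * (z ^+ n)^-1) = (2 * pi)%:C * taylor_coef h n.
Proof.
move=> eh r0; elim: n h eh => [|n IH] h eh.
  rewrite /taylor_coef /= fact0 divr1 (@cauchy_formula R h r 0) ?cmod0 //.
  apply: eq_circ => [|z /(circle_neq0 r0) z0]; first exact: ltW.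
  by rewrite subr0 divff // expr0 invr1.
have d1 k := @cdiff_pow_inv R r k r0.
have dh := cdiff_entire (r := r) eh; have dh' := cdiff_entire (r := r) (entire_dz eh).
have n0 : (n.+1%:R : C) != 0 by rewrite pnatr_eq0.
have := @circ_derivative R r (fun z => h z * (z ^+ n.+1)^-1)
  (fun z => dz h z * (z ^+ n.+1)^-1 - n.+1%:R * (h z * (z ^+ n.+2)^-1)) (ltW r0).
have E : circ r (fun z => (dz h z * (z ^+ n.+1)^-1 -
      n.+1%:R * (h z * (z ^+ n.+2)^-1)) * z) =
    circ r (fun z => dz h z * (z ^+ n)^-1) +
    - n.+1%:R * circ r (fun z => h z * (z ^+ n.+1)^-1).
  have e1 := cdiffM dh' (d1 n); have e2 := cdiffM dh (d1 n.+1).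
  have E1 : circ r (fun z => - n.+1%:R * (h z * (z ^+ n.+1)^-1)) =
      - n.+1%:R * circ r (fun z => h z * (z ^+ n.+1)^-1).
    by apply: circZ => //; exact: ltW.
  rewrite -E1 -(circD (ltW r0) e1 (cdiffZ (- n.+1%:R) e2)).
  apply: eq_circ => [|z /(circle_neq0 r0) z0]; first exact: ltW.
  by rewrite !exprS; field; rewrite z0 expf_neq0.
rewrite E IH; last exact: entire_dz.
have -> : taylor_coef (dz h) n = n.+1%:R * taylor_coef h n.+1.
  rewrite /taylor_coef -iterSr factS natrM.
  have f0 : (n`!%:R : C) != 0 by rewrite pnatr_eq0 -lt0n fact_gt0.
  move: (iter n.+1 _ h 0) (n.+1%:R : C) n0 (n`!%:R : C) f0 => x p p0 q q0.
  by field; rewrite p0 q0.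
move=> H; apply: (mulfI n0); apply/eqP; rewrite eq_sym -subr_eq0; apply/eqP.
rewrite (_ : _ - _ = (2 * pi)%:C * (n.+1%:R * taylor_coef h n.+1) +
    - n.+1%:R * circ r (fun z => h z * (z ^+ n.+1)^-1)); last by ring.
apply: H => [z /(circle_neq0 r0) z0|].
  have := wirtM (wirt_entire_dz z eh)
    (wirt_comp (wirtX n.+1 (wirt_id z)) (wirt_inv (expf_neq0 n.+1 z0))).
  apply: wirt_eq; rewrite /= ?conj0 ?mulr0 ?mul0r ?addr0 ?mulr0 //.
    by rewrite !exprS; field; rewrite z0 expf_neq0.
  by rewrite addr0.
apply: cdiffD; first exact: cdiffM.
have := cdiffZ (- n.+1%:R) (cdiffM dh (d1 n.+2)).
by congr cdiff; apply/funext => z; rewrite mulNr.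
Qed.

Lemma taylor_expansion h r : entire h -> 0 < r -> exists K : R, 0 <= K /\
  forall z m, cmod z <= r ->
    cmod (h z - \sum_(i < m) taylor_coef h i * z ^+ i) <= K / 2 ^+ m.
Proof.
(* On the circle of twice the radius the ratio |z| / r2 is at most 1/2 and r2 / (r2 - |z|) at most
   2; hence the rate 2^-m and the constant K. *)
move=> eh r0; pose r2 := 2 * r; have r20 : 0 < r2 by rewrite mulr_gt0.
have dh := cdiff_entire (r := r2) eh.
have [M HM] := cdiff_bounded (ltW r20) dh.
have HM' t : 0 <= t <= 2 * pi -> cmod (h (r2%:C * cis t)) <= `|M|.
  by move=> t2; rewrite (le_trans (HM _ t2)) // ler_norm.
exists (4 * pi * (`|M| * 2) / (2 * pi)); split.
  by rewrite divr_ge0 ?mulr_ge0 ?pi_ge0.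
move=> z m zr; have zr2 : cmod z < r2 by rewrite /r2; lra.
have := @circ_geom R r2 z h `|M| m zr2 dh HM'.
rewrite -cauchy_formula //.
have -> : \sum_(i < m) z ^+ i * circ r2 (fun w => h w * (w ^+ i)^-1) =
    (2 * pi)%:C * \sum_(i < m) taylor_coef h i * z ^+ i.
  rewrite mulr_sumr; apply: eq_bigr => i _; rewrite circ_taylor //; ring.
rewrite -mulrBr cmodM cmodR ger0_norm ?mulr_ge0 ?pi_ge0 // => H.
have pi2 : 0 < 2 * pi :> R by rewrite mulr_gt0 // pi_gt0.
rewrite mulrAC ler_pdivlMr // mulrC; apply: le_trans H _.
rewrite -!mulrA ler_wpM2l // ler_wpM2l ?pi_ge0 // ler_wpM2l // mulrC.
apply: ler_pM; rewrite ?divr_ge0 ?exprn_ge0 ?divr_ge0 ?cmod_ge0 ?subr_ge0 ?(ltW zr2) ?(ltW r20) //.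
- by rewrite mulr_ge0 ?divr_ge0 ?subr_ge0 ?(ltW r0) ?(ltW zr2).
- by rewrite mulrA ler_pdivrMr ?subr_gt0 // /r2; lra.
rewrite -exprVn lerXn2r ?nnegrE ?divr_ge0 ?cmod_ge0 ?(ltW r20) // ?invr_ge0 //.
by rewrite ler_pdivrMr // /r2; lra.
Qed.

End TaylorExpansion.

(** * Polyanalytic functions *)

Section Polyanalytic.
Variable R : realType.
Local Notation C := R[i].
Implicit Types (f g : C -> C) (z w u a b c : C).

Lemma pderivable_rderiv v f z : pderivable v f z ->
  rderiv (fun s : R => f (z + s%:C * v)) 0 (pderive v f z).
Proof.
have E : z + (0 : R)%:C * v = z by rewrite mul0r addr0.
by move=> H; have := @pderive_line R v f z 0; rewrite E; exact.
Qed.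

Lemma rderiv_pderivable v f z l : rderiv (fun s : R => f (z + s%:C * v)) 0 l ->
  pderivable v f z /\ pderive v f z = l.
Proof.
move=> /rderiv_ReIm[H1 H2]; split.
  by split; [exact: (@ex_derive _ _ _ _ _ _ _ H1)|exact: (@ex_derive _ _ _ _ _ _ _ H2)].
by rewrite /pderive !derive1E !derive_val; exact: complex_eq.
Qed.

Lemma continuous_lin a b f g : continuous (f : C^o -> C^o) ->
  continuous (g : C^o -> C^o) ->
  continuous ((fun z => a * f z + b * g z) : C^o -> C^o).
Proof.
move=> /continuous_epsP cf /continuous_epsP cg; apply/continuous_epsP => z e e0.
have K0 : 0 < cmod a + cmod b + 1 by rewrite ltr_wpDl ?addr_ge0 ?cmod_ge0.
have [d d0 Hd] := cf z _ (divr_gt0 e0 K0); have [d' d'0 Hd'] := cg z _ (divr_gt0 e0 K0).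
exists (Num.min d d'); first by rewrite lt_min d0.
move=> k; rewrite lt_min => /andP[k1 k2].
rewrite (_ : _ - _ = a * (f (z + k) - f z) + b * (g (z + k) - g z)); last by ring.
rewrite (le_trans (cmodD _ _)) // !cmodM.
rewrite (le_trans (lerD (ler_wpM2l (cmod_ge0 a) (Hd _ k1))
  (ler_wpM2l (cmod_ge0 b) (Hd' _ k2)))) //.
by rewrite -mulrDl mulrA ler_pdivrMr // mulrC ler_wpM2l ?(ltW e0) // lerDl.
Qed.

Lemma Cn_lin n a b f g : Cn n f -> Cn n g -> Cn n (fun z => a * f z + b * g z).
Proof.
elim: n f g => [|n IH] f g [cf Hf] [cg Hg].
  by split; [exact: continuous_lin|exact: I].
split; first exact: continuous_lin.
case: Hf => f1 fi c1 ci; case: Hg => g1 gi d1 di.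
have P v : (forall z, pderivable v f z) -> (forall z, pderivable v g z) ->
    forall z, pderivable v (fun z => a * f z + b * g z) z /\
      pderive v (fun z => a * f z + b * g z) z = a * pderive v f z + b * pderive v g z.
  move=> Pf Pg z; apply: rderiv_pderivable.
  by apply: rderivD; apply: rderivZ; apply: pderivable_rderiv.
split.
- by move=> z; case: (P _ f1 g1 z).
- by move=> z; case: (P _ fi gi z).
- have -> : pderive 1 (fun z => a * f z + b * g z) =
      fun z => a * pderive 1 f z + b * pderive 1 g z.
    by apply/funext => z; case: (P _ f1 g1 z).
  exact: IH.
- have -> : pderive 'i%C (fun z => a * f z + b * g z) =
      fun z => a * pderive 'i%C f z + b * pderive 'i%C g z.
    by apply/funext => z; case: (P _ fi gi z).
  exact: IH.
Qed.

Lemma Cn_dzbar n f : Cn n.+1 f -> Cn n (dzbar f).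
Proof.
move=> [_ [_ _ c1 ci]].
have -> : dzbar f = fun z => 2^-1 * pderive 1 f z + ('i%C / 2) * pderive 'i%C f z.
  by apply/funext => z; rewrite /dzbar; field.
exact: Cn_lin.
Qed.

Lemma Cn_wirt n f z : Cn n.+1 f -> wirt f z (dz f z) (dzbar f z).
Proof.
move=> [_ [d1 di c1 ci]]; apply: C1_wirt => //.
- by case: n c1 {ci} => [|n] [].
- by case: n ci {c1} => [|n] [].
Qed.

Definition conj_poly (N : nat) f : Prop := exists2 h : nat -> C -> C,
  forall j, entire (h j) & forall z, f z = \sum_(j < N) h j z * cj z ^+ j.

Lemma conj_poly0 N : conj_poly N (fun=> 0).
Proof.
exists (fun _ _ => 0) => [j|z]; first exact: entire_cst.
by rewrite big1 // => i _; rewrite mul0r.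
Qed.

Lemma conj_poly_mono M N f : (M <= N)%N -> conj_poly M f -> conj_poly N f.
Proof.
move=> MN [h eh fE]; exists (fun j => if (j < M)%N then h j else fun=> 0) => [j|z].
  by case: ifP => // _; exact: entire_cst.
rewrite fE (big_ord_widen_cond N xpredT (fun j => h j z * cj z ^+ j)) //.
rewrite big_mkcond; apply: eq_bigr => i _ /=; case: ifP => //; by rewrite mul0r.
Qed.

Lemma conj_polyD N f g : conj_poly N f -> conj_poly N g ->
  conj_poly N (fun z => f z + g z).
Proof.
move=> [h eh fE] [k ek gE]; exists (fun j z => h j z + k j z) => [j|z].
  exact: (entireD (eh j) (ek j)).
by rewrite fE gE -big_split; apply: eq_bigr => i _; rewrite mulrDl.
Qed.

Lemma conj_polyM N f h : conj_poly N f -> entire h -> conj_poly N (fun z => h z * f z).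
Proof.
move=> [k ek fE] eh; exists (fun j z => h z * k j z) => [j|z]; first exact: (entireM eh (ek j)).
by rewrite fE mulr_sumr; apply: eq_bigr => i _; rewrite mulrA.
Qed.

Lemma conj_poly_mulJ N f : conj_poly N f -> conj_poly N.+1 (fun z => cj z * f z).
Proof.
move=> [h eh fE]; exists (fun j => if j is k.+1 then h k else fun=> 0) => [[|j]|z].
- exact: entire_cst.
- exact: eh.
rewrite big_ord_recl /= mul0r add0r fE mulr_sumr; apply: eq_bigr => i _.
by rewrite mulrCA -exprS.
Qed.

Lemma conj_poly_entire N h : entire h -> conj_poly N.+1 h.
Proof.
move=> eh; exists (fun j => if j is _.+1 then fun=> 0 else h) => [[|j]|z].
- exact: eh.
- exact: entire_cst.
rewrite big_ord_recl /= expr0 mulr1 big1 ?addr0 // => i _; by rewrite mul0r.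
Qed.

(** Horner's scheme: split off h_0 and factor out conj z + c, so that no binomial expansion is
    written. *)
Lemma conj_poly_shift N (h : nat -> C -> C) c : (forall j, entire (h j)) ->
  conj_poly N (fun z => \sum_(j < N) h j z * (cj z + c) ^+ j).
Proof.
elim: N h => [|N IH] h eh.
  by have := conj_poly0 0; congr conj_poly; apply/funext => z; rewrite big_ord0.
have H := IH (fun j => h j.+1) (fun j => eh j.+1).
have := conj_polyD (conj_poly_entire N (eh 0%N))
  (conj_polyD (conj_poly_mulJ H) (conj_poly_mono (leqnSn N) (conj_polyM H (entire_cst c)))).
congr conj_poly; apply/funext => z.
rewrite big_ord_recl expr0 mulr1 -mulrDl mulr_sumr; congr (_ + _).
by apply: eq_bigr => i _ /=; rewrite exprS mulrCA.
Qed.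

Lemma wirt_conj_poly N (h : nat -> C -> C) z : (forall j, entire (h j)) ->
  wirt (fun z => \sum_(j < N) h j z * cj z ^+ j) z
    (\sum_(j < N) dz (h j) z * cj z ^+ j)
    (\sum_(j < N.-1) (j.+1%:R * h j.+1 z) * cj z ^+ j).
Proof.
move=> eh.
have := @wirt_sum R _ (index_enum 'I_N) xpredT (fun j u => h j u * cj u ^+ j)
  (fun j u => dz (h j) u * cj u ^+ j) (fun j u => h j u * (j%:R * cj u ^+ j.-1)) z.
move=> H; apply: wirt_eq (H _) => // [|j].
  case: N {H} => [|N]; first by rewrite !big_ord0.
  rewrite big_ord_recl mul0r mulr0 add0r; apply: eq_bigr => i _.
  by rewrite lift0 /=; ring.
apply: wirt_eq (wirtM (wirt_entire_dz z (eh j)) (wirtX j (wirt_conj z))).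
- by rewrite mulr0 mulr0 addr0.
- by rewrite mul0r add0r mulr1.
Qed.

Lemma conj_poly_dz N f : conj_poly N f -> exists fz fzb : C -> C,
  [/\ forall z, wirt f z (fz z) (fzb z), conj_poly N fz & conj_poly N.-1 fzb].
Proof.
move=> [h eh fE].
exists (fun z => \sum_(j < N) dz (h j) z * cj z ^+ j).
exists (fun z => \sum_(j < N.-1) (j.+1%:R * h j.+1 z) * cj z ^+ j).
split=> [z||].
- by apply: (eq_wirt _ (wirt_conj_poly N z eh)) => u; rewrite fE.
- exists (fun j => dz (h j)); last by move=> z; reflexivity.
  by move=> j; exact: (entire_dz (eh j)).
- exists (fun j z => j.+1%:R * h j.+1 z); last by move=> z; reflexivity.
  by move=> j; exact: (entireM (entire_cst _) (eh _)).
Qed.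

(** For fixed N the class is stable under both partial derivatives, which is what [Cn_class] asks
    for. *)
Lemma conj_poly_Cn N n f : conj_poly N f -> Cn n f.
Proof.
move=> Hf; apply: (@Cn_class R (conj_poly N)) => // g /conj_poly_dz.
move=> [gz [gzb [W Hz Hzb]]]; exists gz, gzb; split=> //.
  by apply: conj_polyD => //; exact: conj_poly_mono (leq_pred N) Hzb.
have := conj_polyM (conj_polyD Hz (conj_polyM
  (conj_poly_mono (leq_pred N) Hzb) (entire_cst (-1)))) (entire_cst 'i%C).
by congr conj_poly; apply/funext => z; rewrite mulN1r.
Qed.

Lemma conj_poly_polyanalytic N f : conj_poly N f -> polyanalytic N f.
Proof.
move=> Hf; split; first exact: conj_poly_Cn Hf.
elim: N f Hf => [|N IH] f Hf z.
  by case: Hf => h _ fE; rewrite /= fE big_ord0.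
rewrite iterSr; apply: IH.
have [fz [fzb [W _ Hzb]]] := conj_poly_dz Hf.
rewrite (_ : dzbar f = fzb) //; apply/funext => u; exact: wirt_dzbar (W u).
Qed.

(** Integrate g termwise in conj z to a polynomial p; then f - p has conjugate derivative 0, hence
    is entire, and joins the coefficient of degree 0. *)
Lemma conj_poly_of_dzbar N f (fz g : C -> C) : (forall z, wirt f z (fz z) (g z)) ->
  conj_poly N g -> conj_poly N.+1 f.
Proof.
move=> Wf [h eh hE].
pose k (j : nat) (u : C) := if j is i.+1 then (i.+1%:R)^-1 * h i u else 0.
have ek j : entire (k j).
  by case: j => [|j]; [exact: entire_cst|exact: (entireM (entire_cst _) (eh _))].
pose p z := \sum_(j < N.+1) k j z * cj z ^+ j.
have eg : entire (fun z => f z - p z).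
  apply/entire_wirtP => z; eexists.
  have := wirtB (Wf z) (wirt_conj_poly N.+1 z ek).
  rewrite hE (_ : \sum_(j < N) h j z * cj z ^+ j =
    \sum_(j < N.+1.-1) (j.+1%:R * k j.+1 z) * cj z ^+ j) ?subrr //; first exact.
  by apply: eq_bigr => i _ /=; rewrite mulrA divff ?mul1r // pnatr_eq0.
have Hp : conj_poly N.+1 p by exists k => //.
have := conj_polyD (conj_poly_entire N eg) Hp.
by congr conj_poly; apply/funext => z; rewrite subrK.
Qed.

Lemma polyanalytic_conj_poly N f : polyanalytic N f -> conj_poly N f.
Proof.
elim: N f => [|N IH] f [cf f0].
  by exists (fun _ _ => 0) => [j|z]; [exact: entire_cst|rewrite big_ord0; exact: f0].
apply: (conj_poly_of_dzbar (fun z => Cn_wirt z cf)); apply: IH.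
by split=> [|z]; [exact: Cn_dzbar|have := f0 z; rewrite iterSr].
Qed.

End Polyanalytic.

(** * Integration over the plane *)

Section PlaneMeasure.
Variable R : realType.
Local Notation C := R[i].
Local Notation M := (measurableTypeR R).
Local Notation leb := (@lebesgue_measure R).
Local Notation pl := (@plane_measure R).

Lemma lebesgue_translation (a : R) (A : set M) : measurable A ->
  leb ((fun x : M => x + a : M) @^-1` A) = leb A.
Proof.
have mf : measurable_fun setT (fun x : M => x + a : M) by exact: measurable_funD.
move=> mA; rewrite -[LHS]/(pushforward leb (fun x : M => x + a : M) A).
apply/esym/lebesgue_measure_unique => //= _ [[u v]] _ <- /=.
transitivity (leb `]u - a, v - a]%classic); last first.
  rewrite /pushforward; congr (leb _); apply/seteqP.
  by split=> x /=; rewrite !in_itv /= ltrBlDr lerBrDr.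
rewrite !lebesgue_measure_itv /= !lte_fin ltrD2r; case: ifP => // _.
by rewrite -!EFinB; congr EFin; ring.
Qed.

Definition measure_preserving (phi : M * M -> M * M) : Prop :=
  measurable_fun setT phi /\
  forall A : set (M * M), measurable A -> pl (phi @^-1` A) = pl A.

Lemma measure_preserving_comp phi psi :
  measure_preserving phi -> measure_preserving psi ->
  measure_preserving (phi \o psi).
Proof.
move=> [mphi Hphi] [mpsi Hpsi]; split; first exact: measurableT_comp.
move=> A mA; rewrite comp_preimage Hpsi ?Hphi //.
by rewrite -[X in measurable X]setTI; apply: mphi.
Qed.

(** Slicing in the other order gives access to horizontal sections, as the shear along the first
    coordinate requires. *)
Lemma plane_measure2E (A : set (M * M)) : measurable A -> pl A = (leb \x^ leb)%E A.
Proof.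
move=> mA; apply: product_measure_unique => // X Y mX mY.
exact: product_measure2E.
Qed.

(** On each vertical section the shear is a translation, so one-dimensional translation invariance
    suffices. *)
Lemma shear_snd_preserving (u : M -> M) : measurable_fun setT u ->
  measure_preserving (fun p => (p.1, p.2 + u p.1)).
Proof.
move=> mu.
have mphi : measurable_fun setT (fun p : M * M => (p.1, p.2 + u p.1 : M)).
  apply/measurable_fun_pairP; split => /=; first exact: measurable_fst.
  apply: measurable_funD; first exact: measurable_snd.
  exact: measurableT_comp mu measurable_fst.
split=> // A mA; rewrite /plane_measure /product_measure1.
apply: eq_integral => x _ /=.
rewrite -[RHS](@lebesgue_translation (u x)); last exact: measurable_xsection.
by congr (leb _); apply/seteqP; split=> y; rewrite /xsection /= !inE.
Qed.

Lemma shear_fst_preserving (u : M -> M) : measurable_fun setT u ->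
  measure_preserving (fun p => (p.1 + u p.2, p.2)).
Proof.
move=> mu.
have mphi : measurable_fun setT (fun p : M * M => (p.1 + u p.2 : M, p.2)).
  apply/measurable_fun_pairP; split => /=; last exact: measurable_snd.
  apply: measurable_funD; first exact: measurable_fst.
  exact: measurableT_comp mu measurable_snd.
split=> // A mA; rewrite !plane_measure2E //; last first.
  by rewrite -[X in measurable X]setTI; apply: mphi.
rewrite /product_measure2; apply: eq_integral => y _ /=.
rewrite -[RHS](@lebesgue_translation (u y)); last exact: measurable_ysection.
by congr (leb _); apply/seteqP; split=> x; rewrite /ysection /= !inE.
Qed.

Lemma translation_preserving (a b : R) :
  measure_preserving (fun p => (p.1 + a, p.2 + b)).
Proof.
have := measure_preserving_comp
  (@shear_fst_preserving (fun=> a) (measurable_cst _))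
  (@shear_snd_preserving (fun=> b) (measurable_cst _)).
by [].
Qed.

(* A rotation by an angle t with cos (t / 2) <> 0 is a product of three shears. *)
Lemma rotation_preserving (t : R) : cos (t / 2) != 0 ->
  measure_preserving (fun p =>
    (cos t * p.1 - sin t * p.2, sin t * p.1 + cos t * p.2)).
Proof.
move=> c0; set k := tan (t / 2).
have mlin (a : R) : measurable_fun setT (fun x : M => a * x : M).
  exact: measurable_funM.
have := measure_preserving_comp (shear_fst_preserving (mlin (- k)))
  (measure_preserving_comp (shear_snd_preserving (mlin (sin t)))
    (shear_fst_preserving (mlin (- k)))).
(* The shears have slopes -k, sin t, -k with k = tan (t/2); they compose to the rotation by 1 - k
   sin t = cos t and k + k cos t = sin t. *)
congr measure_preserving; apply/funext => -[x y] /=.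
have cE : cos t = cos (t / 2) ^+ 2 - sin (t / 2) ^+ 2.
  by rewrite {1}[t]splitr cosD !expr2.
have sE : sin t = 2 * sin (t / 2) * cos (t / 2).
  by rewrite {1}[t]splitr sinD; ring.
have cs := cos2Dsin2 (t / 2).
have kE : k * cos (t / 2) = sin (t / 2) by rewrite /k /tan divfK.
have s2 : sin (t / 2) ^+ 2 = 1 - cos (t / 2) ^+ 2 by lra.
have e1 : 1 - k * sin t = cos t.
  rewrite sE cE (_ : k * (2 * _ * _) = 2 * sin (t / 2) * (k * cos (t / 2))); last by ring.
  rewrite kE (_ : 2 * _ * _ = 2 * sin (t / 2) ^+ 2); last by ring.
  by rewrite s2; ring.
have e2 : k + k * cos t = sin t.
  rewrite sE cE s2.
  rewrite (_ : _ + _ = 2 * cos (t / 2) * (k * cos (t / 2))); last by ring.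
  by rewrite kE; ring.
congr (_, _); last by rewrite -e1; ring.
by rewrite -[in RHS]e2 -e1; ring.
Qed.

End PlaneMeasure.

(** * Integration of complex functions over the plane *)

Section ComplexIntegrals.
Variable R : realType.
Local Notation C := R[i].
Local Notation M := (measurableTypeR R).
Local Notation pl := (@plane_measure R).
Implicit Types (F G : C -> C) (z w a : C).

Definition cmeasurable F : Prop :=
  measurable_fun setT (fun p : M * M => complex.Re (F (p.1 +i* p.2))) /\
  measurable_fun setT (fun p : M * M => complex.Im (F (p.1 +i* p.2))).

Lemma cmeasurable_cst a : cmeasurable (fun=> a).
Proof. by split; exact: measurable_cst. Qed.

Lemma cmeasurable_id : cmeasurable id.
Proof. by split; [exact: measurable_fst|exact: measurable_snd]. Qed.

Lemma cmeasurableD F G : cmeasurable F -> cmeasurable G ->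
  cmeasurable (fun z => F z + G z).
Proof.
move=> [f1 f2] [g1 g2]; split.
- rewrite (_ : (fun p => _) = (fun p : M * M => complex.Re (F (p.1 +i* p.2))
     + complex.Re (G (p.1 +i* p.2)))); first exact: measurable_funD.
  by apply/funext => p; rewrite Re_D.
- rewrite (_ : (fun p => _) = (fun p : M * M => complex.Im (F (p.1 +i* p.2))
     + complex.Im (G (p.1 +i* p.2)))); first exact: measurable_funD.
  by apply/funext => p; rewrite Im_D.
Qed.

Lemma cmeasurableM F G : cmeasurable F -> cmeasurable G ->
  cmeasurable (fun z => F z * G z).
Proof.
move=> [f1 f2] [g1 g2]; split.
- rewrite (_ : (fun p => _) = (fun p : M * M =>
     complex.Re (F (p.1 +i* p.2)) * complex.Re (G (p.1 +i* p.2))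
     - complex.Im (F (p.1 +i* p.2)) * complex.Im (G (p.1 +i* p.2)))).
    by apply: measurable_funB; exact: measurable_funM.
  by apply/funext => p; rewrite Re_M.
- rewrite (_ : (fun p => _) = (fun p : M * M =>
     complex.Re (F (p.1 +i* p.2)) * complex.Im (G (p.1 +i* p.2))
     + complex.Im (F (p.1 +i* p.2)) * complex.Re (G (p.1 +i* p.2)))).
    by apply: measurable_funD; exact: measurable_funM.
  by apply/funext => p; rewrite Im_M.
Qed.

Lemma cmeasurableJ F : cmeasurable F -> cmeasurable (fun z => cj (F z)).
Proof.
move=> [f1 f2]; split.
- rewrite (_ : (fun p => _) = (fun p : M * M => complex.Re (F (p.1 +i* p.2)))) //.
  by apply/funext => p; case: (F _).
- rewrite (_ : (fun p => _) = (fun p : M * M => - complex.Im (F (p.1 +i* p.2)))).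
    exact: measurable_funN.
  by apply/funext => p; case: (F _).
Qed.

Lemma cmeasurableX F n : cmeasurable F -> cmeasurable (fun z => F z ^+ n).
Proof.
move=> mF; elim: n => [|n IH]; first exact: cmeasurable_cst.
by have := cmeasurableM mF IH; congr cmeasurable; apply/funext => z; rewrite exprS.
Qed.

Lemma cmeasurable_sum n (F : nat -> C -> C) : (forall i, cmeasurable (F i)) ->
  cmeasurable (fun z => \sum_(i < n) F i z).
Proof.
move=> mF; elim: n => [|n IH].
  by have := cmeasurable_cst 0; congr cmeasurable; apply/funext => z; rewrite big_ord0.
have := cmeasurableD IH (mF n).
by congr cmeasurable; apply/funext => z; rewrite big_ord_recr.
Qed.

Lemma cmeasurable_lim (F : nat -> C -> C) G : (forall n, cmeasurable (F n)) ->
  (forall z (e : R), 0 < e -> exists n0, forall n, (n0 <= n)%N ->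
     cmod (F n z - G z) <= e) -> cmeasurable G.
Proof.
move=> mF H; split.
- apply: (@measurable_fun_cvg _ _ _ _
    (fun n (p : M * M) => complex.Re (F n (p.1 +i* p.2)))).
    by move=> n; have [] := mF n.
  move=> p _; apply/cvgrPdist_le => e e0; have [n0 Hn0] := H (p.1 +i* p.2) e e0.
  exists n0 => // n /= /Hn0; apply: le_trans; rewrite distrC.
  by apply: le_trans (normr_Re_le _); rewrite !ReImE.
- apply: (@measurable_fun_cvg _ _ _ _
    (fun n (p : M * M) => complex.Im (F n (p.1 +i* p.2)))).
    by move=> n; have [] := mF n.
  move=> p _; apply/cvgrPdist_le => e e0; have [n0 Hn0] := H (p.1 +i* p.2) e e0.
  exists n0 => // n /= /Hn0; apply: le_trans; rewrite distrC.
  by apply: le_trans (normr_Im_le _); rewrite !ReImE.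
Qed.

(** A pointwise limit of Taylor polynomials. *)
Lemma cmeasurable_entire F : entire F -> cmeasurable F.
Proof.
move=> eF.
apply: (@cmeasurable_lim (fun n z => \sum_(i < n) taylor_coef F i * z ^+ i)).
  move=> n; apply: (@cmeasurable_sum n (fun i z => taylor_coef F i * z ^+ i)) => i.
  apply: cmeasurableM; first exact: cmeasurable_cst.
  by apply: cmeasurableX; exact: cmeasurable_id.
move=> z e e0; have z1 : 0 < cmod z + 1 by rewrite ltr_wpDl ?cmod_ge0.
have [K [K0 HK]] := taylor_expansion eF z1.
have h1 : 0 <= (2^-1 : R) < 1 by rewrite invr_ge0 ler0n invf_lt1 ?ltr1n.
have [n0 Hn0] := geometric_small K h1 e0.
exists n0 => n n0n; rewrite cmod_dist (le_trans (HK z n _)) ?lerDl //.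
apply: le_trans Hn0; rewrite ler_wpM2l // -exprVn.
by rewrite ler_wiXn2l ?invr_ge0 // invf_le1 // ler1n.
Qed.

Lemma cmeasurable_conj_poly N F : conj_poly N F -> cmeasurable F.
Proof.
move=> [h eh FE].
have := @cmeasurable_sum N (fun j z => h j z * cj z ^+ j).
move=> H; have {}H := H _; rewrite (_ : F = fun z => \sum_(j < N) h j z * cj z ^+ j).
  apply: H => j; apply: cmeasurableM; first exact: cmeasurable_entire.
  by apply: cmeasurableX; apply: cmeasurableJ; exact: cmeasurable_id.
exact/funext.
Qed.

Lemma measurable_cmod F : cmeasurable F ->
  measurable_fun setT (fun p : M * M => cmod (F (p.1 +i* p.2))).
Proof.
move=> [f1 f2]; apply: measurableT_comp; last first.
  by apply: measurable_funD; exact: measurable_funX.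
by apply: continuous_measurable_fun; exact: sqrt_continuous.
Qed.

Lemma cintegrable_le F (G : M * M -> R) : cmeasurable F ->
  pl.-integrable setT (EFin \o G) ->
  (forall p, cmod (F (p.1 +i* p.2)) <= G p) -> cintegrable F.
Proof.
move=> [f1 f2] iG FG; split.
- apply: (le_integrable _ _ _ iG) => //; first exact/measurable_EFinP.
  move=> p _; rewrite lee_fin [`|G p|]ger0_norm ?(le_trans (cmod_ge0 _) (FG p)) //.
  exact: le_trans (normr_Re_le _) (FG p).
- apply: (le_integrable _ _ _ iG) => //; first exact/measurable_EFinP.
  move=> p _; rewrite lee_fin [`|G p|]ger0_norm ?(le_trans (cmod_ge0 _) (FG p)) //.
  exact: le_trans (normr_Im_le _) (FG p).
Qed.

Lemma cintegrable_measurable F : cintegrable F -> cmeasurable F.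
Proof.
by move=> [/integrableP[/measurable_EFinP f1 _] /integrableP[/measurable_EFinP f2 _]].
Qed.

Lemma cintegrable_cmod F : cintegrable F ->
  pl.-integrable setT (fun p => (cmod (F (p.1 +i* p.2)))%:E).
Proof.
move=> iF; have mF := cintegrable_measurable iF; case: iF => i1 i2.
have := integrableD measurableT (integrable_abse i1) (integrable_abse i2).
move=> iS; apply: (le_integrable _ _ _ iS) => //.
  by apply/measurable_EFinP; exact: measurable_cmod.
move=> p _ /=; rewrite lee_fin ger0_norm ?cmod_ge0 // ger0_norm ?addr_ge0 //.
exact: cmod_le.
Qed.

Lemma cintegrableD F G : cintegrable F -> cintegrable G ->
  cintegrable (fun z => F z + G z).
Proof.
move=> [f1 f2] [g1 g2]; split.
- have := integrableD measurableT f1 g1.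
  by congr (integrable _ _ _); apply/funext => p /=; rewrite Re_D.
- have := integrableD measurableT f2 g2.
  by congr (integrable _ _ _); apply/funext => p /=; rewrite Im_D.
Qed.

Lemma cintegralD F G : cintegrable F -> cintegrable G ->
  cintegral (fun z => F z + G z) = cintegral F + cintegral G.
Proof.
move=> [f1 f2] [g1 g2]; rewrite /cintegral; apply: complex_eq; rewrite !ReImE /=.
- by rewrite -RintegralD //; congr Rintegral; apply/funext => p; rewrite Re_D.
- by rewrite -RintegralD //; congr Rintegral; apply/funext => p; rewrite Im_D.
Qed.

Lemma cintegrableZ a F : cintegrable F -> cintegrable (fun z => a * F z).
Proof.
move=> iF; have mF := cintegrable_measurable iF; have i1 := cintegrable_cmod iF.
apply: (@cintegrable_le _ (fun p => cmod a * cmod (F (p.1 +i* p.2)))).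
- by apply: cmeasurableM => //; exact: cmeasurable_cst.
- have := integrableZl measurableT (cmod a) i1.
  by congr (integrable _ _ _); apply/funext => p /=; rewrite EFinM.
- by move=> p; rewrite cmodM.
Qed.

Lemma cintegralZ a F : cintegrable F ->
  cintegral (fun z => a * F z) = a * cintegral F.
Proof.
move=> [f1 f2]; rewrite /cintegral; case: a => u v.
have j1 k := integrableZl measurableT k f1; have j2 k := integrableZl measurableT k f2.
apply: complex_eq; rewrite !ReImE /=.
- rewrite -!RintegralZl // -RintegralB //; last 2 first.
  + by have := j1 u; congr (integrable _ _ _); apply/funext => p /=; rewrite EFinM.
  + by have := j2 v; congr (integrable _ _ _); apply/funext => p /=; rewrite EFinM.
  by congr Rintegral; apply/funext => p; rewrite Re_M.
- rewrite -!RintegralZl // -RintegralD //; last 2 first.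
  + by have := j2 u; congr (integrable _ _ _); apply/funext => p /=; rewrite EFinM.
  + by have := j1 v; congr (integrable _ _ _); apply/funext => p /=; rewrite EFinM.
  by congr Rintegral; apply/funext => p; rewrite Im_M.
Qed.

Lemma cintegralJ F : cintegrable F ->
  cintegral (fun z => cj (F z)) = cj (cintegral F).
Proof.
move=> [f1 f2]; rewrite /cintegral; apply: complex_eq => /=.
- by congr Rintegral; apply/funext => p; case: (F _).
- rewrite -mulN1r -RintegralZl //; congr Rintegral; apply/funext => p.
  by case: (F _) => ? ?; rewrite mulN1r.
Qed.

Lemma cintegral_sum n (F : nat -> C -> C) : (forall i, cintegrable (F i)) ->
  cintegrable (fun z => \sum_(i < n) F i z) /\
  cintegral (fun z => \sum_(i < n) F i z) = \sum_(i < n) cintegral (F i).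
Proof.
move=> iF; elim: n => [|n [I1 I2]].
  have E0 : (fun z => \sum_(i < 0) F i z) = fun z => 0 * F 0%N z.
    by apply/funext => z; rewrite big_ord0 mul0r.
  rewrite E0 big_ord0; split; first exact: cintegrableZ.
  by rewrite cintegralZ // mul0r.
have E : (fun z => \sum_(i < n.+1) F i z) = fun z => \sum_(i < n) F i z + F n z.
  by apply/funext => z; rewrite big_ord_recr.
by rewrite E big_ord_recr /= cintegralD // I2; split=> //; exact: cintegrableD.
Qed.

(** Real and imaginary part are estimated separately, hence the factor 2. *)
Lemma cmod_cintegral_le F (G : M * M -> R) : cmeasurable F ->
  pl.-integrable setT (EFin \o G) ->
  (forall p, cmod (F (p.1 +i* p.2)) <= G p) ->
  cmod (cintegral F) <= 2 * Rintegral pl setT G.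
Proof.
move=> mF iG FG; have [i1 i2] := cintegrable_le mF iG FG.
rewrite (le_trans (cmod_le _)) //= mulr2n mulrDl mul1r; apply: lerD.
- rewrite (le_trans (le_normr_Rintegral measurableT i1)) //.
  apply: le_Rintegral => //; first exact: integrable_norm.
  by move=> p _; exact: le_trans (normr_Re_le _) (FG p).
- rewrite (le_trans (le_normr_Rintegral measurableT i2)) //.
  apply: le_Rintegral => //; first exact: integrable_norm.
  by move=> p _; exact: le_trans (normr_Im_le _) (FG p).
Qed.

Lemma preserving_ge0_integral phi (f : M * M -> \bar R) : measure_preserving phi ->
  measurable_fun setT f -> (forall p, (0 <= f p)%E) ->
  (\int[pl]_p f (phi p) = \int[pl]_p f p)%E.
Proof.
move=> [mphi Hphi] mf f0.
have := @ge0_integral_pushforward _ _ _ _ _ phi mphi pl setT f measurableT mf (fun p _ => f0 p).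
rewrite preimage_setT => <-.
by apply: eq_measure_integral => A mA _; rewrite -[RHS]Hphi.
Qed.

Lemma preserving_integrable phi (f : M * M -> \bar R) : measure_preserving phi ->
  pl.-integrable setT f -> pl.-integrable setT (f \o phi) /\
  (\int[pl]_p f (phi p) = \int[pl]_p f p)%E.
Proof.
move=> Hp intf; have [mf lf] := integrableP _ _ _ intf; have [mphi Hphi] := Hp.
have ifp : pl.-integrable setT (f \o phi).
  apply/integrableP; split; first exact: measurableT_comp.
  rewrite (@preserving_ge0_integral phi (fun p => `|f p|)%E Hp) //.
  exact: measurableT_comp.
split=> //; have := @integral_pushforward _ _ _ _ _ phi mphi pl setT f mf.
rewrite preimage_setT => /(_ ifp measurableT) <-.
by apply: eq_measure_integral => A mA _; rewrite -[RHS]Hphi.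
Qed.

Lemma preserving_cintegrable (phi : C -> C) F :
  measure_preserving (fun p => (complex.Re (phi (p.1 +i* p.2)),
    complex.Im (phi (p.1 +i* p.2)))) ->
  cintegrable F -> cintegrable (fun z => F (phi z)) /\
  cintegral (fun z => F (phi z)) = cintegral F.
Proof.
move=> Hp [f1 f2]; have [j1 k1] := preserving_integrable Hp f1.
have [j2 k2] := preserving_integrable Hp f2.
have E z : F (complex.Re z +i* complex.Im z) = F z by case: z.
split; first split.
- by move: j1; congr (integrable _ _ _); apply/funext => p /=; rewrite E.
- by move: j2; congr (integrable _ _ _); apply/funext => p /=; rewrite E.
rewrite /cintegral /Rintegral -k1 -k2 /=; apply: complex_eq => /=;
  by congr fine; apply: eq_integral => p _; rewrite E.
Qed.

Lemma cintegral_translation F w : cintegrable F ->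
  cintegrable (fun z => F (z + w)) /\ cintegral (fun z => F (z + w)) = cintegral F.
Proof.
apply: preserving_cintegrable; have := translation_preserving (complex.Re w) (complex.Im w).
by congr measure_preserving; apply/funext => p; rewrite !ReImE.
Qed.

Lemma cintegral_rotation F t : cos (t / 2) != 0 -> cintegrable F ->
  cintegrable (fun z => F (cis t * z)) /\
  cintegral (fun z => F (cis t * z)) = cintegral F.
Proof.
move=> c0; apply: preserving_cintegrable; have := rotation_preserving c0.
by congr measure_preserving; apply/funext => p; rewrite cisE !ReImE /= [sin t * _ + _]addrC.
Qed.

End ComplexIntegrals.

(** * Gaussian integrals and exponential majorants *)

Section Gaussian.
Variable R : realType.
Local Notation C := R[i].
Local Notation M := (measurableTypeR R).
Local Notation pl := (@plane_measure R).
Local Notation leb := (@lebesgue_measure R).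
Implicit Types (F G : C -> C) (z w a : C).

(** Up to its peak value, the integrand is the normal density of variance 1 / (2 c), whose integral
    is 1. *)
Lemma integral_gauss1 (c : R) : 0 < c ->
  (\int[leb]_x (expR (- c * x ^+ 2))%:E = (Num.sqrt (pi / c))%:E)%E.
Proof.
move=> c0; pose s := Num.sqrt ((2 * c)^-1).
have s2 : s ^+ 2 = (2 * c)^-1 by rewrite sqr_sqrtr // invr_ge0 mulr_ge0 // ltW.
have s0 : s != 0 by rewrite gt_eqF // sqrtr_gt0 invr_gt0 mulr_gt0.
have := @integral_normal_pdf R 0 s; rewrite normal_pdfE // => H.
have I := @integrable_normal_pdf R 0 s; rewrite normal_pdfE // in I.
have p0 := normal_peak_gt0 s0.
transitivity (\int[leb]_x ((normal_peak s)^-1%:E * (normal_peak s * normal_fun 0 s x)%:E))%E.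
  apply: eq_integral => x _; rewrite -EFinM mulKf ?gt_eqF //; congr EFin.
  rewrite /normal_fun subr0 s2; congr expR.
  by field; rewrite gt_eqF.
rewrite integralZl // H mule1 /normal_peak invrK; congr EFin; congr Num.sqrt.
by rewrite s2; field; rewrite gt_eqF.
Qed.

Lemma measurable_norm2 : measurable_fun setT (fun p : M * M => p.1 ^+ 2 + p.2 ^+ 2 : R).
Proof.
apply: measurable_funD; apply: measurable_funX; first exact: measurable_fst.
exact: measurable_snd.
Qed.

Lemma integral_gauss2 (c : R) : 0 < c ->
  (\int[pl]_p (expR (- c * (p.1 ^+ 2 + p.2 ^+ 2)))%:E = (pi / c)%:E)%E.
Proof.
move=> c0; have pc : 0 <= pi / c by rewrite divr_ge0 ?pi_ge0 // ltW.
have mf : measurable_fun setT (fun p : M * M => (expR (- c * (p.1 ^+ 2 + p.2 ^+ 2)))%:E).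
  apply/measurable_EFinP; apply: measurableT_comp => //.
  by apply: measurable_funM => //; exact: measurable_norm2.
rewrite /plane_measure fubini_tonelli1 //.
have mg : measurable_fun setT (fun x : M => (expR (- c * x ^+ 2))%:E).
  apply/measurable_EFinP; apply: measurableT_comp => //.
  by apply: measurable_funM => //; exact: measurable_funX.
transitivity (\int[leb]_x ((expR (- c * x ^+ 2))%:E * (Num.sqrt (pi / c))%:E))%E.
  apply: eq_integral => x _; rewrite /fubini_F -(integral_gauss1 c0) /=.
  rewrite -ge0_integralZl //.
  by apply: eq_integral => y _; rewrite -EFinM -expRD mulrDr.
rewrite ge0_integralZr //.
by rewrite integral_gauss1 // -EFinM -expr2 sqr_sqrtr.
Qed.

Definition pt (p : M * M) : C := p.1 +i* p.2.

Lemma cmod_pt p : cmod (pt p) ^+ 2 = p.1 ^+ 2 + p.2 ^+ 2.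
Proof. by rewrite cmod_sqr. Qed.

Lemma measurable_cmod_pt : measurable_fun setT (fun p : M * M => cmod (pt p)).
Proof. exact: measurable_cmod (cmeasurable_id R). Qed.

(** Completing the square gives t r - c r^2 <= t^2 / (2 c) - (c/2) r^2, so half of the Gaussian
    absorbs the exponential. *)
Lemma integrable_gauss (c t : R) : 0 < c ->
  pl.-integrable setT (fun p => (expR (t * cmod (pt p) - c * cmod (pt p) ^+ 2))%:E).
Proof.
move=> c0; have c2 : 0 < c / 2 by rewrite divr_gt0.
have I : pl.-integrable setT (fun p => (expR (- (c / 2) * (p.1 ^+ 2 + p.2 ^+ 2)))%:E).
  apply/integrableP; split.
    apply/measurable_EFinP; apply: measurableT_comp => //.
    by apply: measurable_funM => //; exact: measurable_norm2.
  under eq_integral do rewrite /= ger0_norm ?expR_ge0 //.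
  by rewrite /= integral_gauss2 // ltry.
have := integrableZl measurableT (expR (t ^+ 2 / (2 * c))) I.
apply: le_integrable => //.
  apply/measurable_EFinP; apply: measurableT_comp => //.
  apply: measurable_funB; first by apply: measurable_funM => //; exact: measurable_cmod_pt.
  apply: measurable_funM => //; apply: measurable_funX; exact: measurable_cmod_pt.
move=> p _; rewrite /= lee_fin -expRD !ger0_norm ?expR_ge0 // ler_expR -cmod_pt.
rewrite -subr_ge0; set r := cmod _.
have -> : t ^+ 2 / (2 * c) + - (c / 2) * r ^+ 2 - (t * r - c * r ^+ 2) =
  (c * r - t) ^+ 2 / (2 * c) by field; rewrite gt_eqF.
by rewrite divr_ge0 ?sqr_ge0 // mulr_ge0 // ltW.
Qed.

(** Raise x / n <= e^(x/n) to the n-th power. *)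
Lemma pow_le_expR (n : nat) (x : R) : 0 <= x -> x ^+ n <= n%:R ^+ n * expR x.
Proof.
case: n => [|n] x0; first by rewrite !expr0 mul1r (le_trans _ (expR_ge1Dx x)) // lerDl.
have n0 : 0 < n.+1%:R :> R by rewrite ltr0n.
rewrite -{2}[x](divfK (lt0r_neq0 n0)) expRM_natr -exprMn lerXn2r ?nnegrE //.
by rewrite mulrC -ler_pdivrMr // (le_trans _ (expR_ge1Dx _)) // lerDr.
Qed.

End Gaussian.

(** * Differentiation under the integral sign *)

Section DominatedFamilies.
Variable R : realType.
Local Notation C := R[i].
Local Notation M := (measurableTypeR R).
Local Notation pl := (@plane_measure R).
Implicit Types (f g F : C -> C) (z w a b k : C) (u v : C -> C -> C).

Lemma rderiv_affine a b (s : R) : rderiv (fun s : R => a + s%:C * b) s b.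
Proof.
move=> e e0; exists 1 => // h _; rewrite rmorphD /= (_ : _ - _ = 0); last by ring.
by rewrite cmod0 mulr_ge0 // ltW.
Qed.

Lemma wirt_increment f (fa fb : C -> C) w0 k (B t : R) : 0 <= t <= 1 -> cmod k <= 1 ->
  (forall w, cmod (w - w0) <= 1 -> [/\ wirt f w (fa w) (fb w), cmod (fa w) <= B
     & cmod (fb w) <= B]) ->
  cmod (f (w0 + t%:C * k) - f w0) <= 4 * B * cmod k.
Proof.
move=> /andP[t0 t1] k1 H.
have B0 : 0 <= B.
  by have [|_ + _] := H w0; [rewrite subrr cmod0|apply: le_trans; exact: cmod_ge0].
have small (s : R) : 0 <= s <= t -> cmod (w0 + s%:C * k - w0) <= 1.
  move=> /andP[s0 st]; rewrite addrC addKr cmodM cmodR ger0_norm //.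
  by rewrite mulr_ile1 ?cmod_ge0 // (le_trans st).
have := @mvt_cmod R (fun s => f (w0 + s%:C * k))
  (fun s => fa (w0 + s%:C * k) * k + fb (w0 + s%:C * k) * cj k) 0 t (2 * B * cmod k) t0.
rewrite mul0r addr0 subr0 => X; apply: le_trans (X _) _.
  move=> s st; have [W Ba Bb] := H _ (small s st).
  split; first exact: (wirt_curve (g := fun s : R => w0 + s%:C * k) W (rderiv_affine w0 k s)).
  rewrite (le_trans (cmodD _ _)) // !cmodM cmodJ mulr2n !mulrDl mul1r.
  by rewrite lerD // ler_wpM2r ?cmod_ge0.
rewrite (_ : 2 * (2 * B * cmod k) * t = 4 * B * cmod k * t); last by ring.
by rewrite ler_piMr // !mulr_ge0 ?cmod_ge0.
Qed.

(** Along the segment, minus its linear part, the derivative is an increment of fa and fb, at most 2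
    * 4 B |k|^2 by [wirt_increment]; one more mean value step doubles 8 to 16. *)
Lemma wirt_quadratic f (fa fb faa fab fba fbb : C -> C) w0 k (B : R) : cmod k <= 1 ->
  (forall w, cmod (w - w0) <= 1 ->
     [/\ wirt f w (fa w) (fb w), wirt fa w (faa w) (fab w), wirt fb w (fba w) (fbb w),
       cmod (faa w) <= B /\ cmod (fab w) <= B & cmod (fba w) <= B /\ cmod (fbb w) <= B]) ->
  cmod (f (w0 + k) - f w0 - (fa w0 * k + fb w0 * cj k)) <= 16 * B * cmod k ^+ 2.
Proof.
move=> k1 H.
pose phi (s : R) := f (w0 + s%:C * k) - s%:C * (fa w0 * k + fb w0 * cj k).
have := @mvt_cmod R phi (fun s => (fa (w0 + s%:C * k) * k + fb (w0 + s%:C * k) * cj k)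
  - (fa w0 * k + fb w0 * cj k)) 0 1 (8 * B * cmod k ^+ 2) ler01.
rewrite /phi !mul0r !mul1r addr0 !subr0 mulr1.
rewrite (_ : f (w0 + k) - (fa w0 * k + fb w0 * cj k) - f w0 =
  f (w0 + k) - f w0 - (fa w0 * k + fb w0 * cj k)); last by ring.
move=> X; apply: le_trans (X _) _; last by rewrite le_eqVlt; apply/orP; left; apply/eqP; ring.
move=> s s01; have small : cmod (w0 + s%:C * k - w0) <= 1.
  case/andP: s01 => s0 s1; rewrite addrC addKr cmodM cmodR ger0_norm //.
  by rewrite mulr_ile1 ?cmod_ge0.
have [W _ _ _ _] := H _ small; split.
  apply: rderivB.
    exact: (wirt_curve (g := fun s : R => w0 + s%:C * k) W (rderiv_affine w0 k s)).
  move: (fa w0 * k + fb w0 * cj k) => q.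
  have -> : (fun r : R => r%:C * q) = (fun r : R => 0 + r%:C * q).
    by apply/funext => r; rewrite add0r.
  exact: rderiv_affine.
rewrite (_ : _ - _ = (fa (w0 + s%:C * k) - fa w0) * k + (fb (w0 + s%:C * k) - fb w0) * cj k);
  last by ring.
have Ia : cmod (fa (w0 + s%:C * k) - fa w0) <= 4 * B * cmod k.
  by apply: (wirt_increment s01 k1 (fa := faa) (fb := fab)) => w /H[? ? ? [? ?] [? ?]].
have Ib : cmod (fb (w0 + s%:C * k) - fb w0) <= 4 * B * cmod k.
  by apply: (wirt_increment s01 k1 (fa := fba) (fb := fbb)) => w /H[? ? ? [? ?] [? ?]].
rewrite (le_trans (cmodD _ _)) // !cmodM cmodJ.
rewrite (le_trans (lerD (ler_wpM2r (cmod_ge0 k) Ia) (ler_wpM2r (cmod_ge0 k) Ib))) //.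
by rewrite le_eqVlt; apply/orP; left; apply/eqP; ring.
Qed.

(** One integrable majorant serves a whole unit ball of parameters, the range in which
    [wirt_quadratic] compares w0 and w0 + k. *)
Definition dominated u : Prop := (forall w, cmeasurable (u^~ w)) /\
  forall w0, exists2 B : M * M -> R, pl.-integrable setT (EFin \o B) &
    forall w, cmod (w - w0) <= 1 -> forall p, cmod (u (pt p) w) <= B p.

Lemma dominatedD u v : dominated u -> dominated v ->
  dominated (fun z w => u z w + v z w).
Proof.
move=> [mu Hu] [mv Hv]; split=> [w|w0]; first exact: cmeasurableD.
have [B iB HB] := Hu w0; have [B' iB' HB'] := Hv w0.
exists (fun p => B p + B' p).
  have := integrableD measurableT iB iB'.
  by congr (integrable _ _ _); apply/funext => p /=; rewrite EFinD.
by move=> w ww p; rewrite (le_trans (cmodD _ _)) // lerD ?HB ?HB'.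
Qed.

Lemma dominatedZ a u : dominated u -> dominated (fun z w => a * u z w).
Proof.
move=> [mu Hu]; split=> [w|w0].
  by apply: cmeasurableM => //; exact: cmeasurable_cst.
have [B iB HB] := Hu w0; exists (fun p => cmod a * B p).
  have := integrableZl measurableT (cmod a) iB.
  by congr (integrable _ _ _); apply/funext => p /=; rewrite EFinM.
by move=> w ww p; rewrite cmodM ler_wpM2l ?cmod_ge0 // HB.
Qed.

Lemma dominated_cintegrable u w : dominated u -> cintegrable (u^~ w).
Proof.
move=> [mu Hu]; have [B iB HB] := Hu w; apply: (cintegrable_le (mu w) iB) => p.
by apply: HB; rewrite subrr cmod0.
Qed.

(** Majorants of the four second derivatives bound the second-order remainder pointwise by an
    integrable function times |k|^2, and integration preserves the square. *)
Lemma dominated_wirt u ua ub uaa uab uba ubb w0 :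
  (forall z w, wirt (u z) w (ua z w) (ub z w)) ->
  (forall z w, wirt (ua z) w (uaa z w) (uab z w)) ->
  (forall z w, wirt (ub z) w (uba z w) (ubb z w)) ->
  dominated u -> dominated ua -> dominated ub ->
  dominated uaa -> dominated uab -> dominated uba -> dominated ubb ->
  wirt (fun w => cintegral (u^~ w)) w0 (cintegral (ua^~ w0)) (cintegral (ub^~ w0)).
Proof.
move=> W Wa Wb du da db [_ /(_ w0)[B1 i1 H1]] [_ /(_ w0)[B2 i2 H2]]
  [_ /(_ w0)[B3 i3 H3]] [_ /(_ w0)[B4 i4 H4]].
pose B p := B1 p + B2 p + (B3 p + B4 p).
have iB : pl.-integrable setT (EFin \o B).
  have := integrableD measurableT (integrableD measurableT i1 i2)
    (integrableD measurableT i3 i4).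
  by congr (integrable _ _ _); apply/funext => p /=; rewrite !EFinD.
apply: (@little_o_quad _ _ (2 * Rintegral pl setT (fun p => 16 * B p)) 1) => // k kd.
have k1 := ltW kd.
have iu w := dominated_cintegrable w du.
have ia := dominated_cintegrable w0 da; have ib := dominated_cintegrable w0 db.
pose D z := (u z (w0 + k) + -1 * u z w0) + (- k * ua z w0 + - cj k * ub z w0).
have DE : cintegral D = cintegral (u^~ (w0 + k)) - cintegral (u^~ w0) -
    (cintegral (ua^~ w0) * k + cintegral (ub^~ w0) * cj k).
  have j1 := cintegrableZ (-1) (iu w0); have j2 := cintegrableZ (- k) ia.
  have j3 := cintegrableZ (- cj k) ib.
  rewrite /D (cintegralD (cintegrableD (iu (w0 + k)) j1) (cintegrableD j2 j3)).
  rewrite (cintegralD (iu (w0 + k)) j1) (cintegralD j2 j3).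
  rewrite (cintegralZ (-1) (iu w0)) (cintegralZ (- k) ia) (cintegralZ (- cj k) ib).
  by ring.
rewrite -DE.
have iB' : pl.-integrable setT (EFin \o (fun p => 16 * B p * cmod k ^+ 2)).
  have := integrableZl measurableT (16 * cmod k ^+ 2) iB.
  congr (integrable _ _ _); apply/funext => p /=; rewrite -EFinM; congr EFin; ring.
have mD : cmeasurable D.
  apply: cintegrable_measurable; apply: cintegrableD.
    by apply: cintegrableD; [exact: iu|apply: cintegrableZ; exact: iu].
  by apply: cintegrableD; apply: cintegrableZ.
have bD p : cmod (D (p.1 +i* p.2)) <= 16 * B p * cmod k ^+ 2.
  have := @wirt_quadratic (u (pt p)) (ua (pt p)) (ub (pt p)) (uaa (pt p)) (uab (pt p))
    (uba (pt p)) (ubb (pt p)) w0 k (B p) k1.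
  move=> X; rewrite -/(pt p) (_ : D (pt p) = u (pt p) (w0 + k) - u (pt p) w0
    - (ua (pt p) w0 * k + ub (pt p) w0 * cj k)); last by rewrite /D; ring.
  apply: X => w ww.
  have b1 := H1 w ww p; have b2 := H2 w ww p; have b3 := H3 w ww p; have b4 := H4 w ww p.
  have c1 := le_trans (cmod_ge0 _) b1; have c2 := le_trans (cmod_ge0 _) b2.
  have c3 := le_trans (cmod_ge0 _) b3; have c4 := le_trans (cmod_ge0 _) b4.
  split; [exact: W|exact: Wa|exact: Wb| |];
    split; rewrite /B; apply: le_trans; [exact: b1| |exact: b2| |exact: b3| |exact: b4|]; lra.
apply: le_trans (cmod_cintegral_le mD iB' bD) _.
have iB16 : pl.-integrable setT (EFin \o (fun p => 16 * B p)).
  have := integrableZl measurableT 16 iB.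
  by congr (integrable _ _ _); apply/funext => p /=; rewrite -EFinM.
by rewrite RintegralZr // mulrA.
Qed.

End DominatedFamilies.

(** * Fock-type integrals and Gaussian moments *)

Section FockIntegrals.
Variable R : realType.
Local Notation C := R[i].
Local Notation M := (measurableTypeR R).
Local Notation pl := (@plane_measure R).
Implicit Types (f g F : C -> C) (z w : C) (a b c : nat).

(** Decay beyond every e^(-t|z|) is what makes [fock_kernel] integrable for all w, since its last
    factor grows like e^(|w||z|/2). *)
Definition rapid F : Prop := cmeasurable F /\ forall t : R,
  pl.-integrable setT (fun p => (cmod (F (pt p)) * expR (t * cmod (pt p)))%:E).

(** Powers of w - z and conj(w - z) come from Laguerre polynomials in |z - w|^2, the exponential
    from the reproducing kernel; the power of conj z is produced by differentiating that exponential
    in w. *)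
Definition fock_kernel F a b c z w : C :=
  F z * ((w - z) ^+ a * cj (w - z) ^+ b * cj z ^+ c * cexp (w * (cj z / 2))).

Lemma cmod_expRe w z : cmod (cexp (w * (cj z / 2))) <= expR (cmod w / 2 * cmod z).
Proof.
rewrite cmod_cexp ler_expR (le_trans (ler_norm _)) // (le_trans (normr_Re_le _)) //.
by rewrite !cmodM cmodJ cmodV cmod_nat mulrA mulrAC.
Qed.

Lemma cmeasurable_cexp F : cmeasurable F -> cmeasurable (fun z => cexp (F z)).
Proof.
move=> [m1 m2]; split.
- apply: measurable_funM; first exact: measurableT_comp.
  by apply: measurableT_comp => //; apply: continuous_measurable_fun; exact: continuous_cos.
- apply: measurable_funM; first exact: measurableT_comp.
  by apply: measurableT_comp => //; apply: continuous_measurable_fun; exact: continuous_sin.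
Qed.

(** With r = |w0| + 1, every polynomial factor is at most r + |z|, and (r + |z|)^n <= n^n e^(r +
    |z|); the majorant is thus [rapid] at t = 1 + r/2. *)
Lemma dominated_fock F a b c : rapid F -> dominated (fock_kernel F a b c).
Proof.
move=> [mF rF]; split=> [w|w0].
  apply: cmeasurableM => //; have mid := cmeasurable_id R.
  have mw : cmeasurable (fun z => w - z).
    have := cmeasurableD (cmeasurable_cst w) (cmeasurableM (cmeasurable_cst (-1)) mid).
    by congr cmeasurable; apply/funext => z; rewrite mulN1r.
  apply: cmeasurableM.
    apply: cmeasurableM; last by apply: cmeasurableX; exact: cmeasurableJ.
    apply: cmeasurableM; first exact: cmeasurableX.
    by apply: cmeasurableX; exact: cmeasurableJ.
  apply: cmeasurable_cexp; apply: cmeasurableM; first exact: cmeasurable_cst.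
  by apply: cmeasurableM; [exact: cmeasurableJ|exact: cmeasurable_cst].
have [r rE] : exists r : R, r = cmod w0 + 1 by eexists.
pose n := (a + b + c)%N.
have r0 : 0 <= r by rewrite rE addr_ge0 ?cmod_ge0.
exists (fun p => (n%:R ^+ n * expR r) * (cmod (F (pt p)) * expR ((1 + r / 2) * cmod (pt p)))).
  have := integrableZl measurableT (n%:R ^+ n * expR r) (rF (1 + r / 2)).
  by congr (integrable _ _ _); apply/funext => p /=; rewrite -EFinM.
move=> w ww p; rewrite /fock_kernel cmodM [X in _ <= X]mulrCA ler_wpM2l ?cmod_ge0 //.
move: (pt p) => z; have z0 := cmod_ge0 z.
have wr : cmod w <= r.
  rewrite (_ : w = w0 + (w - w0)); last by ring.
  by rewrite rE (le_trans (cmodD _ _)) // lerD2l.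
have rz : 0 <= r + cmod z by rewrite addr_ge0.
have wz : cmod (w - z) <= r + cmod z by rewrite (le_trans (cmodB _ _)) // lerD2r.
have zz : cmod z <= r + cmod z by rewrite lerDr.
have P k x : cmod x <= r + cmod z -> cmod (x ^+ k) <= (r + cmod z) ^+ k.
  by move=> H; rewrite cmodX lerXn2r ?nnegrE ?cmod_ge0.
rewrite !cmodM; apply: (@le_trans _ _ ((r + cmod z) ^+ n * expR (r / 2 * cmod z))).
  apply: ler_pM; rewrite ?mulr_ge0 ?cmod_ge0 //.
    rewrite /n !exprD; apply: ler_pM; rewrite ?mulr_ge0 ?cmod_ge0 //; last by rewrite P ?cmodJ.
    by apply: ler_pM; rewrite ?mulr_ge0 ?cmod_ge0 ?P ?cmodJ.
  by rewrite (le_trans (cmod_expRe _ _)) // ler_expR !ler_wpM2r ?invr_ge0.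
rewrite mulrDl mul1r expRD; apply: (@le_trans _ _ (n%:R ^+ n * expR (r + cmod z) * expR (r / 2 * cmod z))).
  by rewrite ler_wpM2r ?expR_ge0 ?pow_le_expR.
by rewrite expRD !mulrA.
Qed.

Lemma wirt_fock F a b c z w : wirt (fock_kernel F a b c z) w
  (a%:R * fock_kernel F a.-1 b c z w + 2^-1 * fock_kernel F a b c.+1 z w)
  (b%:R * fock_kernel F a b.-1 c z w).
Proof.
have W1 := wirtB (wirt_id w) (wirt_cst z w).
have W2 := wirt_comp W1 (wirt_conj (w - z)).
have W3 := wirt_comp (wirtM (wirt_id w) (wirt_cst (cj z / 2) w)) (wirt_cexp (w * (cj z / 2))).
have := wirtZ (F z) (wirtM (wirtM (wirtM (wirtX a W1) (wirtX b W2)) (wirt_cst (cj z ^+ c) w)) W3).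
by apply: wirt_eq; rewrite /fock_kernel !conjE ?exprS; field.
Qed.

Definition fock_int F a b c w : C := cintegral (fun z => fock_kernel F a b c z w).

Lemma fock_cintegrable F a b c w : rapid F -> cintegrable (fun z => fock_kernel F a b c z w).
Proof. by move=> rF; apply: (dominated_cintegrable w (dominated_fock a b c rF)). Qed.

Let dK F a b c z w : C :=
  a%:R * fock_kernel F a.-1 b c z w + 2^-1 * fock_kernel F a b c.+1 z w.
Let bK F a b c z w : C := b%:R * fock_kernel F a b.-1 c z w.

Let dominated_dK F a b c : rapid F -> dominated (dK F a b c).
Proof. by move=> rF; apply: dominatedD; apply: dominatedZ; exact: dominated_fock. Qed.

Let dominated_bK F a b c : rapid F -> dominated (bK F a b c).
Proof. by move=> rF; apply: dominatedZ; exact: dominated_fock. Qed.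

Lemma wirt_fock_int F a b c w : rapid F -> wirt (fock_int F a b c) w
  (a%:R * fock_int F a.-1 b c w + 2^-1 * fock_int F a b c.+1 w)
  (b%:R * fock_int F a b.-1 c w).
Proof.
move=> rF.
have := @dominated_wirt R (fock_kernel F a b c) (dK F a b c) (bK F a b c)
  (fun z w => a%:R * dK F a.-1 b c z w + 2^-1 * dK F a b c.+1 z w)
  (fun z w => a%:R * bK F a.-1 b c z w + 2^-1 * bK F a b c.+1 z w)
  (fun z w => b%:R * dK F a b.-1 c z w) (fun z w => b%:R * bK F a b.-1 c z w) w
  (fun z w => wirt_fock F a b c z w)
  (fun z w => wirtD (wirtZ a%:R (wirt_fock F a.-1 b c z w))
     (wirtZ 2^-1 (wirt_fock F a b c.+1 z w)))
  (fun z w => wirtZ b%:R (wirt_fock F a b.-1 c z w))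
  (dominated_fock a b c rF) (dominated_dK a b c rF) (dominated_bK a b c rF)
  (dominatedD (dominatedZ a%:R (dominated_dK a.-1 b c rF))
     (dominatedZ 2^-1 (dominated_dK a b c.+1 rF)))
  (dominatedD (dominatedZ a%:R (dominated_bK a.-1 b c rF))
     (dominatedZ 2^-1 (dominated_bK a b c.+1 rF)))
  (dominatedZ b%:R (dominated_dK a b.-1 c rF)) (dominatedZ b%:R (dominated_bK a b.-1 c rF)).
have i1 := fock_cintegrable a.-1 b c w rF; have i2 := fock_cintegrable a b c.+1 w rF.
have i3 := fock_cintegrable a b.-1 c w rF.
have -> : cintegral ((dK F a b c)^~ w) =
    a%:R * fock_int F a.-1 b c w + 2^-1 * fock_int F a b c.+1 w.
  rewrite /dK (cintegralD (cintegrableZ a%:R i1) (cintegrableZ 2^-1 i2)).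
  by rewrite (cintegralZ a%:R i1) (cintegralZ 2^-1 i2).
have -> : cintegral ((bK F a b c)^~ w) = b%:R * fock_int F a b.-1 c w.
  by rewrite /bK (cintegralZ b%:R i3).
by [].
Qed.

Definition gauss z : C := cexp (- (z * cj z / 2)).

Lemma gaussE z : gauss z = (expR (- (cmod z ^+ 2 / 2)))%:C.
Proof.
rewrite /gauss mulcJ -cexpR; move: (cmod z ^+ 2) => x; congr cexp.
rewrite (rmorphN (real_complex R)) (rmorphM (real_complex R)).
by rewrite (fmorphV (real_complex R)) (rmorph_nat (real_complex R)).
Qed.

Lemma gaussJ z : cj (gauss z) = gauss z.
Proof. by rewrite gaussE conjR. Qed.

Lemma cmod_gauss z : cmod (gauss z) = expR (- (cmod z ^+ 2 / 2)).
Proof. by rewrite gaussE cmodR ger0_norm ?expR_ge0. Qed.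

Lemma cmeasurable_gauss : cmeasurable gauss.
Proof.
apply: cmeasurable_cexp; have mid := cmeasurable_id R.
have := cmeasurableM (cmeasurable_cst (- 2^-1)) (cmeasurableM mid (cmeasurableJ mid)).
by congr cmeasurable; apply/funext => z; ring.
Qed.

Lemma rapid_gauss_poly a b : rapid (fun z => gauss z * (z ^+ a * cj z ^+ b)).
Proof.
have mid := cmeasurable_id R; split=> [|t].
  apply: cmeasurableM; first exact: cmeasurable_gauss.
  by apply: cmeasurableM; apply: cmeasurableX; [exact: mid|exact: cmeasurableJ].
have h2 : 0 < (1 / 2 : R) by rewrite divr_gt0.
pose n := (a + b)%N.
have := integrableZl measurableT (n%:R ^+ n) (integrable_gauss (1 + t) h2).
apply: le_integrable => //.
  apply/measurable_EFinP; apply: measurable_funM.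
    apply: (@measurable_cmod R (fun z => gauss z * (z ^+ a * cj z ^+ b))).
    apply: cmeasurableM; first exact: cmeasurable_gauss.
    by apply: cmeasurableM; apply: cmeasurableX; [exact: mid|exact: cmeasurableJ].
  apply: measurableT_comp => //; apply: measurable_funM => //; exact: measurable_cmod_pt.
move=> p _; move: (pt p) => z; rewrite /= lee_fin.
rewrite !ger0_norm ?mulr_ge0 ?exprn_ge0 ?cmod_ge0 ?expR_ge0 //.
rewrite cmodM cmod_gauss cmodM !cmodX cmodJ -exprD -/n.
rewrite (_ : (1 + t) * cmod z - 1 / 2 * cmod z ^+ 2 =
  - (cmod z ^+ 2 / 2) + t * cmod z + cmod z); last by field.
rewrite expRD expRD -!mulrA [X in _ <= X]mulrCA ler_wpM2l ?expR_ge0 //.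
rewrite [X in _ <= X]mulrCA [X in X <= _]mulrC ler_wpM2l ?expR_ge0 //.
by rewrite pow_le_expR ?cmod_ge0.
Qed.

Lemma cmod_signM n z : cmod ((-1) ^+ n * z) = cmod z.
Proof. by rewrite cmodM cmodX cmodN cmod1 expr1n mul1r. Qed.

(* The translate by w of this integrand is antiholomorphic in w. *)
Lemma gauss_fock_int a b w : fock_int gauss a b 0 w =
  cj (fock_int (fun z => (-1) ^+ (a + b) * (gauss z * (z ^+ b * cj z ^+ a))) 0 0 0 (- w)).
Proof.
have rg : rapid gauss.
  have := rapid_gauss_poly 0 0; congr rapid; apply/funext => z.
  by rewrite !expr0 !mulr1.
have i0 := fock_cintegrable a b 0 w rg.
have [i1 e1] := cintegral_translation w i0.
rewrite /fock_int -e1.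
have -> : (fun z => fock_kernel gauss a b 0 (z + w) w) = (fun z => cj (fock_kernel
    (fun z => (-1) ^+ (a + b) * (gauss z * (z ^+ b * cj z ^+ a))) 0 0 0 z (- w))).
  apply/funext => z; rewrite /fock_kernel !conjE gaussJ !expr0 !mul1r.
  rewrite (_ : w - (z + w) = - z); last by ring.
  rewrite (_ : cj w - (cj z + cj w) = - cj z); last by ring.
  rewrite [(- z) ^+ a]exprNn [(- cj z) ^+ b]exprNn exprD cexpJ !conjE.
  rewrite (_ : gauss (z + w) * ((-1) ^+ a * z ^+ a * ((-1) ^+ b * cj z ^+ b) * 1 *
      cexp (w * ((cj z + cj w) / 2))) =
    (-1) ^+ a * (-1) ^+ b * (cj z ^+ b * z ^+ a) *
      (gauss (z + w) * cexp (w * ((cj z + cj w) / 2)))); last by ring.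
  (* The exponents add up to -z (conj z + conj w) / 2: w itself drops out and only conj w is
     left. *)
  rewrite (_ : gauss (z + w) * cexp (w * ((cj z + cj w) / 2)) =
      gauss z * cexp (- cj w * (z / 2))); last first.
    by rewrite /gauss -!cexpD; congr cexp; rewrite !conjE; field.
  by ring.
apply: cintegralJ; apply: fock_cintegrable.
have [mg rg'] := rapid_gauss_poly b a.
split; first by apply: cmeasurableM => //; exact: cmeasurable_cst.
move=> t; have := rg' t; congr (integrable _ _ _); apply/funext => p.
by rewrite cmod_signM.
Qed.

Definition gauss_moment (j : nat) : C := cintegral (fun z => gauss z * (z ^+ j * cj z ^+ j)).

(** The function [fock_int gauss j.+1 j 0] is antiholomorphic in w, so its d/dw at 0 vanishes; the
    derivative rule evaluates the same quantity as (j + 1) m_j - m_(j+1) / 2. *)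
Lemma gauss_momentS j : gauss_moment j.+1 = 2 * j.+1%:R * gauss_moment j.
Proof.
have rg : rapid gauss.
  have := rapid_gauss_poly 0 0; congr rapid; apply/funext => z.
  by rewrite !expr0 !mulr1.
pose F' z := (-1) ^+ (j.+1 + j) * (gauss z * (z ^+ j * cj z ^+ j.+1)).
have rF' : rapid F'.
  have [mg rg'] := rapid_gauss_poly j j.+1.
  split; first by apply: cmeasurableM => //; exact: cmeasurable_cst.
  move=> t; have := rg' t; congr (integrable _ _ _); apply/funext => p.
  by rewrite cmod_signM.
have W1 := wirt_fock_int j.+1 j 0 0 rg.
have W2 := wirt_comp (wirt_comp (wirtN (wirt_id 0)) (wirt_fock_int 0 0 0 (- 0) rF'))
  (wirt_conj _).
have E : fock_int gauss j.+1 j 0 = fun w => cj (fock_int F' 0 0 0 (- w)).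
  by apply/funext => w; rewrite gauss_fock_int.
(* The inner integral has b = 0 and is holomorphic; the outer conjugation exchanges the
   coefficients, which makes d/dw zero. *)
have [b2 W2'] : exists b2 : C, wirt (fun w => cj (fock_int F' 0 0 0 (- w))) 0 0 b2.
  eexists; apply: wirt_eq W2; last by reflexivity.
  by rewrite !conjE mulr0n; ring.
have := wirt_dz W1; rewrite E (wirt_dz W2').
have -> : fock_int gauss j.+1.-1 j 0 0 = gauss_moment j.
  congr cintegral; apply/funext => z; rewrite /fock_kernel !sub0r mul0r cexp0 expr0 !mulr1.
  by rewrite !conjE [(- z) ^+ _]exprNn [(- cj z) ^+ _]exprNn mulrACA -exprMn mulN1r opprK expr1n mul1r.
have -> : fock_int gauss j.+1 j 1 0 = - gauss_moment j.+1.
  rewrite -mulN1r -cintegralZ; last first.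
    have := fock_cintegrable 0 0 0 0 (rapid_gauss_poly j.+1 j.+1).
    by congr cintegrable; apply/funext => z; rewrite /fock_kernel !expr0 mul0r cexp0 !mulr1.
  congr cintegral; apply/funext => z; rewrite /fock_kernel !sub0r mul0r cexp0 expr1 !mulr1.
  rewrite !conjE [(- z) ^+ _]exprNn [(- cj z) ^+ _]exprNn [(-1) ^+ j.+1]exprS.
  have s1 : ((-1) ^+ j * (-1) ^+ j : C) = 1 by rewrite -exprMn mulN1r opprK expr1n.
  rewrite (_ : gauss z * _ = - ((-1) ^+ j * (-1) ^+ j) * (gauss z * (z ^+ j.+1 *
    (cj z ^+ j * cj z)))); last by ring.
  by rewrite s1 [cj z ^+ j.+1]exprSr.
move=> H; have : 2 * (j.+1%:R * gauss_moment j + 2^-1 * - gauss_moment j.+1) = 0.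
  by rewrite -H mulr0.
rewrite mulrDr !mulrA mulfV ?pnatr_eq0 // mul1r => /eqP; rewrite subr_eq0 => /eqP <-.
by [].
Qed.

Lemma gauss_moment0 : gauss_moment 0 = (2 * pi)%:C.
Proof.
have E : (fun z => gauss z * (z ^+ 0 * cj z ^+ 0)) = fun z => (expR (- (cmod z ^+ 2 / 2)))%:C.
  by apply/funext => z; rewrite !expr0 !mulr1 gaussE.
rewrite /gauss_moment E /cintegral /=; apply: complex_eq => /=; last first.
  by rewrite /Rintegral integral0.
rewrite /Rintegral; have h2 : 0 < (1 / 2 : R) by rewrite divr_gt0.
transitivity (fine ((pi : R) / (1 / 2))%:E); last by rewrite /= div1r invrK mulrC.
rewrite -(integral_gauss2 h2); congr fine; apply: eq_integral => p _.
by rewrite cmod_pt; congr EFin; congr expR; field.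
Qed.

Lemma gauss_momentE j : gauss_moment j = (2 * pi)%:C * (2 ^+ j * j`!%:R).
Proof.
elim: j => [|j IH]; first by rewrite gauss_moment0 fact0 expr0 !mulr1.
by rewrite gauss_momentS IH exprS factS natrM; ring.
Qed.

End FockIntegrals.

(** * Integrals against radial weights *)

Section RadialIntegrals.
Variable R : realType.
Local Notation C := R[i].
Local Notation M := (measurableTypeR R).
Local Notation pl := (@plane_measure R).
Implicit Types (F G : C -> C) (z w : C) (r t : R).

Definition ccvg (u : nat -> C) (l : C) : Prop := forall e : R, 0 < e ->
  exists n0, forall n, (n0 <= n)%N -> cmod (u n - l) <= e.

Lemma ccvg_unique u l l' : ccvg u l -> ccvg u l' -> l = l'.
Proof.
move=> H H'; apply/eqP; rewrite -subr_eq0; apply/eqP/cmod_lt_small => e e0.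
have e2 : 0 < e / 2 by rewrite divr_gt0.
have [n Hn] := H _ e2; have [n' Hn'] := H' _ e2.
have := lerD (Hn _ (leq_maxl n n')) (Hn' _ (leq_maxr n n')).
rewrite -splitr cmod_dist; apply: le_trans; rewrite (le_trans _ (cmodD _ _)) //.
by rewrite (_ : _ + _ = l - l') //; ring.
Qed.

Lemma ccvg_cst l : ccvg (fun=> l) l.
Proof. by move=> e e0; exists 0%N => n _; rewrite subrr cmod0 ltW. Qed.

Lemma ccvgD u v l l' : ccvg u l -> ccvg v l' -> ccvg (fun n => u n + v n) (l + l').
Proof.
move=> H H' e e0; have e2 : 0 < e / 2 by rewrite divr_gt0.
have [n Hn] := H _ e2; have [n' Hn'] := H' _ e2.
exists (maxn n n') => m; rewrite geq_max => /andP[/Hn h /Hn' h'].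
rewrite opprD addrACA (le_trans (cmodD _ _)) // [e]splitr; exact: lerD.
Qed.

Lemma ccvgZ a u l : ccvg u l -> ccvg (fun n => a * u n) (a * l).
Proof.
move=> H e e0; have a0 : 0 < cmod a + 1 by rewrite ltr_wpDl ?cmod_ge0.
have [n Hn] := H _ (divr_gt0 e0 a0); exists n => m /Hn.
rewrite -mulrBr cmodM ler_pdivlMr // mulrC; apply: le_trans.
by rewrite ler_wpM2r ?cmod_ge0 // lerDl.
Qed.

Lemma ccvg_sum n (u : nat -> nat -> C) l : (forall i, ccvg (u i) (l i)) ->
  ccvg (fun m => \sum_(i < n) u i m) (\sum_(i < n) l i).
Proof.
move=> H; elim: n => [|n IH].
  have := ccvg_cst 0; rewrite big_ord0; congr ccvg.
  by apply/funext => m; rewrite big_ord0.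
have := ccvgD IH (H n); rewrite big_ord_recr; congr ccvg.
by apply/funext => m; rewrite big_ord_recr.
Qed.

Lemma ccvg_geometric u l (K q : R) : 0 <= q < 1 -> (forall n, cmod (u n - l) <= K * q ^+ n) ->
  0 <= K -> ccvg u l.
Proof.
move=> q01 H K0 e e0; have [m Hm] := geometric_small K q01 e0.
exists m => n mn; rewrite (le_trans (H n)) // (le_trans _ Hm) // ler_wpM2l //.
by case/andP: q01 => q0 q1; rewrite ler_wiXn2l // ltW.
Qed.

Lemma ccvg_shift u l m : ccvg (fun n => u (m + n)%N) l -> ccvg u l.
Proof.
move=> H e e0; have [n0 Hn] := H e e0; exists (m + n0)%N => n mn.
have mn' : (m <= n)%N by rewrite (leq_trans _ mn) // leq_addr.
by rewrite -(subnKC mn') Hn // leq_subRL.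
Qed.

Definition disc r z : C := if cmod z <= r then 1 else 0.

Lemma cmod_disc r z : cmod (disc r z) <= 1.
Proof. by rewrite /disc; case: ifP; rewrite ?cmod1 ?cmod0. Qed.

Lemma disc_rot r t z : disc r (cis t * z) = disc r z.
Proof. by rewrite /disc cmodM cmod_cis mul1r. Qed.

Lemma measurable_disc r a b :
  measurable_fun setT (fun p : M * M => if cmod (pt p) <= r then a else b : R).
Proof.
apply: measurable_fun_ifT => //.
by apply: measurable_fun_ler => //; exact: measurable_cmod_pt.
Qed.

Lemma cmeasurable_disc r : cmeasurable (disc r).
Proof.
split.
- have := measurable_disc r 1 0; congr measurable_fun; apply/funext => p.
  by rewrite /disc -/(pt p); case: ifP.
- have := measurable_disc r 0 0; congr measurable_fun; apply/funext => p.
  by rewrite /disc -/(pt p); case: ifP.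
Qed.

Lemma cintegrable_disc r F : cintegrable F -> cintegrable (fun z => disc r z * F z).
Proof.
move=> iF; apply: (cintegrable_le _ (cintegrable_cmod iF)) => [|p].
  by apply: cmeasurableM; [exact: cmeasurable_disc|exact: cintegrable_measurable].
by rewrite cmodM ler_piMl ?cmod_ge0 // cmod_disc.
Qed.

(** The change of variables gives I = c I. *)
Lemma cintegral_rotation_eq0 F t (c : C) : cos (t / 2) != 0 -> c != 1 ->
  cintegrable F -> (forall z, F (cis t * z) = c * F z) -> cintegral F = 0.
Proof.
move=> t0 c1 iF FE; have [_ E] := cintegral_rotation t0 iF.
have : (1 - c) * cintegral F = 0.
  rewrite mulrBl mul1r -cintegralZ // -{1}E; apply/eqP; rewrite subr_eq0; apply/eqP.
  by congr cintegral; apply/funext => z; rewrite FE.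
by move/eqP; rewrite mulf_eq0 subr_eq0 eq_sym (negbTE c1) /= => /eqP.
Qed.

(** Dominated convergence for the part outside the disc, which vanishes at each point once n exceeds
    its modulus. *)
Lemma disc_exhaustion F : cintegrable F ->
  ccvg (fun n => cintegral (fun z => disc n%:R z * F z)) (cintegral F).
Proof.
move=> iF e e0; have iC := cintegrable_cmod iF.
have mC := measurable_cmod (cintegrable_measurable iF).
pose g n (p : M * M) : R := (if cmod (pt p) <= n%:R then 0 else 1) * cmod (F (pt p)).
have mg n : measurable_fun setT (g n) by apply: measurable_funM => //; exact: measurable_disc.
have gle n p : 0 <= g n p <= cmod (F (pt p)).
  by rewrite /g; case: ifP; rewrite ?mul0r ?mul1r ?cmod_ge0 ?lexx.
have ig n : pl.-integrable setT (EFin \o g n).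
  apply: le_integrable iC => //; first exact/measurable_EFinP.
  move=> p _; have /andP[g0 g1] := gle n p; rewrite /= lee_fin !ger0_norm ?cmod_ge0 //.
have nz p : \forall n \near \oo, g n p = 0.
  exists (Num.bound (cmod (pt p))) => // n /= nb; rewrite /g ifT ?mul0r //.
  by rewrite ltW // (lt_le_trans (archi_boundP (cmod_ge0 _))) // ler_nat.
have gc p : (fun n => (g n p)%:E) @ \oo --> 0%E.
  apply: cvg_near_cst; have [N _ HN] := nz p; exists N => // n /HN /= ->.
  by [].
have gd p n : (`|(g n p)%:E| <= (cmod (F (pt p)))%:E)%E.
  by have /andP[g0 g1] := gle n p; rewrite lee_fin ger0_norm.
have [_ _] := @dominated_convergence _ _ _ pl setT measurableT (fun n p => (g n p)%:E)
  (cst 0%E) (fun p => (cmod (F (pt p)))%:E) (fun n => measurable_int _ (ig n))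
  (measurable_cst _) (aeW _ (fun p _ => gc p)) iC (aeW _ (fun p n _ => gd p n)).
rewrite integral0 => /fine_cvgP[_ /cvgrPdist_le H].
have [n0 _ Hn0] := H (e / 2) (divr_gt0 e0 (ltr0Sn _ 1)).
exists n0 => n /Hn0 /=; rewrite sub0r normrN => Hg.
have iD := cintegrable_disc n%:R iF; have iN := cintegrableZ (-1) iF.
rewrite -mulN1r -cintegralZ // -cintegralD //.
apply: (le_trans (cmod_cintegral_le _ (ig n) _)).
- by apply: cintegrable_measurable; exact: cintegrableD.
- move=> p; rewrite -/(pt p) /g /disc; case: ifP => _.
    by rewrite mul1r mulN1r subrr mul0r cmod0.
  by rewrite mul0r add0r mulN1r cmodN mul1r.
- by rewrite mulrC -ler_pdivlMr // (le_trans (ler_norm _)).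
Qed.

(** The angle pi / (2 k) aims at i rather than -1: for k = 1 the target -1 would force a half angle
    of cosine 0, outside the reach of [rotation_preserving]. *)
Lemma cis_root k : (0 < k)%N -> exists t, cos (t / 2) != 0 /\ cis t ^+ k = 'i%C.
Proof.
move=> k0; have kn : k%:R != 0 :> R by rewrite pnatr_eq0 -lt0n.
have k1 : 0 < k%:R :> R by rewrite ltr0n.
exists (pi / 2 / k%:R); split.
  rewrite gt_eqF //; apply: cos_gt0_pihalf; apply/andP; split.
    rewrite (@lt_trans _ _ 0) ?oppr_lt0 ?divr_gt0 ?pi_gt0 //.
  have kk : 1 <= k%:R :> R by rewrite ler1n.
  rewrite ltr_pdivrMr // ltr_pdivrMr // -mulrA ltr_pMr ?divr_gt0 ?pi_gt0 //; lra.
rewrite /cis -cexpMn (_ : _ *+ k = 'i%C * (pi / 2)%:C); last first.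
  rewrite -mulrnAr -(rmorphMn (real_complex R)) /=; congr ('i%C * _%:C).
  by rewrite -mulr_natr divfK.
by rewrite -/(cis _) cisE cos_pihalf sin_pihalf.
Qed.

(** Rotation by t multiplies the integrand by a power of [cis t] with exponent i - j, or of its
    conjugate; the angle is chosen so that this phase is i or conj i. *)
Lemma disc_orthogonal (rho : C -> C) r i j : i != j ->
  (forall t z, rho (cis t * z) = rho z) ->
  cintegrable (fun z => z ^+ i * cj z ^+ j * rho z) ->
  cintegral (fun z => disc r z * (z ^+ i * cj z ^+ j * rho z)) = 0.
Proof.
move=> ij rot irho; have iD := cintegrable_disc r irho.
have i1 : 'i%C != 1 :> C by rewrite eq_complex /= negb_and eq_sym oner_eq0.
have i2 : cj 'i%C != 1 :> C by rewrite conji eq_complex /= negb_and oppr0 eq_sym oner_eq0.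
have cc t : cis t * cj (cis t) = 1 by rewrite mulcJ cmod_cis expr1n.
case: (ltngtP i j) ij => // ij _.
- have [t [t0 tE]] : exists t, cos (t / 2) != 0 /\ cis t ^+ (j - i) = 'i%C.
    by apply: cis_root; rewrite subn_gt0.
  apply: (cintegral_rotation_eq0 t0 i2 iD) => z.
  rewrite disc_rot rot -tE conjX conjM !exprMn.
  have -> : cj (cis t) ^+ j = cj (cis t) ^+ i * cj (cis t) ^+ (j - i).
    by rewrite -exprD subnKC // ltnW.
  rewrite (_ : disc r z * _ = (cis t ^+ i * cj (cis t) ^+ i) *
    (cj (cis t) ^+ (j - i) * (disc r z * (z ^+ i * cj z ^+ j * rho z)))); last by ring.
  by rewrite -exprMn cc expr1n mul1r.
- have [t [t0 tE]] : exists t, cos (t / 2) != 0 /\ cis t ^+ (i - j) = 'i%C.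
    by apply: cis_root; rewrite subn_gt0.
  apply: (cintegral_rotation_eq0 t0 i1 iD) => z.
  rewrite disc_rot rot -tE conjM !exprMn.
  have -> : cis t ^+ i = cis t ^+ j * cis t ^+ (i - j) by rewrite -exprD subnKC // ltnW.
  rewrite (_ : disc r z * _ = (cis t ^+ j * cj (cis t) ^+ j) *
    (cis t ^+ (i - j) * (disc r z * (z ^+ i * cj z ^+ j * rho z)))); last by ring.
  by rewrite -exprMn cc expr1n mul1r.
Qed.

(** On the disc the coefficients h_j may be replaced by Taylor polynomials of degree below m, with
    an error of order 2^-m times the integral of |rho|. *)
Lemma disc_radial_integral N (h : nat -> C -> C) (rho : C -> C) r : 0 < r ->
  (forall j, entire (h j)) -> (forall t z, rho (cis t * z) = rho z) ->
  (forall i j, cintegrable (fun z => z ^+ i * cj z ^+ j * rho z)) ->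
  cintegrable (fun z => (\sum_(j < N) h j z * cj z ^+ j) * rho z) ->
  cintegral (fun z => disc r z * ((\sum_(j < N) h j z * cj z ^+ j) * rho z)) =
  \sum_(j < N) taylor_coef (h j) j *
    cintegral (fun z => disc r z * (z ^+ j * cj z ^+ j * rho z)).
Proof.
move=> r0 eh rot irho iG.
have irho0 : cintegrable rho.
  by have := irho 0%N 0%N; congr cintegrable; apply/funext => z; rewrite !expr0 !mul1r.
pose mono i j z := disc r z * (z ^+ i * cj z ^+ j * rho z).
have imono i j : cintegrable (mono i j) by apply: cintegrable_disc.
pose T m z := \sum_(j < N) \sum_(i < m) taylor_coef (h j) i * mono i j z.
have [K [K0 HK]] : exists K : nat -> R, (forall j, 0 <= K j) /\ forall j z m, cmod z <= r ->
    cmod (h j z - \sum_(i < m) taylor_coef (h j) i * z ^+ i) <= K j / 2 ^+ m.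
  have H j := cid (taylor_expansion (eh j) r0).
  exists (fun j => projT1 (H j)); split=> j; have [] := projT2 (H j) => // _; exact.
have TI m := cintegral_sum N (fun j => (cintegral_sum m
  (fun i => cintegrableZ (taylor_coef (h j) i) (imono i j))).1).
set I := Rintegral pl setT (fun p => cmod (rho (p.1 +i* p.2))).
pose K' := \sum_(j < N) K j * r ^+ j.
(* Once m >= N all diagonal indices j < N are present and everything else integrates to 0, so the
   approximations are constant in m. *)
have TE m : (N <= m)%N -> cintegral (T m) = \sum_(j < N) taylor_coef (h j) j * cintegral (mono j j).
  move=> Nm; rewrite (TI m).2; apply: eq_bigr => j _.
  rewrite (cintegral_sum m (fun i => cintegrableZ (taylor_coef (h j) i) (imono i j))).2.
  have jm : (j < m)%N by rewrite (leq_trans (ltn_ord j)).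
  rewrite (bigD1 (Ordinal jm)) //= big1 ?addr0 ?cintegralZ // => i /= ij.
  by rewrite cintegralZ // disc_orthogonal ?mulr0.
set G := fun z => _; have iDG : cintegrable G by apply: cintegrable_disc.
apply: (@ccvg_unique (fun m => cintegral (T (N + m)%N))); last first.
  have := @ccvg_cst (\sum_(j < N) taylor_coef (h j) j * cintegral (mono j j)).
  by congr ccvg; apply/funext => m; rewrite TE // leq_addr.
have I0 : 0 <= I by apply: Rintegral_ge0 => p _; exact: cmod_ge0.
have K'0 : 0 <= K' by apply: sumr_ge0 => j _; rewrite mulr_ge0 // exprn_ge0 // ltW.
have h1 : 0 <= (2^-1 : R) < 1 by rewrite invr_ge0 ler0n invf_lt1 ?ltr1n.
apply: (ccvg_shift (m := 0%N)).
apply: (@ccvg_geometric _ _ (2 * (K' * I)) 2^-1) => //; last by rewrite !mulr_ge0.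
move=> m; set n := (N + (0 + m))%N.
have iT := (TI n).1; rewrite -mulN1r -cintegralZ // -cintegralD //; last exact: cintegrableZ.
have iK : pl.-integrable setT (EFin \o (fun p => K' * 2^-1 ^+ n * cmod (rho (pt p)))).
  have := integrableZl measurableT (K' * 2^-1 ^+ n) (cintegrable_cmod irho0).
  by congr (integrable _ _ _); apply/funext => p /=; rewrite -EFinM.
have nm : K' * (2^-1 : R) ^+ n <= K' * 2^-1 ^+ m.
  rewrite ler_wpM2l // ler_wiXn2l ?invr_ge0 ?invf_le1 ?ler1n //.
  by rewrite /n add0n leq_addl.
apply: (le_trans (cmod_cintegral_le _ iK _)).
- apply: cintegrable_measurable; apply: cintegrableD => //; exact: cintegrableZ.
- move=> p; rewrite -/(pt p); move: (pt p) => z.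
  have -> : T n z = disc r z * ((\sum_(j < N)
      (\sum_(i < n) taylor_coef (h j) i * z ^+ i) * cj z ^+ j) * rho z).
    rewrite mulr_suml mulr_sumr; apply: eq_bigr => j _.
    rewrite !mulr_suml mulr_sumr; apply: eq_bigr => i _; rewrite /mono; ring.
  rewrite (_ : _ + _ = - (disc r z * ((\sum_(j < N) (h j z -
     \sum_(i < n) taylor_coef (h j) i * z ^+ i) * cj z ^+ j) * rho z))); last first.
    rewrite mulN1r /G; under [in RHS]eq_bigr do rewrite mulrBl.
    by rewrite sumrB; ring.
  rewrite cmodN /disc; case: ifP => zr; last first.
    by rewrite mul0r cmod0 !mulr_ge0 ?cmod_ge0 ?exprn_ge0 ?invr_ge0.
  rewrite mul1r cmodM ler_wpM2r ?cmod_ge0 // (le_trans (cmod_sum _ _ _)) //.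
  rewrite /K' mulr_suml ler_sum // => j _; rewrite cmodM cmodX cmodJ mulrAC.
  by rewrite ler_pM ?cmod_ge0 ?exprn_ge0 ?cmod_ge0 ?exprVn ?HK ?lerXn2r ?nnegrE ?cmod_ge0 ?(ltW r0).
- rewrite RintegralZl //; last exact: cintegrable_cmod.
  rewrite -/I (_ : 2 * (K' * I) * 2^-1 ^+ m = 2 * (K' * 2^-1 ^+ m * I)); last by ring.
  by rewrite ler_wpM2l // ler_wpM2r.
Qed.

(** Both sides of the identity on discs converge as the radius grows: the left one by integrability
    of the whole sum, the right one by integrability of each monomial. *)
Lemma radial_integral N (h : nat -> C -> C) (rho : C -> C) :
  (forall j, entire (h j)) -> (forall t z, rho (cis t * z) = rho z) ->
  (forall i j, cintegrable (fun z => z ^+ i * cj z ^+ j * rho z)) ->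
  cintegrable (fun z => (\sum_(j < N) h j z * cj z ^+ j) * rho z) ->
  cintegral (fun z => (\sum_(j < N) h j z * cj z ^+ j) * rho z) =
  \sum_(j < N) taylor_coef (h j) j * cintegral (fun z => z ^+ j * cj z ^+ j * rho z).
Proof.
move=> eh rot irho iG.
have H := ccvg_sum N (fun j => ccvgZ (taylor_coef (h j) j) (disc_exhaustion (irho j j))).
(* The shift discards the disc of radius 0, since the identity on discs is stated for positive
   radius. *)
apply: (ccvg_unique (disc_exhaustion iG)); apply: (@ccvg_shift _ _ 1%N).
move=> e /H[n0 Hn0]; exists n0 => n n0n.
rewrite (disc_radial_integral (ltr0Sn R n) eh rot irho iG).
by apply: Hn0; rewrite (leq_trans n0n).
Qed.

End RadialIntegrals.

(** * Alternating binomial sums and moments of Laguerre polynomials *)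

Section LaguerreMoments.
Variable R : realType.
Local Notation C := R[i].
Implicit Types (z w : C).

(** Pascal's rule: an alternating sum of order k + 1 is one of order k applied to differences. *)
Lemma alternating_binS (A : nzRingType) k (a : nat -> A) :
  \sum_(i < k.+2) (-1) ^+ i * 'C(k.+1, i)%:R * a i =
  \sum_(i < k.+1) (-1) ^+ i * 'C(k, i)%:R * (a i - a i.+1).
Proof.
rewrite big_ord_recl /=.
under eq_bigr => i _ do rewrite /bump add1n binS natrD mulrDr mulrDl.
rewrite big_split /= addrA.
have -> : (-1) ^+ 0 * 'C(k.+1, 0)%:R * a 0%N +
    \sum_(i < k.+1) (-1) ^+ i.+1 * 'C(k, i.+1)%:R * a i.+1 =
    \sum_(i < k.+1) (-1) ^+ i * 'C(k, i)%:R * a i.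
  rewrite big_ord_recr /= (@bin_small k k.+1) // mulr0 mul0r addr0 [in RHS]big_ord_recl /=.
  by rewrite !bin0.
rewrite -big_split /=; apply: eq_bigr => i _.
by rewrite exprS mulN1r mulrBr !mulNr.
Qed.

(** Each difference lowers the lower index of the binomial coefficient by one; after k differences,
    degree j < k leaves nothing. *)
Lemma alternating_vandermonde (A : nzRingType) k s j :
  \sum_(i < k.+1) (-1) ^+ i * 'C(k, i)%:R * 'C(i + s, j)%:R =
  (if (k <= j)%N then (-1) ^+ k * 'C(s, j - k)%:R else 0) :> A.
Proof.
elim: k s => [|k IH] s; first by rewrite big_ord_recl big_ord0 addr0 !mul1r add0n subn0.
rewrite (alternating_binS k (fun i => 'C(i + s, j)%:R)).
under eq_bigr => i _ do rewrite mulrBr addSnnS.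
rewrite sumrB !IH; case: (leqP k j) => kj; last by rewrite subrr leqNgt ltnW.
rewrite -mulrBr; case: (ltnP k j) => kj'.
  rewrite -(subnSK kj') binS natrD opprD addrA subrr sub0r exprS mulN1r.
  by rewrite mulrN mulNr.
by rewrite (_ : j - k = 0)%N ?bin0 ?subrr ?mulr0 //; apply/eqP.
Qed.

Lemma laguerre_sum1 (A : nzRingType) k j : (j <= k)%N ->
  \sum_(i < k.+1) (-1) ^+ i * 'C(k + 1, k - i)%:R * 'C(i + j, j)%:R = (j == 0)%:R :> A.
Proof.
(* In the vanishing sum of order k + 1 with offset j - 1, the terms from 1 on are minus the wanted
   sum, and the term 0 is C(j - 1, j). The latter is 0 for j > 0, and 1 for j = 0 because [j.-1]
   truncates to 0. *)
move=> jk; have := alternating_vandermonde A k.+1 j.-1 j.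
rewrite leqNgt ltnS jk /= big_ord_recl /= expr0 bin0 !mul1r add0n.
have -> : 'C(j.-1, j) = (j == 0)%N by case: j {jk} => // j; rewrite bin_small.
move/eqP; rewrite addr_eq0 => /eqP ->; rewrite -sumrN; apply: eq_bigr => i _.
rewrite /bump add1n addn1 exprS mulN1r !mulNr opprK; congr (_ * _%:R * _%:R).
  rewrite -[LHS]bin_sub; last by rewrite (leq_trans (leq_subr _ _)).
  by congr 'C(_, _); have := ltn_ord i; lia.
by case: j {jk} => [|j]; rewrite ?bin0 //= addSnnS.
Qed.

(** Whereas parameter 1 isolates the moment j = 0, parameter 0 isolates j = k: this is the
    difference between the two kinds of kernel. *)
Lemma laguerre_sum0 (A : nzRingType) k j : (j <= k)%N ->
  \sum_(i < k.+1) (-1) ^+ i * 'C(k + 0, k - i)%:R * 'C(i + j, j)%:R =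
  (if j == k then (-1) ^+ k else 0) :> A.
Proof.
move=> jk; rewrite (_ : (if _ then _ else _) =
  if (k <= j)%N then (-1) ^+ k * 'C(j, j - k)%:R else 0); last first.
  rewrite eqn_leq jk /=; case: ifP => // kj.
  by rewrite (_ : j - k = 0)%N ?bin0 ?mulr1 //; apply/eqP; rewrite subn_eq0.
rewrite -alternating_vandermonde; apply: eq_bigr => i _.
by rewrite addn0 bin_sub // -ltnS.
Qed.

Definition laguerre_weight b k z : C := laguerre b k (z * cj z / 2) * gauss z.

Lemma laguerre_weight_rot b k t z : laguerre_weight b k (cis t * z) = laguerre_weight b k z.
Proof.
rewrite /laguerre_weight /gauss conjM (_ : cis t * z * _ = z * cj z) //.
by rewrite mulrACA [cis t * _]mulcJ cmod_cis expr1n mul1r.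
Qed.

Lemma laguerre_weight_mono b k i j :
  cintegrable (fun z => z ^+ i * cj z ^+ j * laguerre_weight b k z).
Proof.
pose c l : C := (-1) ^+ l * 'C(k + b, k - l)%:R / l`!%:R / 2 ^+ l.
have ig l : cintegrable (fun z => gauss z * (z ^+ (l + i) * cj z ^+ (l + j))).
  have := fock_cintegrable 0 0 0 0 (rapid_gauss_poly R (l + i) (l + j)).
  congr cintegrable; apply/funext => z.
  by rewrite /fock_kernel !expr0 mul0r cexp0 !mulr1.
have := (cintegral_sum k.+1 (fun l => cintegrableZ (c l) (ig l))).1.
congr cintegrable; apply/funext => z; rewrite /laguerre_weight /laguerre mulr_suml mulr_sumr.
apply: eq_bigr => l _; rewrite /c !exprD !exprMn exprVn.
by ring.
Qed.

(** The Gaussian moment 2^(i+j) (i + j)!, divided by the 2^i i! of the Laguerre coefficient, is 2^j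
    j! C(i + j, j). *)
Lemma laguerre_moment b k j :
  cintegral (fun z => z ^+ j * cj z ^+ j * laguerre_weight b k z) =
  (2 * pi)%:C * (2 ^+ j * j`!%:R *
    \sum_(i < k.+1) (-1) ^+ i * 'C(k + b, k - i)%:R * 'C(i + j, j)%:R).
Proof.
pose c l : C := (-1) ^+ l * 'C(k + b, k - l)%:R / l`!%:R / 2 ^+ l.
have ig l : cintegrable (fun z => gauss z * (z ^+ (l + j) * cj z ^+ (l + j))).
  have := fock_cintegrable 0 0 0 0 (rapid_gauss_poly R (l + j) (l + j)).
  congr cintegrable; apply/funext => z.
  by rewrite /fock_kernel !expr0 mul0r cexp0 !mulr1.
have E := (cintegral_sum k.+1 (fun l => cintegrableZ (c l) (ig l))).2.
rewrite (_ : cintegral _ = cintegral (fun z => \sum_(l < k.+1) c l *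
  (gauss z * (z ^+ (l + j) * cj z ^+ (l + j))))).
  rewrite E !mulr_sumr; apply: eq_bigr => l _; rewrite cintegralZ //.
  rewrite -/(gauss_moment R (l + j)) gauss_momentE /c -(@bin_fact (l + j) j) ?leq_addl //.
  rewrite addnK !natrM exprD.
  have l0 : l`!%:R != 0 :> C by rewrite pnatr_eq0 -lt0n fact_gt0.
  have p0 : 2 ^+ l != 0 :> C by rewrite expf_neq0 // pnatr_eq0.
  move: (2 ^+ l) p0 l0 => p; move: (l`!%:R) => q p0 q0.
  by field; rewrite p0 q0.
congr cintegral; apply/funext => z; rewrite /laguerre_weight /laguerre mulr_suml mulr_sumr.
apply: eq_bigr => l _; rewrite /c !exprD !exprMn exprVn.
by ring.
Qed.

End LaguerreMoments.

(** * Reproducing kernels in the weighted space *)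

Section WeightedSpace.
Variable R : realType.
Local Notation C := R[i].
Local Notation M := (measurableTypeR R).
Local Notation pl := (@plane_measure R).
Implicit Types (f g k : C -> C) (z w a : C).

Definition wt z : R := expR (- complex.Im z ^+ 2).

Lemma wt_gt0 z : 0 < wt z. Proof. exact: expR_gt0. Qed.

Lemma rbf_weightE z : rbf_weight z = (wt z)%:C.
Proof.
rewrite /rbf_weight (_ : _ / 4 = (- complex.Im z ^+ 2)%:C) ?cexpR //.
by apply: complex_eq; case: z => x y /=; rewrite ?ReImE /=; field.
Qed.

Definition sqnorm f z : R := cmod (f z) ^+ 2 * wt z.

Lemma sqnorm_ge0 f z : 0 <= sqnorm f z.
Proof. by rewrite mulr_ge0 ?sqr_ge0 // ltW // wt_gt0. Qed.

Lemma rbf_norm2E f :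
  rbf_norm2 f = (((2 * pi)^-1)%:E * \int[pl]_p (sqnorm f (pt p))%:E)%E.
Proof.
rewrite /rbf_norm2; congr (_ * _)%E; apply: eq_integral => p _; congr EFin.
by rewrite -/(pt p) rbf_weightE cmodE -(rmorphXn (real_complex R)) -(rmorphM (real_complex R)).
Qed.

Lemma ipi_gt0 : 0 < (2 * pi : R)^-1.
Proof. by rewrite invr_gt0 mulr_gt0 ?pi_gt0. Qed.

(** Measurability is recorded because finiteness of [rbf_norm2] alone does not give it; members of
    the spaces at hand are measurable by their form. *)
Definition square_int f : Prop := cmeasurable f /\
  pl.-integrable setT (fun p => (sqnorm f (pt p))%:E).

Lemma measurable_wt : measurable_fun setT (fun p : M * M => wt (pt p)).
Proof.
apply: measurableT_comp => //; apply: measurable_funN; apply: measurable_funX.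
exact: measurable_snd.
Qed.

Lemma measurable_sqnorm f : cmeasurable f ->
  measurable_fun setT (fun p : M * M => sqnorm f (pt p)).
Proof.
move=> mf; apply: measurable_funM; last exact: measurable_wt.
by apply: measurable_funX; exact: measurable_cmod.
Qed.

Lemma square_intP f : cmeasurable f -> (rbf_norm2 f < +oo)%E <-> square_int f.
Proof.
move=> mf; have ms := measurable_sqnorm mf; rewrite rbf_norm2E.
have I0 : (0 <= \int[pl]_p (sqnorm f (pt p))%:E)%E.
  by apply: integral_ge0 => p _; rewrite lee_fin sqnorm_ge0.
have absE : (\int[pl]_p `|(sqnorm f (pt p))%:E| = \int[pl]_p (sqnorm f (pt p))%:E)%E.
  by apply: eq_integral => p _; rewrite gee0_abs // lee_fin sqnorm_ge0.
split=> [H|[_ /integrableP[_]]].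
  split=> //; apply/integrableP; split; first exact/measurable_EFinP.
  rewrite absE; move: I0 H; case: (\int[pl]_p _)%E => [r| |] //= _; rewrite ?ltry //.
  by rewrite gt0_muley ?lte_fin ?ipi_gt0 // ltxx.
rewrite absE; move: I0; case: (\int[pl]_p _)%E => [r| |] //= _ _; rewrite -EFinM; exact: ltry.
Qed.

Lemma square_int_le f (G : M * M -> R) : cmeasurable f ->
  pl.-integrable setT (EFin \o G) -> (forall p, sqnorm f (pt p) <= G p) -> square_int f.
Proof.
move=> mf iG fG; split=> //; apply: (le_integrable _ _ _ iG) => //.
  by apply/measurable_EFinP; exact: measurable_sqnorm.
move=> p _; rewrite lee_fin !ger0_norm ?sqnorm_ge0 //.
exact: le_trans (sqnorm_ge0 _ _) (fG p).
Qed.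

Lemma cmodD_sqr z w : cmod (z + w) ^+ 2 <= 2 * cmod z ^+ 2 + 2 * cmod w ^+ 2.
Proof.
have := cmodD z w; have := cmod_ge0 (z + w); have := cmod_ge0 z; have := cmod_ge0 w.
have := sqr_ge0 (cmod z - cmod w).
move: (cmod z) (cmod w) (cmod (z + w)) => x y s H y0 x0 s0 le.
have : s ^+ 2 <= (x + y) ^+ 2 by rewrite lerXn2r ?nnegrE ?addr_ge0.
nra.
Qed.

Lemma sqnorm_lin a f g z :
  sqnorm (fun z => a * f z + g z) z <= 2 * cmod a ^+ 2 * sqnorm f z + 2 * sqnorm g z.
Proof.
rewrite (_ : _ + _ = (2 * cmod (a * f z) ^+ 2 + 2 * cmod (g z) ^+ 2) * wt z).
  by rewrite ler_wpM2r ?cmodD_sqr // ltW // wt_gt0.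
by rewrite cmodM /sqnorm; ring.
Qed.

Lemma square_int_lin a f g : square_int f -> square_int g ->
  square_int (fun z => a * f z + g z).
Proof.
move=> [mf lf] [mg lg].
apply: (@square_int_le _ (fun p => 2 * cmod a ^+ 2 * sqnorm f (pt p) + 2 * sqnorm g (pt p))).
- by apply: cmeasurableD => //; apply: cmeasurableM => //; exact: cmeasurable_cst.
- have := integrableD measurableT (integrableZl measurableT (2 * cmod a ^+ 2) lf)
    (integrableZl measurableT 2 lg).
  by congr (integrable _ _ _); apply/funext => p /=; rewrite EFinD !EFinM.
- by move=> p; exact: sqnorm_lin.
Qed.

Lemma square_int0 : square_int (fun=> 0).
Proof.
apply: (@square_int_le _ (fun=> 0)) => [||p]; first exact: cmeasurable_cst.
  exact: integrable0.
by rewrite /sqnorm cmod0 expr0n mul0r.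
Qed.

Lemma square_intB f g : square_int f -> square_int g ->
  square_int (fun z => f z - g z).
Proof.
move=> hf hg; have := square_int_lin (-1) hg hf.
by congr square_int; apply/funext => z; rewrite mulN1r addrC.
Qed.

Lemma cmeasurable_weight : cmeasurable (@rbf_weight R).
Proof.
apply: cmeasurable_cexp; have mid := cmeasurable_id R.
have mi : cmeasurable (fun z : C => z - cj z).
  have := cmeasurableD mid (cmeasurableM (cmeasurable_cst (-1)) (cmeasurableJ mid)).
  by congr cmeasurable; apply/funext => z; rewrite mulN1r.
by apply: cmeasurableM; [exact: cmeasurableX|exact: cmeasurable_cst].
Qed.

Lemma cmod_weight z : cmod (rbf_weight z) = wt z.
Proof. by rewrite rbf_weightE cmodR ger0_norm // ltW // wt_gt0. Qed.

Lemma square_int_prod f g : square_int f -> square_int g ->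
  cintegrable (fun z => f z * cj (g z) * rbf_weight z).
Proof.
move=> [mf lf] [mg lg].
apply: (@cintegrable_le _ _ (fun p => sqnorm f (pt p) + sqnorm g (pt p))).
- apply: cmeasurableM; last exact: cmeasurable_weight.
  by apply: cmeasurableM => //; exact: cmeasurableJ.
- have := integrableD measurableT lf lg.
  by congr (integrable _ _ _); apply/funext => p.
- move=> p; rewrite -/(pt p) !cmodM cmodJ cmod_weight /sqnorm -mulrDl.
  rewrite ler_wpM2r ?(ltW (wt_gt0 _)) //.
  have := sqr_ge0 (cmod (f (pt p)) - cmod (g (pt p))).
  have := mulr_ge0 (cmod_ge0 (f (pt p))) (cmod_ge0 (g (pt p))).
  move: (cmod (f _)) (cmod (g _)) => x y; nra.
Qed.

Lemma rbf_ip_lin a f g k : square_int f -> square_int g -> square_int k ->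
  rbf_ip (fun z => a * f z + g z) k = a * rbf_ip f k + rbf_ip g k.
Proof.
move=> hf hg hk; have i1 := square_int_prod hf hk; have i2 := square_int_prod hg hk.
rewrite /rbf_ip mulrCA -mulrDr -(cintegralZ a i1) -cintegralD //; last exact: cintegrableZ.
by congr (_ * cintegral _); apply/funext => z; ring.
Qed.

Lemma rbf_ip_sym f g : square_int f -> square_int g -> rbf_ip g f = cj (rbf_ip f g).
Proof.
move=> hf hg; rewrite /rbf_ip conjM conjR -cintegralJ; last exact: square_int_prod.
congr (_ * cintegral _); apply/funext => z; rewrite !conjE rbf_weightE conjR.
by ring.
Qed.

Definition energy f : R := (2 * pi)^-1 * Rintegral pl setT (fun p => sqnorm f (pt p)).

Lemma energy_ge0 f : 0 <= energy f.
Proof.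
by rewrite mulr_ge0 ?(ltW ipi_gt0) //; apply: Rintegral_ge0 => p _; exact: sqnorm_ge0.
Qed.

Lemma rbf_ip_self f : rbf_ip f f = (energy f)%:C.
Proof.
rewrite /energy (rmorphM (real_complex R)) /rbf_ip; congr (_ * _).
rewrite /cintegral; apply: complex_eq => /=.
- by congr Rintegral; apply/funext => p; rewrite mulcJ rbf_weightE -(rmorphM (real_complex R)).
- transitivity (Rintegral pl setT (fun=> 0)).
    by congr Rintegral; apply/funext => p; rewrite mulcJ rbf_weightE -(rmorphM (real_complex R)).
  by rewrite /Rintegral integral0.
Qed.

Lemma ip_normE f : ip_norm (@rbf_ip R) f = Num.sqrt (energy f).
Proof. by rewrite /ip_norm rbf_ip_self. Qed.

(* A form of the Cauchy-Schwarz inequality that needs no case distinction. *)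
Lemma rbf_ip_le f g : square_int f -> square_int g ->
  cmod (rbf_ip f g) ^+ 2 <= energy f * (energy g + 1).
Proof.
move=> hf hg; set c := rbf_ip f g; have g0 := energy_ge0 g; have g1 : 0 < energy g + 1 by lra.
have E a : (energy (fun z => a * g z + f z))%:C =
    a * cj a * (energy g)%:C + a * cj c + cj a * c + (energy f)%:C.
  have hd := square_int_lin a hg hf.
  rewrite -rbf_ip_self rbf_ip_lin // (rbf_ip_sym hd hg) (rbf_ip_sym hd hf).
  rewrite !rbf_ip_lin // !rbf_ip_self (rbf_ip_sym hf hg) -/c.
  by clearbody c; rewrite !conjE; ring.
(* The minimising coefficient would be -c / energy g; adding 1 to the denominator avoids division by
   0 and, as s * energy g <= 1, still leaves s |c|^2 <= energy f. *)
pose s := (energy g + 1)^-1; pose a := - (s%:C * c).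
have : 0 <= energy (fun z => a * g z + f z) by exact: energy_ge0.
have {}E : energy (fun z => a * g z + f z) =
    s ^+ 2 * cmod c ^+ 2 * energy g - 2 * s * cmod c ^+ 2 + energy f.
  apply: (congr1 (@complex.Re R) (x := (_)%:C) (y := (_)%:C)); rewrite E /a; clear a E; clearbody c; rewrite !conjE.
  rewrite (_ : _ + _ = s%:C ^+ 2 * (c * cj c) * (energy g)%:C - 2 * s%:C * (c * cj c)
     + (energy f)%:C); last by ring.
  rewrite mulcJ; move: (cmod c ^+ 2) => x.
  rewrite -(rmorphXn (real_complex R)) -(rmorph_nat (real_complex R) 2).
  by rewrite !(rmorphD (real_complex R), rmorphN (real_complex R), rmorphM (real_complex R)).
rewrite E => H; have sg : s * (energy g + 1) = 1 by rewrite mulVf ?gt_eqF.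
have s0 : 0 < s by rewrite invr_gt0.
have c0 := sqr_ge0 (cmod c).
rewrite -ler_pdivrMr // -/s.
move: (cmod c ^+ 2) H c0 => x H x0; clear a E; clearbody s.
have sx : 0 <= s ^+ 2 * x by rewrite mulr_ge0 // sqr_ge0.
have e1 : s ^+ 2 * x * energy g = s * x - s ^+ 2 * x.
  rewrite (_ : s ^+ 2 * x * energy g = s * x * (s * (energy g + 1)) - s ^+ 2 * x); last by ring.
  by rewrite sg; ring.
by rewrite e1 in H; lra.
Qed.

End WeightedSpace.

(** * A criterion for reproducing kernel Hilbert spaces *)

Section AbstractReproducing.
Variable R : realType.
Local Notation C := R[i].
Local Notation M := (measurableTypeR R).
Local Notation pl := (@plane_measure R).
Implicit Types (f g k : C -> C) (z w a : C).

Lemma ccvg_cauchy (u : nat -> C) : (forall e : R, 0 < e -> exists n0 : nat,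
    forall m n, (n0 <= m)%N -> (n0 <= n)%N -> cmod (u m - u n) <= e) ->
  exists l, ccvg u l.
Proof.
move=> H.
have P (v : nat -> R) : (forall m n, `|v m - v n| <= cmod (u m - u n)) -> cvgn v.
  move=> Hv; apply/cauchy_cvgP/cauchy_exP => e e0.
  have [n0 Hn] := H (e / 2) (divr_gt0 e0 (ltr0Sn _ 1)).
  exists (v n0); exists n0 => // n /= n0n; rewrite /ball /=.
  rewrite (le_lt_trans (Hv _ _)) // (le_lt_trans (Hn _ _ (leqnn _) n0n)) //.
  by rewrite ltr_pdivrMr // mulrDr mulr1 ltrDl.
have c1 : cvgn (fun n => complex.Re (u n)).
  by apply: P => m n; rewrite -Re_N -Re_D; exact: normr_Re_le.
have c2 : cvgn (fun n => complex.Im (u n)).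
  by apply: P => m n; rewrite -Im_N -Im_D; exact: normr_Im_le.
exists (limn (fun n => complex.Re (u n)) +i* limn (fun n => complex.Im (u n))) => e e0.
have e2 : 0 < e / 2 by rewrite divr_gt0.
move/cvgrPdist_le: c1 => /(_ _ e2)[n1 _ H1]; move/cvgrPdist_le: c2 => /(_ _ e2)[n2 _ H2].
exists (maxn n1 n2) => n; rewrite geq_max => /andP[/H1 /= h1 /H2 /= h2].
rewrite (le_trans (cmod_le _)) // !ReImE /= [e]splitr.
by apply: lerD; rewrite distrC.
Qed.

Lemma sqnorm_fatou (u : nat -> C -> C) f (c : R) : (forall n, square_int (u n)) ->
  (forall z, ccvg (fun n => u n z) (f z)) -> (forall n, energy (u n) <= c) ->
  square_int f /\ energy f <= c.
Proof.
move=> hu cu uc.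
have mf : cmeasurable f by apply: (cmeasurable_lim (fun n => (hu n).1)); exact: cu.
have IE n : (\int[pl]_p (sqnorm (u n) (pt p))%:E = (2 * pi * energy (u n))%:E)%E.
  rewrite /energy mulrA divff ?mul1r; last by rewrite gt_eqF // mulr_gt0 // pi_gt0.
  rewrite /Rintegral fineK //; apply: integrable_fin_num => //; exact: (hu n).2.
have cv p : (fun n => (sqnorm (u n) (pt p))%:E) @ \oo --> (sqnorm f (pt p))%:E.
  apply: cvg_EFin; first exact: nearW.
  apply: cvgM; last exact: cvg_cst.
  have cm : (fun n => cmod (u n (pt p))) @ \oo --> cmod (f (pt p)).
    apply/cvgrPdist_le => e e0; have [n0 Hn] := cu (pt p) e e0; exists n0 => // n /Hn /=.
    by apply: le_trans; rewrite ler_norml lerNl opprB cmod_ge_sub cmod_dist cmod_ge_sub.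
  by apply: cvgM.
have F : (\int[pl]_p (sqnorm f (pt p))%:E <= (2 * pi * c)%:E)%E.
  have -> : (\int[pl]_p (sqnorm f (pt p))%:E =
      \int[pl]_p limn_einf (fun n => (sqnorm (u n) (pt p))%:E))%E.
    apply: eq_integral => p _; have [-> _] := cvg_limn_einf_sup (cv p); by [].
  apply: (le_trans (fatou _ _ _ _)) => //.
  - by move=> n; exact: measurable_int (hu n).2.
  - by move=> n p _; rewrite lee_fin sqnorm_ge0.
  rewrite limn_einf_lim; apply: lime_le; first exact: is_cvg_einfs.
  apply: nearW => n; apply: (@le_trans _ _ (\int[pl]_p (sqnorm (u n) (pt p))%:E)%E).
    by apply: ereal_inf_lbound; exists n => /=.
  by rewrite IE lee_fin ler_wpM2l // mulr_ge0 ?pi_ge0.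
have sf : square_int f.
  apply/square_intP => //; rewrite rbf_norm2E.
  apply: (@le_lt_trans _ _ (((2 * pi)^-1)%:E * (2 * pi * c)%:E)%E); last by rewrite -EFinM ltry.
  by apply: lee_wpmul2l => //; rewrite lee_fin ltW // ipi_gt0.
split=> //; rewrite /energy mulrC ler_pdivrMr ?mulr_gt0 ?pi_gt0 //.
rewrite -lee_fin /Rintegral fineK 1?mulrC //.
by apply: integrable_fin_num => //; exact: sf.2.
Qed.

Lemma cmod_sqrt_le z (b : R) : cmod z ^+ 2 <= b -> cmod z <= Num.sqrt b.
Proof.
move=> H; have b0 : 0 <= b by rewrite (le_trans _ H) ?sqr_ge0.
by rewrite -(ger0_norm (cmod_ge0 z)) -sqrtr_sqr ler_sqrt.
Qed.

(** The last hypothesis stands in for closedness of H: a limit is only shown to satisfy the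
    reproducing identity, and each space must recover membership from that identity. *)
Lemma rkhs_of_reproducing (H : set (C -> C)) (K : C -> C -> C) :
  (forall f, H f -> square_int f) -> linear_subspace H ->
  reproducing_kernel H (@rbf_ip R) K ->
  (forall f, square_int f -> (forall w, f w = rbf_ip f (K^~ w)) -> H f) ->
  rkhs H (@rbf_ip R).
Proof.
move=> HS HL HK HC.
have bnd f w : H f -> cmod (f w) <= Num.sqrt (energy (K^~ w) + 1) * Num.sqrt (energy f).
  move=> Hf; have [Hw E] := HK w; rewrite -sqrtrM ?addr_ge0 ?energy_ge0 // mulrC.
  by apply: cmod_sqrt_le; rewrite {1}(E f Hf) rbf_ip_le //; exact: HS.
have HB f g : H f -> H g -> H (fun x => f x - g x).
  move=> Hf Hg; have := HL.2 (-1) _ _ Hg Hf.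
  by congr H; apply/funext => z; rewrite mulN1r addrC.
split=> //.
- split.
  + by move=> a f g k Hf Hg Hk; apply: rbf_ip_lin; exact: HS.
  + by move=> f g Hf Hg; apply: rbf_ip_sym; exact: HS.
  + by move=> f Hf; rewrite rbf_ip_self lecR energy_ge0.
  + move=> f Hf; rewrite rbf_ip_self => /(congr1 (@complex.Re R)) /= E w.
    apply/eqP; rewrite -cmod_eq0 eq_le cmod_ge0 andbT (le_trans (bnd f w Hf)) //.
    by rewrite E sqrtr0 mulr0.
- move=> u Hu cau.
  have cu z : exists l, ccvg (fun n => u n z) l.
    apply: ccvg_cauchy => e e0; set B := Num.sqrt (energy (K^~ z) + 1).
    have B0 : 0 <= B by exact: sqrtr_ge0.
    have [n0 Hn] := cau _ (divr_gt0 e0 (ltr_wpDl B0 (@ltr01 R))).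
    exists n0 => m n mn nn; have := Hn m n mn nn; rewrite /ip_dist ip_normE => Hd.
    rewrite (le_trans (bnd _ z (HB _ _ (Hu m) (Hu n)))) // -/B.
    rewrite (le_trans (ler_wpM2l B0 (ltW Hd))) // mulrA ler_pdivrMr ?ltr_wpDl //.
    by rewrite mulrC ler_wpM2l ?(ltW e0) // lerDl.
  pose f z := projT1 (cid (cu z)).
  have fE z : ccvg (fun n => u n z) (f z) by exact: projT2 (cid (cu z)).
  (* Fatou's lemma is applied to m |-> u n - u (n0 + m), with n fixed; the limit of these
     differences is u n - f. *)
  have dist (e : R) : 0 < e -> exists n0, forall n, (n0 <= n)%N ->
      square_int (fun z => u n z - f z) /\ energy (fun z => u n z - f z) <= e ^+ 2.
    move=> e0; have [n0 Hn] := cau e e0; exists n0 => n nn.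
    apply: (@sqnorm_fatou (fun m z => u n z - u (n0 + m)%N z)).
    + by move=> m; apply: HS; exact: HB.
    + move=> z d d0; have [n1 Hn1] := fE z d d0; exists n1 => m mn.
      rewrite (_ : _ - _ = - (u (n0 + m)%N z - f z)); last by ring.
      by rewrite cmodN Hn1 // (leq_trans mn) // leq_addl.
    + move=> m; have := Hn n (n0 + m)%N nn (leq_addr _ _); rewrite /ip_dist ip_normE => /ltW.
      by move=> h; rewrite -[energy _]sqr_sqrtr ?energy_ge0 // lerXn2r ?nnegrE ?sqrtr_ge0 // ltW.
  have sf : square_int f.
    have [n0 /(_ n0 (leqnn _))[h _]] := dist 1 ltr01.
    have := square_intB (HS _ (Hu n0)) h; congr square_int.
    by apply/funext => z; ring.
  exists f.
    apply: HC => // w; apply: (ccvg_unique (fE w)) => e e0.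
    have [Hw Ew] := HK w; set B := Num.sqrt (energy (K^~ w) + 1).
    have B0 : 0 <= B by exact: sqrtr_ge0.
    have B1 : 0 < B + 1 by rewrite ltr_wpDl.
    have [n0 Hn] := dist _ (divr_gt0 e0 B1); exists n0 => n /Hn[h1 h2].
    have uE : rbf_ip (fun z => u n z - f z) (K^~ w) = rbf_ip (u n) (K^~ w) - rbf_ip f (K^~ w).
      rewrite (_ : (fun z => u n z - f z) = fun z => -1 * f z + u n z); last first.
        by apply/funext => z; rewrite mulN1r addrC.
      by rewrite rbf_ip_lin ?mulN1r 1?addrC //; exact: HS.
    rewrite Ew // -uE.
    apply: (le_trans (cmod_sqrt_le (rbf_ip_le h1 (HS _ Hw)))).
    rewrite sqrtrM ?energy_ge0 // -/B.
    have : Num.sqrt (energy (fun z => u n z - f z)) <= e / (B + 1).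
      rewrite -[e / (B + 1)]ger0_norm; last by rewrite ltW // divr_gt0.
      by rewrite -sqrtr_sqr ler_sqrt // sqr_ge0.
    move=> h; rewrite (le_trans (ler_wpM2r B0 h)) // mulrAC ler_pdivrMr //.
    by rewrite ler_wpM2l ?(ltW e0) // lerDl.
  apply/cvgrPdist_le => e e0; have [n0 Hn] := dist e e0; exists n0 => // n /Hn[_ h].
  rewrite /= sub0r normrN /ip_dist ip_normE ger0_norm ?sqrtr_ge0 //.
  by rewrite -(ger0_norm (ltW e0)) -sqrtr_sqr ler_sqrt // sqr_ge0.
- move=> w; exists (Num.sqrt (energy (K^~ w) + 1)) => f Hf.
  by rewrite cmodE lecR ip_normE bnd.
Qed.

End AbstractReproducing.

(** * The polyanalytic spaces *)

Section LaguerreKernel.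
Variable R : realType.
Local Notation C := R[i].
Local Notation M := (measurableTypeR R).
Local Notation pl := (@plane_measure R).
Implicit Types (f g : C -> C) (z w a c d : C) (b k : nat).

Definition laguerre_kernel b k z w : C :=
  cexp (- ((z - cj w) ^+ 2 / 4)) * laguerre b k ((z - w) * cj (z - w) / 2).

Lemma normc_sqr z : `|z| ^+ 2 = z * cj z.
Proof. by rewrite mulcJ cmodE -(rmorphXn (real_complex R)). Qed.

Lemma K_rbfE N : K_rbf N = laguerre_kernel 1 N.-1.
Proof. by apply/funext => z; apply/funext => w; rewrite /K_rbf normc_sqr. Qed.

Lemma K_true_rbfE l : K_true_rbf l = laguerre_kernel 0 l.-1.
Proof. by apply/funext => z; apply/funext => w; rewrite /K_true_rbf normc_sqr mulrC. Qed.

Lemma laguerreJ b k z : cj (laguerre b k (z * cj z / 2)) = laguerre b k (z * cj z / 2).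
Proof.
rewrite /laguerre conj_sum; apply: eq_bigr => i _.
by rewrite !conjE [cj z * z]mulrC.
Qed.

Lemma entire_gaussian a c d : entire (fun z : C => cexp (a * z ^+ 2 + c * z + d)).
Proof.
have e2 := entireM (entire_cst a) (@entireX R id 2 (@entire_id R)).
have e1 := entireM (entire_cst c) (@entire_id R).
exact: (entire_comp (@entire_cexp R) (entireD (entireD e2 e1) (entire_cst d))).
Qed.

Lemma entireB_cst w : entire (fun z : C => z - w).
Proof. exact: (entireD (@entire_id R) (entire_cst (- w))). Qed.

Lemma conj_poly_laguerre b k w : conj_poly k.+1 (fun z => laguerre_kernel b k z w).
Proof.
pose c (j : nat) : C := (-1) ^+ j * 'C(k + b, k - j)%:R / j`!%:R / 2 ^+ j.
have eh j : entire (fun z => c j * (z - w) ^+ j).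
  exact: (entireM (entire_cst (c j)) (@entireX R (fun z => z - w) j (@entireB_cst w))).
have := conj_polyM (@conj_poly_shift R k.+1 _ (- cj w) eh)
  (@entire_gaussian (- 4^-1) (cj w / 2) (- (cj w ^+ 2 / 4))).
congr conj_poly; apply/funext => z; rewrite /laguerre_kernel; congr (cexp _ * _).
  by field.
rewrite /laguerre; apply: eq_bigr => i _; rewrite /c !conjE !exprMn exprVn.
by ring.
Qed.

(** With w moved to the origin, kernel and weight become the rotation-invariant [laguerre_weight]
    times exponentials that are holomorphic in z. *)
Lemma laguerre_kernel_shift b k z w : cj (laguerre_kernel b k (z + w) w) * rbf_weight (z + w) =
  laguerre_weight b k z * cexp (- (z * cj w / 2)) * cexp (- (w ^+ 2 / 4)) * cexp ((z + w) ^+ 2 / 4).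
Proof.
rewrite /laguerre_kernel addrK conjM laguerreJ cexpJ /laguerre_weight /gauss /rbf_weight.
rewrite mulrAC -cexpD mulrC -!mulrA -!cexpD; congr (_ * cexp _).
by rewrite !conjE; field.
Qed.

(** The exponentials are those left over in [laguerre_kernel_shift]; for g = f e^(z^2/4) they give
    the value f w at z = 0. *)
Definition magnetic (w : C) g z : C := cexp (- (w ^+ 2 / 4)) * g (z + w) * cexp (- (z * cj w / 2)).

Lemma rbf_ip_shift b k f w : square_int f -> square_int (laguerre_kernel b k ^~ w) ->
  let G := magnetic w (fun z => f z * cexp (z ^+ 2 / 4)) in
  cintegrable (fun z => G z * laguerre_weight b k z) /\
  rbf_ip f (laguerre_kernel b k ^~ w) =
    ((2 * pi)^-1)%:C * cintegral (fun z => G z * laguerre_weight b k z).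
Proof.
move=> hf hK G; have iP := square_int_prod hf hK.
have [i1 e1] := cintegral_translation w iP.
have E : (fun z => G z * laguerre_weight b k z) =
    fun z => f (z + w) * cj (laguerre_kernel b k (z + w) w) * rbf_weight (z + w).
  by apply/funext => z; rewrite -mulrA laguerre_kernel_shift /G /magnetic; ring.
by rewrite E /rbf_ip -e1.
Qed.

Lemma magnetic0 f w : magnetic w (fun z => f z * cexp (z ^+ 2 / 4)) 0 = f w.
Proof.
rewrite /magnetic add0r !mul0r oppr0 cexp0 mulr1 mulrCA -cexpD addrC subrr cexp0 mulr1.
by [].
Qed.

(** The squared modulus of the kernel times the weight is e^((Im w)^2) times a translate of the
    squared Laguerre polynomial against the Gaussian, because -Re((z - conj w)^2)/2 - (Im z)^2 = (Im
    w)^2 - |z - w|^2/2. *)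
Lemma laguerre_square_int b k w : square_int (laguerre_kernel b k ^~ w).
Proof.
pose L z : C := laguerre b k (z * cj z / 2).
have iL : cintegrable (fun z => L z * laguerre_weight b k z).
  pose c (j : nat) : C := (-1) ^+ j * 'C(k + b, k - j)%:R / j`!%:R / 2 ^+ j.
  have := (cintegral_sum k.+1 (fun j => cintegrableZ (c j) (laguerre_weight_mono R b k j j))).1.
  congr cintegrable; apply/funext => z; rewrite {1}/L /laguerre mulr_suml.
  by apply: eq_bigr => i _; rewrite /c !exprMn exprVn; ring.
have [i1 _] := cintegral_translation (- w) iL.
have i2 := integrableZl measurableT (expR (complex.Im w ^+ 2)) (cintegrable_cmod i1).
apply: (square_int_le (cmeasurable_conj_poly (conj_poly_laguerre b k w)) i2) => p.
rewrite -/(pt p); move: (pt p) => z; rewrite /sqnorm /laguerre_kernel /wt.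
rewrite /laguerre_weight !cmodM cmod_gauss cmod_cexp /L.
set l := cmod (laguerre _ _ _).
rewrite (_ : _ * _ = l * (l * (expR (complex.Re (- ((z - cj w) ^+ 2 / 4))) ^+ 2 *
  expR (- complex.Im z ^+ 2)))); last by ring.
rewrite (_ : expR (complex.Im w ^+ 2) * _ = l * (l * (expR (complex.Im w ^+ 2) *
  expR (- (cmod (z + - w) ^+ 2 / 2))))); last by ring.
rewrite expr2 -!expRD cmod_sqr le_eqVlt; apply/orP; left; apply/eqP.
by congr (_ * (_ * expR _)); case: z w {l L iL i1 i2} => x y [u v] /=; field.
Qed.

Lemma taylor_coef0 (h : C -> C) : taylor_coef h 0 = h 0.
Proof. by rewrite /taylor_coef /= fact0 divr1. Qed.

Lemma conj_poly_at0 N (h : nat -> C -> C) :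
  \sum_(j < N.+1) h j 0 * cj (0 : C) ^+ j = h 0%N 0.
Proof.
rewrite big_ord_recl expr0 mulr1 big1 ?addr0 // => i _.
by rewrite conj0 exprS mul0r mulr0.
Qed.

Lemma conj_poly_magnetic N w f : conj_poly N f ->
  conj_poly N (magnetic w (fun z => f z * cexp (z ^+ 2 / 4))).
Proof.
move=> [h eh fE].
have eD : entire (fun z : C => z + w) := entireD (@entire_id R) (entire_cst w).
have ek j : entire (fun z => h j (z + w)) := entire_comp (eh j) eD.
have e2 := @entire_gaussian 4^-1 ((w - cj w) / 2) 0.
have := conj_polyM (@conj_poly_shift R N _ (cj w) ek) e2.
congr conj_poly; apply/funext => z; rewrite /magnetic fE.
rewrite (_ : _ * cexp (- (z * cj w / 2)) = (cexp (- (w ^+ 2 / 4)) * cexp ((z + w) ^+ 2 / 4)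
   * cexp (- (z * cj w / 2))) * \sum_(j < N) h j (z + w) * cj (z + w) ^+ j); last by ring.
rewrite -!cexpD; congr (cexp _ * _); first by field.
by apply: eq_bigr => i _; rewrite conjD.
Qed.

(** After the magnetic translation only the moment j = 0 survives, and the constant term of the
    translated function is f w. *)
Lemma polyanalytic_reproducing k f w : conj_poly k.+1 f -> square_int f ->
  f w = rbf_ip f (laguerre_kernel 1 k ^~ w).
Proof.
move=> pf sf; have [+ ->] := rbf_ip_shift sf (laguerre_square_int 1 k w).
have [h eh hE] := conj_poly_magnetic w pf.
have G0 := magnetic0 f w; rewrite hE conj_poly_at0 in G0.
move: hE; set G := magnetic _ _ => hE.
have -> : (fun z => G z * laguerre_weight 1 k z) =
    fun z => (\sum_(j < k.+1) h j z * cj z ^+ j) * laguerre_weight 1 k z.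
  by apply/funext => z; rewrite hE.
move=> iG; rewrite (radial_integral eh (laguerre_weight_rot 1 k) (laguerre_weight_mono R 1 k) iG).
rewrite big_ord_recl big1 ?addr0 => [|i _]; last first.
  by rewrite laguerre_moment laguerre_sum1 ?lift0 /= ?mulr0 // -ltnS ltn_ord.
rewrite taylor_coef0 laguerre_moment laguerre_sum1 //= G0 fact0 expr0 !mulr1.
by rewrite mulrCA -(rmorphM (real_complex R)) mulVf ?mulr1 // gt_eqF // mulr_gt0 ?pi_gt0.
Qed.

End LaguerreKernel.

(** * Membership recovered from the reproducing identity *)

Section Closure.
Variable R : realType.
Local Notation C := R[i].
Local Notation M := (measurableTypeR R).
Local Notation pl := (@plane_measure R).
Implicit Types (f g : C -> C) (z w a c d : C) (b k : nat).

(** All factors of the integrand of <f, K_w> that do not involve w. *)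
Definition fock_density f z : C :=
  ((2 * pi)^-1)%:C * (f z * rbf_weight z * cexp (- (cj z ^+ 2 / 4))).

Lemma rapid_fock_density f : square_int f -> rapid (fock_density f).
Proof.
move=> [mf sf].
have mF : cmeasurable (fock_density f).
  apply: cmeasurableM; first exact: cmeasurable_cst.
  apply: cmeasurableM; first by apply: cmeasurableM => //; exact: cmeasurable_weight.
  apply: cmeasurable_cexp.
  have := cmeasurableM (cmeasurable_cst (- 4^-1)) (cmeasurableX 2 (cmeasurableJ (cmeasurable_id R))).
  by congr cmeasurable; apply/funext => z; field.
split=> // t; have h2 : 0 < (1 / 2 : R) by rewrite divr_gt0.
have := integrableZl measurableT ((2 * pi)^-1)
  (integrableD measurableT sf (integrable_gauss (2 * t) h2)).
apply: le_integrable => //.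
  apply/measurable_EFinP; apply: measurable_funM; first exact: (measurable_cmod mF).
  by apply: measurableT_comp => //; apply: measurable_funM => //; exact: measurable_cmod_pt.
move=> p _; move: (pt p) => z; rewrite /= lee_fin.
have ip := ltW (ipi_gt0 R).
rewrite !ger0_norm ?mulr_ge0 ?addr_ge0 ?sqnorm_ge0 ?expR_ge0 ?cmod_ge0 //.
rewrite /fock_density cmodM cmodR ger0_norm // -mulrA ler_wpM2l // !cmodM cmod_weight cmod_cexp.
rewrite /sqnorm /wt.
set y := complex.Im z; set x := complex.Re z.
have zE : cmod z ^+ 2 = x ^+ 2 + y ^+ 2 by rewrite cmod_sqr.
have -> : complex.Re (- (cj z ^+ 2 / 4)) = - (x ^+ 2 - y ^+ 2) / 4.
  by rewrite /x /y; case: z {zE x y} => x y /=; field.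
(* The integrand is |f| q r with q^2 the weight and r a Gaussian with linear exponent; then |f| q r
   <= (|f| q)^2 + r^2, and both squares are integrable. *)
set q := expR (- y ^+ 2 / 2).
have -> : expR (- y ^+ 2) = q ^+ 2 by rewrite /q [expR _ ^+ 2]expr2 -expRD; congr expR; field.
set r := expR (t * cmod z - cmod z ^+ 2 / 4).
have -> : expR (2 * t * cmod z - 1 / 2 * cmod z ^+ 2) = r ^+ 2.
  by rewrite /r [expR _ ^+ 2]expr2 -expRD; congr expR; field.
have E : q ^+ 2 * expR (- (x ^+ 2 - y ^+ 2) / 4) * expR (t * cmod z) = q * r.
  by rewrite /q /r zE [expR _ ^+ 2]expr2 -!expRD; congr expR; field.
rewrite -[_ ^+ 2 * q ^+ 2]exprMn.
rewrite (_ : _ * expR (t * cmod z) = cmod (f z) * q * r); last by rewrite -[RHS]mulrA -E; ring.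
have := sqr_ge0 (cmod (f z) * q - r).
have : 0 <= cmod (f z) * q * r by rewrite !mulr_ge0 ?cmod_ge0 ?expR_ge0.
by move: (_ * q) => X; nra.
Qed.

(** The conjugate exponent -(conj z - w)^2 / 4 splits into -w^2/4, the term -conj(z)^2/4 hidden in
    [fock_density], and w conj(z)/2. *)
Lemma kernel_fock f b k w : square_int f ->
  rbf_ip f (laguerre_kernel b k ^~ w) = cexp (- (w ^+ 2 / 4)) *
    \sum_(i < k.+1) (-1) ^+ i * 'C(k + b, k - i)%:R / i`!%:R / 2 ^+ i *
       fock_int (fock_density f) i i 0 w.
Proof.
move=> sf; have rF := rapid_fock_density sf.
pose c (j : nat) : C := (-1) ^+ j * 'C(k + b, k - j)%:R / j`!%:R / 2 ^+ j.
have [iS eS] := cintegral_sum k.+1 (fun i => cintegrableZ (c i) (fock_cintegrable i i 0 w rF)).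
have -> : \sum_(i < k.+1) c i * fock_int (fock_density f) i i 0 w =
    cintegral (fun z => \sum_(i < k.+1) c i * fock_kernel (fock_density f) i i 0 z w).
  by rewrite eS; apply: eq_bigr => i _; rewrite cintegralZ //; exact: fock_cintegrable.
rewrite -cintegralZ // /rbf_ip -cintegralZ; last first.
  exact: square_int_prod sf (laguerre_square_int b k w).
congr cintegral; apply/funext => z.
rewrite /laguerre_kernel conjM laguerreJ cexpJ.
have -> : laguerre b k ((z - w) * cj (z - w) / 2) =
    \sum_(i < k.+1) c i * ((w - z) ^+ i * cj (w - z) ^+ i).
  rewrite /laguerre; apply: eq_bigr => i _; rewrite /c -exprMn.
  rewrite (_ : (w - z) * cj (w - z) = (z - w) * cj (z - w)); last by rewrite !conjE; ring.
  by rewrite exprMn exprVn; ring.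
have -> : \sum_(i < k.+1) c i * fock_kernel (fock_density f) i i 0 z w =
    fock_density f z * (cexp (w * (cj z / 2)) *
      \sum_(i < k.+1) c i * ((w - z) ^+ i * cj (w - z) ^+ i)).
  rewrite !mulr_sumr; apply: eq_bigr => i _; rewrite /fock_kernel expr0; ring.
rewrite /fock_density; move: (\sum_(i < _) _) => s.
rewrite (_ : cj (- ((z - cj w) ^+ 2 / 4)) =
  - (w ^+ 2 / 4) + (- (cj z ^+ 2 / 4)) + w * (cj z / 2)); last by rewrite !conjE; field.
by rewrite !cexpD; ring.
Qed.

(** Each d/d(conj w) lowers b by one and kills the integral at b = 0; [conj_poly_of_dzbar]
    integrates this back. *)
Lemma conj_poly_fock_int (F : C -> C) (a b : nat) : rapid F -> conj_poly b.+1 (fock_int F a b 0).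
Proof.
move=> rF; have W := fun b w => wirt_fock_int a b 0 w rF.
elim: b => [|b IH]; apply: (conj_poly_of_dzbar (W _)).
  by have := conj_poly0 R 0; congr conj_poly; apply/funext => w; rewrite mul0r.
exact: (conj_polyM IH (entire_cst _)).
Qed.

Lemma conj_poly_sum n N (F : nat -> C -> C) : (forall i, (i < n)%N -> conj_poly N (F i)) ->
  conj_poly N (fun z => \sum_(i < n) F i z).
Proof.
elim: n => [|n IH] H.
  by have := conj_poly0 R N; congr conj_poly; apply/funext => z; rewrite big_ord0.
have := conj_polyD (IH (fun i ni => H i (ltnW ni))) (H n (ltnSn n)).
by congr conj_poly; apply/funext => z; rewrite big_ord_recr.
Qed.

Lemma polyanalytic_of_reproducing k f : square_int f ->
  (forall w, f w = rbf_ip f (laguerre_kernel 1 k ^~ w)) -> conj_poly k.+1 f.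
Proof.
move=> sf fE; have rF := rapid_fock_density sf.
have -> : f = fun w => cexp (- (w ^+ 2 / 4)) * \sum_(i < k.+1)
    (-1) ^+ i * 'C(k + 1, k - i)%:R / i`!%:R / 2 ^+ i * fock_int (fock_density f) i i 0 w.
  by apply/funext => w; rewrite {1}fE kernel_fock.
have eE : entire (fun w : C => cexp (- (w ^+ 2 / 4))).
  have := @entire_gaussian R (- 4^-1) 0 0; congr entire; apply/funext => w; congr cexp.
  by field.
apply: conj_polyM eE.
apply: (@conj_poly_sum k.+1 k.+1 (fun i w => (-1) ^+ i * 'C(k + 1, k - i)%:R / i`!%:R / 2 ^+ i *
  fock_int (fock_density f) i i 0 w)) => i ik.
exact: (conj_poly_mono ik (conj_polyM (conj_poly_fock_int i i rF) (entire_cst _))).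
Qed.

Lemma polyanalytic_rbfP k f :
  polyanalytic_rbf k.+1 f <-> conj_poly k.+1 f /\ square_int f.
Proof.
split=> [[pf nf]|[cf sf]].
  have cf := polyanalytic_conj_poly pf; split=> //.
  by apply/square_intP => //; exact: cmeasurable_conj_poly cf.
split; first exact: conj_poly_polyanalytic.
by apply/square_intP => //; exact: cmeasurable_conj_poly cf.
Qed.

Lemma polyanalytic_reproducing_kernel k :
  reproducing_kernel (polyanalytic_rbf k.+1) (@rbf_ip R) (laguerre_kernel 1 k).
Proof.
move=> w; split.
  by apply/polyanalytic_rbfP; split; [exact: conj_poly_laguerre|exact: laguerre_square_int].
by move=> f /polyanalytic_rbfP[cf sf]; exact: polyanalytic_reproducing.
Qed.

Lemma polyanalytic_rkhs k : rkhs (@polyanalytic_rbf R k.+1) (@rbf_ip R).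
Proof.
apply: rkhs_of_reproducing (@polyanalytic_reproducing_kernel k) _.
- by move=> f /polyanalytic_rbfP[].
- split.
    by apply/polyanalytic_rbfP; split; [exact: conj_poly0|exact: square_int0].
  move=> a f g /polyanalytic_rbfP[cf sf] /polyanalytic_rbfP[cg sg].
  apply/polyanalytic_rbfP; split; last exact: square_int_lin.
  exact: (conj_polyD (conj_polyM cf (entire_cst a)) cg).
- by move=> f sf fE; apply/polyanalytic_rbfP; split=> //; exact: polyanalytic_of_reproducing.
Qed.

End Closure.

(** * The true polyanalytic spaces *)

Section Landau.
Variable R : realType.
Local Notation C := R[i].
Implicit Types (f g h : C -> C) (z w a c d : C) (b k p q : nat).

(** Differentiation in z commutes with multiplication by conj z, so the k-th power of d/dz -
    conj(z)/2 expands binomially; conjugation by the Gaussian turns this operator into d/dz. *)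
Definition landau k h z : C :=
  \sum_(p < k.+1) 'C(k, p)%:R * (iter p (@dz R) h z * (- (cj z / 2)) ^+ (k - p)).

Lemma wirt_gauss z : exists b : C, wirt (@gauss R) z (- (cj z / 2) * gauss z) b.
Proof.
eexists; have W := wirt_comp (wirtN (wirtM (wirtM (wirt_id z) (wirt_conj z))
  (wirt_cst 2^-1 z))) (wirt_cexp (- (z * cj z / 2))).
apply: wirt_eq W; last by reflexivity.
by rewrite /gauss !conjE; ring.
Qed.

Lemma binomial_step (A : nat -> nat -> C) k :
  \sum_(p < k.+1) 'C(k, p)%:R * (A p.+1 (k - p)%N + A p (k - p).+1) =
  \sum_(p < k.+2) 'C(k.+1, p)%:R * A p (k.+1 - p)%N.
Proof.
under eq_bigr do rewrite mulrDr.
rewrite big_split /= addrC [RHS]big_ord_recl /=.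
under [in RHS]eq_bigr => i _ do rewrite /bump add1n binS natrD mulrDl subSS.
rewrite big_split /= addrA; congr (_ + _).
rewrite [in RHS]big_ord_recr /= (@bin_small k k.+1) // mul0r addr0 big_ord_recl /= !bin0 subn0.
by congr (_ + _); apply: eq_bigr => i _; rewrite /bump add1n subnSK.
Qed.

(** The hypothesis says that d/dz - conj(z)/2 sends X p q to X p.+1 q + X p q.+1, as if it were the
    sum of two commuting operators counted by p and q. *)
Lemma iter_dz_gauss (X : nat -> nat -> C -> C) :
  (forall p q u, exists b : C,
     wirt (X p q) u (X p.+1 q u + X p q.+1 u + cj u / 2 * X p q u) b) ->
  forall k, iter k (@dz R) (fun u => X 0%N 0%N u * gauss u) =
    fun z => (\sum_(p < k.+1) 'C(k, p)%:R * X p (k - p)%N z) * gauss z.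
Proof.
move=> HX; elim=> [|k IH].
  by apply/funext => z; rewrite /= big_ord_recl big_ord0 addr0 mul1r.
rewrite iterS IH; apply/funext => z; have [bg Wg] := wirt_gauss z.
have H p q := cid (HX p q z).
have W := @wirt_sum R _ (index_enum 'I_k.+1) xpredT (fun (p : 'I_k.+1) u => 'C(k, p)%:R * X p (k - p)%N u)
  (fun (p : 'I_k.+1) u => 'C(k, p)%:R * (X p.+1 (k - p)%N u + X p (k - p).+1 u + cj u / 2 * X p (k - p)%N u))
  (fun (p : 'I_k.+1) u => 'C(k, p)%:R * projT1 (H p (k - p)%N)) z
  (fun p : 'I_k.+1 => wirtZ _ (projT2 (H p (k - p)%N))).
rewrite (wirt_dz (wirtM W Wg)) -(binomial_step (fun p q => X p q z)).
rewrite (_ : \sum_(p < k.+1) _ * (X p.+1 _ z + _ + _) =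
  \sum_(p < k.+1) 'C(k, p)%:R * (X p.+1 (k - p)%N z + X p (k - p).+1 z)
  + cj z / 2 * \sum_(p < k.+1) 'C(k, p)%:R * X p (k - p)%N z); last first.
  by rewrite mulr_sumr -big_split; apply: eq_bigr => i _ /=; ring.
by ring.
Qed.

Lemma iter_dz_landau k h : entire h ->
  iter k (@dz R) (fun u => h u * gauss u) = fun z => landau k h z * gauss z.
Proof.
move=> eh; have := @iter_dz_gauss (fun p q u => iter p (@dz R) h u * (- (cj u / 2)) ^+ q).
rewrite (_ : (fun u => iter 0 (@dz R) h u * (- (cj u / 2)) ^+ 0 * gauss u) =
  fun u => h u * gauss u); last by apply/funext => u; rewrite mulr1.
move=> -> // p q u; eexists.
have W1 := wirtX q (wirtN (wirtM (wirt_conj u) (wirt_cst 2^-1 u))).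
have W2 := wirtM (wirt_entire_dz u (@entire_iter_dz R h p eh)) W1.
apply: wirt_eq W2; last by reflexivity.
by rewrite iterS [_ ^+ q.+1]exprS; ring.
Qed.

(** The same power of the operator may be expanded along any such array. Suitable arrays settle the
    commutation with translations, the membership of the kernel and the closure of the space. *)
Lemma landau_eq (X : nat -> nat -> C -> C) k z : entire (X 0%N 0%N) ->
  (forall p q u, exists b : C,
     wirt (X p q) u (X p.+1 q u + X p q.+1 u + cj u / 2 * X p q u) b) ->
  landau k (X 0%N 0%N) z = \sum_(p < k.+1) 'C(k, p)%:R * X p (k - p)%N z.
Proof.
move=> eX HX; have := iter_dz_gauss HX k; rewrite iter_dz_landau // => E.
by apply: (mulIf (cexp_neq0 (- (z * cj z / 2)))); exact: (congr1 (@^~ z) E).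
Qed.

Lemma binomial_rev (A : nat -> nat -> C) k :
  \sum_(p < k.+1) 'C(k, p)%:R * A p (k - p)%N = \sum_(j < k.+1) 'C(k, j)%:R * A (k - j)%N j.
Proof.
rewrite (reindex_inj rev_ord_inj) /=; apply: eq_bigr => i _; rewrite subSS.
have ik : (i <= k)%N by rewrite -ltnS.
by rewrite bin_sub // subKn.
Qed.

Lemma iter_dz_lin p a g h : entire g -> entire h ->
  iter p (@dz R) (fun u => a * g u + h u) =
  fun z => a * iter p (@dz R) g z + iter p (@dz R) h z.
Proof.
move=> eg eh; elim: p => [|p IH] //; rewrite iterS IH; apply/funext => z.
exact: wirt_dz (wirtD (wirtZ a (wirt_entire_dz z (@entire_iter_dz R g p eg)))
  (wirt_entire_dz z (@entire_iter_dz R h p eh))).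
Qed.

Lemma landau_lin k a g h z : entire g -> entire h ->
  landau k (fun u => a * g u + h u) z = a * landau k g z + landau k h z.
Proof.
move=> eg eh; rewrite /landau mulr_sumr -big_split; apply: eq_bigr => p _ /=.
by rewrite iter_dz_lin //; ring.
Qed.

Lemma iter_dz0 p : iter p (@dz R) (fun=> 0) = fun=> 0.
Proof.
elim: p => [|p IH] //; rewrite iterS IH; apply/funext => z; exact: wirt_dz (wirt_cst 0 z).
Qed.

Lemma landau0 k z : landau k (fun=> 0) z = 0.
Proof. by rewrite /landau big1 // => p _; rewrite iter_dz0 mul0r mulr0. Qed.

Lemma landauZ k a h z : entire h -> landau k (fun u => a * h u) z = a * landau k h z.
Proof.
move=> eh; have := landau_lin k a z eh (entire_cst 0); rewrite landau0 addr0 => <-.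
by congr landau; apply/funext => u; rewrite addr0.
Qed.

Lemma landau_conj_poly k h z : landau k h z =
  \sum_(j < k.+1) ('C(k, j)%:R * (- 2^-1) ^+ j * iter (k - j) (@dz R) h z) * cj z ^+ j.
Proof.
rewrite /landau (binomial_rev (fun p q => iter p (@dz R) h z * (- (cj z / 2)) ^+ q)).
apply: eq_bigr => j _; rewrite (_ : - (cj z / 2) = - 2^-1 * cj z); last by ring.
by rewrite exprMn; ring.
Qed.

End Landau.

(** * Reproducing property and closure for the true polyanalytic spaces *)

Section TrueSpaces.
Variable R : realType.
Local Notation C := R[i].
Implicit Types (f g h : C -> C) (z w a c d : C) (b k p q : nat).

Definition landau_fun k h z : C := cexp (- (z ^+ 2 / 4)) * landau k h z.

Lemma conj_poly_landau k h : entire h -> conj_poly k.+1 (landau k h).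
Proof.
move=> eh; exists (fun (j : nat) z => 'C(k, j)%:R * (- 2^-1) ^+ j * iter (k - j) (@dz R) h z).
  by move=> j; exact: (entireM (entire_cst _) (@entire_iter_dz R h (k - j) eh)).
by move=> z; rewrite landau_conj_poly.
Qed.

Lemma conj_poly_landau_fun k h : entire h -> conj_poly k.+1 (landau_fun k h).
Proof.
move=> eh; have := conj_polyM (conj_poly_landau k eh) (@entire_gaussian R (- 4^-1) 0 0).
congr conj_poly; apply/funext => z; rewrite /landau_fun; congr (cexp _ * _).
by field.
Qed.

(** The normalising constant 2^k / sqrt(k!) is nonzero and is absorbed into h; the Gaussian factors
    cancel. *)
Lemma true_rbfP k f : true_polyanalytic_rbf k.+1 f <->
  square_int f /\ exists2 h, entire h & forall z, f z = landau_fun k h z.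
Proof.
pose c : C := 2 ^+ k / sqrtC k`!%:R.
have c0 : c != 0.
  by rewrite mulf_neq0 ?expf_neq0 ?invr_eq0 ?sqrtC_eq0 ?pnatr_eq0 // -lt0n fact_gt0.
have E h z : entire h -> c * cexp (`|z| ^+ 2 / 2 - z ^+ 2 / 4) *
    iter k (@dz R) (fun u => h u * cexp (- (`|u| ^+ 2 / 2))) z = c * landau_fun k h z.
  move=> eh; rewrite (_ : (fun u => h u * cexp (- (`|u| ^+ 2 / 2))) = fun u => h u * gauss u).
    rewrite iter_dz_landau // normc_sqr /landau_fun /gauss cexpD.
    rewrite (_ : _ * (_ * _) * (landau k h z * _) = c * (cexp (- (z ^+ 2 / 4)) * landau k h z)
      * (cexp (z * cj z / 2) * cexp (- (z * cj z / 2)))); last by ring.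
    by rewrite -[cexp (z * cj z / 2) * _]cexpD subrr cexp0 mulr1.
  by apply/funext => u; rewrite normc_sqr.
have M h : entire h -> forall f, (forall z, f z = landau_fun k h z) -> cmeasurable f.
  move=> eh g gE; have := cmeasurable_conj_poly (conj_poly_landau_fun k eh).
  by congr cmeasurable; apply/funext => z; rewrite gE.
split=> [[nf [h eh fE]]|[sf [h eh fE]]].
  have ech : entire (fun z => c * h z) := entireM (entire_cst c) eh.
  have fE' z : f z = landau_fun k (fun z => c * h z) z.
    by rewrite fE E // /landau_fun landauZ // mulrCA.
  by split; [apply/square_intP => //; exact: M fE'|exists (fun z => c * h z)].
split; first by apply/square_intP => //; exact: M fE.
exists (fun z => c^-1 * h z); first exact: (entireM (entire_cst c^-1) eh).
move=> z; rewrite E; last exact: (entireM (entire_cst c^-1) eh).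
by rewrite /landau_fun landauZ // mulrCA mulVKf // fE.
Qed.

(* landau k is the k-th power of d/dz - cj z / 2, an operator that commutes with
   magnetic translations. *)
Lemma landau_magnetic k h w z : entire h ->
  landau k h (z + w) * cexp (- (z * cj w / 2)) =
  landau k (fun u => h (u + w) * cexp (- (u * cj w / 2))) z.
Proof.
move=> eh.
(* Differentiating the exponential gives -conj(w)/2, and subtracting conj(u)/2 completes it to
   -conj(u + w)/2, the factor counted by q. *)
pose X p q u : C := iter p (@dz R) h (u + w) * (- (cj (u + w) / 2)) ^+ q * cexp (- (u * cj w / 2)).
have -> : (fun u => h (u + w) * cexp (- (u * cj w / 2))) = X 0%N 0%N.
  by apply/funext => u; rewrite /X /= mulr1.
rewrite (@landau_eq R X).
- by rewrite /landau mulr_suml; apply: eq_bigr => p _; rewrite /X; ring.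
- have e1 := @entire_gaussian R 0 (- (cj w / 2)) 0.
  have e2 : entire (fun z : C => z + w) := entireD (@entire_id R) (entire_cst w).
  have := entireM (entire_comp eh e2) e1; congr entire; apply/funext => u.
  by rewrite /X /= mulr1; congr (_ * cexp _); ring.
- move=> p q u; eexists.
  have W0 := wirtD (wirt_id u) (wirt_cst w u).
  have W1 := wirt_comp W0 (wirt_entire_dz (u + w) (@entire_iter_dz R h p eh)).
  have W2 := wirtX q (wirtN (wirtM (wirt_comp W0 (wirt_conj (u + w))) (wirt_cst 2^-1 u))).
  have W3 := wirt_comp (wirtN (wirtM (wirtM (wirt_id u) (wirt_cst (cj w) u)) (wirt_cst 2^-1 u)))
    (wirt_cexp (- (u * cj w / 2))).
  apply: wirt_eq (wirtM (wirtM W1 W2) W3); last by reflexivity.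
  by rewrite /X iterS [_ ^+ q.+1]exprS !conjE; ring.
Qed.

(** Only the moment j = k survives. The top coefficient is (-1/2)^k H, so its k-th Taylor
    coefficient is (-1/2)^k f(w) / k!, and the moment 2^k k! (-1)^k undoes these constants. *)
Lemma true_reproducing k f w : true_polyanalytic_rbf k.+1 f ->
  f w = rbf_ip f (laguerre_kernel 0 k ^~ w).
Proof.
move=> /true_rbfP[sf [h eh fE]]; have [+ ->] := rbf_ip_shift sf (laguerre_square_int 0 k w).
have G0 := magnetic0 f w; set G := magnetic _ _ in G0 *.
pose H u : C := cexp (- (w ^+ 2 / 4)) * (h (u + w) * cexp (- (u * cj w / 2))).
have eH0 : entire (fun u => h (u + w) * cexp (- (u * cj w / 2))).
  have e1 := @entire_gaussian R 0 (- (cj w / 2)) 0.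
  have e2 : entire (fun z : C => z + w) := entireD (@entire_id R) (entire_cst w).
  have := entireM (entire_comp eh e2) e1; congr entire; apply/funext => u.
  by congr (_ * cexp _); ring.
have eH : entire H := entireM (entire_cst _) eH0.
have GE z : G z = landau k H z.
  have e : cexp (- ((z + w) ^+ 2 / 4)) * cexp ((z + w) ^+ 2 / 4) = 1 by rewrite -cexpD addNr cexp0.
  rewrite landauZ // -landau_magnetic // /G /magnetic fE /landau_fun.
  transitivity (cexp (- (w ^+ 2 / 4)) * (landau k h (z + w) * cexp (- (z * cj w / 2))) *
    (cexp (- ((z + w) ^+ 2 / 4)) * cexp ((z + w) ^+ 2 / 4))); first by ring.
  by rewrite e mulr1.
pose hj (j : nat) z : C := 'C(k, j)%:R * (- 2^-1) ^+ j * iter (k - j) (@dz R) H z.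
have ehj j : entire (hj j) := entireM (entire_cst _) (@entire_iter_dz R H (k - j) eH).
have -> : (fun z => G z * laguerre_weight 0 k z) =
    fun z => (\sum_(j < k.+1) hj j z * cj z ^+ j) * laguerre_weight 0 k z.
  by apply/funext => z; rewrite GE landau_conj_poly.
move=> iG; rewrite (radial_integral ehj (laguerre_weight_rot 0 k) (laguerre_weight_mono R 0 k) iG).
rewrite big_ord_recr big1 ?add0r => [|i _]; last first.
  rewrite laguerre_moment laguerre_sum0; last exact: ltnW (ltn_ord i).
  by rewrite (ltn_eqF (ltn_ord i)) !mulr0.
(* At 0 all positive powers of conj z vanish, and the term j = 0 of [landau k H] is the k-th
   derivative of H. *)
have D0 : iter k (@dz R) H 0 = f w.
  rewrite -G0 GE landau_conj_poly (@conj_poly_at0 R k hj) /hj.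
  by rewrite bin0 subn0 expr0 !mul1r.
have TC : taylor_coef (hj k) k = (- 2^-1) ^+ k * f w / k`!%:R.
  rewrite /taylor_coef /hj subnn binn mul1r /=; congr (_ / _).
  have := iter_dz_lin k ((- 2^-1) ^+ k) eH (entire_cst 0) => /(congr1 (@^~ 0)).
  rewrite iter_dz0 addr0 -D0 => <-; congr (iter _ _ _ _).
  by apply/funext => u; rewrite addr0.
rewrite /= TC laguerre_moment laguerre_sum0 // eqxx.
have k0 : k`!%:R != 0 :> C by rewrite pnatr_eq0 -lt0n fact_gt0.
rewrite (_ : (- 2^-1) ^+ k * f w / k`!%:R * _ = (2 * pi)%:C * f w *
  ((- 2^-1) * 2 * (-1)) ^+ k * (k`!%:R / k`!%:R)); last by rewrite !exprMn; ring.
rewrite divff // (_ : - 2^-1 * 2 * -1 = 1 :> C); last by field.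
rewrite expr1n !mulr1 add0r mulrA -(rmorphM (real_complex R)) mulVf ?mul1r //.
by rewrite gt_eqF // mulr_gt0 ?pi_gt0.
Qed.

Lemma laguerre0E k (x : C) : laguerre 0 k x =
  \sum_(j < k.+1) 'C(k, j)%:R * ((- x) ^+ j / j`!%:R).
Proof.
apply: eq_bigr => j _; rewrite addn0 bin_sub; last by rewrite -ltnS ltn_ord.
by rewrite [(- x) ^+ j]exprNn; ring.
Qed.

Lemma ffact_div (k j : nat) : (j <= k)%N -> (k ^_ (k - j))%:R = k`!%:R / j`!%:R :> C.
Proof.
move=> jk; have j0 : j`!%:R != 0 :> C by rewrite pnatr_eq0 -lt0n fact_gt0.
by rewrite -(ffact_fact (leq_subr j k)) subKn // natrM mulfK.
Qed.

(** The kernel is generated by h(u) = (u - w)^k e^(u conj(w)/2), up to a constant: p derivatives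
    fall on the power, and conj(w)/2 - conj(u)/2 = -conj(u - w)/2 supplies the factors counted by
    q. *)
Lemma true_laguerre_kernel k w : true_polyanalytic_rbf k.+1 (laguerre_kernel 0 k ^~ w).
Proof.
apply/true_rbfP; split; first exact: laguerre_square_int.
pose X p q u : C := (k ^_ p)%:R * (u - w) ^+ (k - p) * (- (cj (u - w) / 2)) ^+ q *
  cexp (u * cj w / 2).
have eX : entire (X 0%N 0%N).
  have e1 := @entire_gaussian R 0 (cj w / 2) 0.
  have := entireM (@entireX R (fun z => z - w) k (@entireB_cst R w)) e1.
  congr entire; apply/funext => u; rewrite /X ffactn0 mul1r subn0 expr0 mulr1.
  by congr (_ * cexp _); ring.
pose c : C := cexp (- (cj w ^+ 2 / 4)) / k`!%:R.
exists (fun u => c * X 0%N 0%N u); first exact: (entireM (entire_cst c) eX).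
move=> z; rewrite /landau_fun landauZ // (@landau_eq R X) //.
  rewrite (binomial_rev (fun p q => X p q z)) /laguerre_kernel laguerre0E.
  have k0 : k`!%:R != 0 :> C by rewrite pnatr_eq0 -lt0n fact_gt0.
  rewrite (_ : - ((z - cj w) ^+ 2 / 4) = - (z ^+ 2 / 4) + (- (cj w ^+ 2 / 4)) + z * cj w / 2);
    last by field.
  rewrite !cexpD /c !mulr_sumr; apply: eq_bigr => j _.
  have jk : (j <= k)%N by rewrite -ltnS.
  rewrite /X ffact_div // subKn // (_ : - ((z - w) * cj (z - w) / 2) =
    (z - w) * (- (cj (z - w) / 2))); last by ring.
  have j0 : j`!%:R != 0 :> C by rewrite pnatr_eq0 -lt0n fact_gt0.
  rewrite exprMn; move: (k`!%:R) (j`!%:R) k0 j0 => x y x0 y0.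
  by field; rewrite x0 y0.
move=> p q u; eexists.
have W0 := wirtB (wirt_id u) (wirt_cst w u).
have W1 := wirtX (k - p) W0.
have W2 := wirtX q (wirtN (wirtM (wirt_comp W0 (wirt_conj (u - w))) (wirt_cst 2^-1 u))).
have W3 := wirt_comp (wirtM (wirtM (wirt_id u) (wirt_cst (cj w) u)) (wirt_cst 2^-1 u))
  (wirt_cexp (u * cj w / 2)).
apply: wirt_eq (wirtM (wirtM (wirtZ (k ^_ p)%:R W1) W2) W3); last by reflexivity.
by rewrite /X ffactnSr natrM subnS [_ ^+ q.+1]exprS !conjE; ring.
Qed.

(** The generating function is the integral with exponents (k, 0), entire since b = 0; the operator
    lowers a or raises b, and after k steps the Laguerre combination of exponents (j, j) appears. *)
Lemma true_of_reproducing k f : square_int f ->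
  (forall w, f w = rbf_ip f (laguerre_kernel 0 k ^~ w)) -> true_polyanalytic_rbf k.+1 f.
Proof.
move=> sf fE; have rF := rapid_fock_density sf; apply/true_rbfP; split=> //.
pose J (a b : nat) := fock_int (fock_density f) a b 0.
pose X p q u : C := (k ^_ p)%:R * (- 2^-1) ^+ q * J (k - p)%N q u.
have eX : entire (X 0%N 0%N).
  apply/entire_wirtP => u; eexists.
  apply: wirt_eq (wirtZ ((k ^_ 0)%:R * (- 2^-1) ^+ 0) (wirt_fock_int (k - 0) 0 0 u rF)).
    by reflexivity.
  by rewrite mul0r mulr0.
(* Writing conj z as conj u - conj(u - z) trades the index c, which d/dw raises, for the index b and
   the term in conj(u)/2 that [landau_eq] expects. *)
have JS (a b : nat) u : J a b.+1 u = cj u * J a b u - fock_int (fock_density f) a b 1 u.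
  have i0 := fock_cintegrable a b 0 u rF; have i1 := fock_cintegrable a b 1 u rF.
  rewrite -mulN1r -(cintegralZ (cj u) i0) -(cintegralZ (-1) i1) -cintegralD;
    [|exact: cintegrableZ|exact: cintegrableZ].
  congr cintegral; apply/funext => z; rewrite /fock_kernel exprS conjD conjN expr0 expr1.
  by ring.
exists (fun u => k`!%:R^-1 * X 0%N 0%N u); first exact: (entireM (entire_cst _) eX).
have k0 : k`!%:R != 0 :> C by rewrite pnatr_eq0 -lt0n fact_gt0.
move=> z; rewrite /landau_fun landauZ // (@landau_eq R X) //.
  rewrite (binomial_rev (fun p q => X p q z)) fE kernel_fock //; congr (_ * _).
  rewrite mulr_sumr; apply: eq_bigr => j _.
  have jk : (j <= k)%N by rewrite -ltnS.
  rewrite /X ffact_div // subKn // addn0 bin_sub // [(- 2^-1) ^+ j]exprNn exprVn.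
  have j0 : j`!%:R != 0 :> C by rewrite pnatr_eq0 -lt0n fact_gt0.
  have p0 : 2 ^+ j != 0 :> C by rewrite expf_neq0 // pnatr_eq0.
  rewrite -/(J j j z); move: (k`!%:R) (j`!%:R) (2 ^+ j) k0 j0 p0 => x y t x0 y0 t0.
  by field; rewrite x0 y0 t0.
move=> p q u; eexists.
apply: wirt_eq (wirtZ ((k ^_ p)%:R * (- 2^-1) ^+ q) (wirt_fock_int (k - p) q 0 u rF)).
  by rewrite /X JS ffactnSr natrM subnS [_ ^+ q.+1]exprS -/(J _ _ u) -/(J _ _ u); field.
by reflexivity.
Qed.

Lemma true_reproducing_kernel k :
  reproducing_kernel (true_polyanalytic_rbf k.+1) (@rbf_ip R) (laguerre_kernel 0 k).
Proof.
by move=> w; split; [exact: true_laguerre_kernel|move=> f; exact: true_reproducing].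
Qed.

Lemma true_rkhs k : rkhs (@true_polyanalytic_rbf R k.+1) (@rbf_ip R).
Proof.
apply: rkhs_of_reproducing (@true_reproducing_kernel k) _.
- by move=> f /true_rbfP[].
- split.
    apply/true_rbfP; split; first exact: square_int0.
    by exists (fun=> 0) => [|z]; [exact: entire_cst|rewrite /landau_fun landau0 mulr0].
  move=> a f g /true_rbfP[sf [h eh fE]] /true_rbfP[sg [j ej gE]].
  apply/true_rbfP; split; first exact: square_int_lin.
  exists (fun z => a * h z + j z); first exact: (entireD (entireM (entire_cst a) eh) ej).
  by move=> z; rewrite fE gE /landau_fun landau_lin //; ring.
- by move=> f sf fE; exact: true_of_reproducing.
Qed.

End TrueSpaces.

Theorem theorem4p22 (R : realType) (N : nat) (hN : (0 < N)%N) :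
  [/\ rkhs (polyanalytic_rbf N) (@rbf_ip R),
      reproducing_kernel (polyanalytic_rbf N) (@rbf_ip R) (K_rbf N),
      forall (f : R[i] -> R[i]) (w : R[i]), polyanalytic_rbf N f ->
        cintegrable
          (fun z => f z * (K_rbf N z w)^*%C * cexp ((z - z^*%C) ^+ 2 / 4)) /\
        f w = ((2 * pi)^-1)%:C *
          cintegral
            (fun z => f z * (K_rbf N z w)^*%C * cexp ((z - z^*%C) ^+ 2 / 4)) &
      forall l : nat, (1 <= l <= N)%N ->
        rkhs (true_polyanalytic_rbf l) (@rbf_ip R) /\
        reproducing_kernel (true_polyanalytic_rbf l) (@rbf_ip R)
          (K_true_rbf l)].
Proof.
case: N hN => // k _; rewrite K_rbfE; split.
- exact: polyanalytic_rkhs.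
- exact: polyanalytic_reproducing_kernel.
- move=> f w /polyanalytic_rbfP[cf sf]; split.
    exact: square_int_prod sf (laguerre_square_int 1 k w).
  exact: polyanalytic_reproducing.
- move=> [|l] // _; rewrite K_true_rbfE; split; first exact: true_rkhs.
  exact: true_reproducing_kernel.
Qed.
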